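(* Let $\boldsymbol{k}\in\mathbb{Z}_+^m$ be a partition of $n$ with $m\geq 2$ and let $j_1,j_2\in\{1,\dots,m\}$ be two different indices. Let $a,b\in L^\infty(\mathbb{B}^n)$ be given. If $a$ is $\mathrm{U}(\boldsymbol{k},j_1,\mathbb{T})$-invariant and $b$ is $\mathrm{U}(\boldsymbol{k},j_2,\mathbb{T})$-invariant (that is, $a$ and $b$ are quasi-radial quasi-homogeneous symbols for the subgroups $\mathrm{U}(\boldsymbol{k},j_1,\mathbb{T})$ and $\mathrm{U}(\boldsymbol{k},j_2,\mathbb{T})$, respectively), then \[ T_a^{(\lambda)}T_b^{(\lambda)} = T_b^{(\lambda)}T_a^{(\lambda)} \] for every $\lambda>-1$.
   Context: Here $\mathbb{Z}_+$ is the set of positive integers. $\mathbb{B}^n$ is the open unit ball of $\mathbb{C}^n$ with Lebesgue measure $v$. For $\lambda>-1$, $dv_\lambda(z) = c_\lambda (1-|z|^2)^\lambda dv(z)$ with $c_\lambda = \frac{\Gamma(n+\lambda+1)}{\pi^n\Gamma(\lambda+1)}$, and $\mathcal{A}^2_\lambda(\mathbb{B}^n)$ is the closed subspace of holomorphic functions in $L^2(\mathbb{B}^n,v_\lambda)$, with orthogonal projection $B_\lambda$. For $a\in L^\infty(\mathbb{B}^n)$ the Toeplitz operator is $T_a^{(\lambda)}(f)=B_\lambda(af)$ on $\mathcal{A}^2_\lambda(\mathbb{B}^n)$. For a subgroup $H\subset\mathrm{U}(n)$, a symbol $a\in L^\infty(\mathbb{B}^n)$ is $H$-invariant if $a\circ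 A=a$ for all $A\in H$. A partition of $n$ is $\boldsymbol{k}=(k_1,\dots,k_m)\in\mathbb{Z}_+^m$ with $k_1+\dots+k_m=n$. For $j\in\{1,\dots,m\}$, $\mathrm{U}(\boldsymbol{k},j,\mathbb{T}) = \mathrm{U}(k_1)\times\dots\times\mathrm{U}(k_{j-1})\times\mathbb{T}I_{(j)}\times\mathrm{U}(k_{j+1})\times\dots\times\mathrm{U}(k_m)$, embedded block diagonally in $\mathrm{U}(n)$, where $I_{(j)}$ is the identity of $\mathbb{C}^{k_j}$ and $\mathbb{T}$ is the group of unit complex numbers. *)

(* Defs.v *)
From HB Require Import structures.
From mathcomp Require Import all_boot all_order all_algebra spectral.
From mathcomp Require Import complex.
From mathcomp Require Import all_classical all_reals all_analysis.

Set Implicit Arguments.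
Unset Strict Implicit.
Unset Printing Implicit Defensive.

Import Order.TTheory GRing.Theory Num.Theory.
Import numFieldNormedType.Exports.

Local Open Scope classical_set_scope.
Local Open Scope ring_scope.
Local Open Scope complex_scope.

(* R[i] as a normed space over itself: [differentiable] on maps
   'cV[R[i]]_n -> R[i] is then complex (Frechet) differentiability. *)
HB.instance Definition _ (R : realType) := GRing.ComAlgebra.copy R[i] R[i]^o.
HB.instance Definition _ (R : realType) := NormedModule.copy R[i] R[i]^o.

(* The sigma-algebra of R[i] is that of R * R; the one of matrices is the
   product sigma-algebra. On R[i] and 'cV[R[i]]_n they are the Borel ones. *)
Definition measure_complex_display : measure_display.
Proof. exact: default_measure_display. Qed.

Section measurable_complex.
Variable R : realType.

Definition pair_of_complex (z : R[i]) : R * R := (complex.Re z, complex.Im z).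

Let sa : sigma_algebra setT
  (preimage_set_system [set: R[i]] pair_of_complex measurable).
Proof. exact/sigma_algebra_preimage/sigma_algebra_measurable. Qed.

Let complex_measurable0 :
  preimage_set_system [set: R[i]] pair_of_complex measurable set0.
Proof. by case: sa. Qed.

Let complex_measurableC A :
  preimage_set_system [set: R[i]] pair_of_complex measurable A ->
  preimage_set_system [set: R[i]] pair_of_complex measurable (~` A).
Proof. by case: sa => _ + _; rewrite -setTD; apply. Qed.

Let complex_measurable_bigcup (F : (set R[i])^nat) :
  (forall i, preimage_set_system [set: R[i]] pair_of_complex measurable (F i)) ->
  preimage_set_system [set: R[i]] pair_of_complex measurable (\bigcup_i F i).
Proof. by case: sa => _ _; apply. Qed.

HB.instance Definition _ := @isMeasurable.Build measure_complex_display R[i]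
  (preimage_set_system [set: R[i]] pair_of_complex measurable)
  complex_measurable0 complex_measurableC complex_measurable_bigcup.

Lemma measurable_complex_of_pair :
  measurable_fun [set: R * R] (fun p : R * R => (p.1 +i* p.2 : R[i])).
Proof.
move=> _ _ [B mB <-]; rewrite !setTI.
by rewrite (_ : _ @^-1` _ = B)//; apply/seteqP; split => -[].
Qed.

End measurable_complex.

Definition measure_matrix_display : measure_display -> measure_display.
Proof. exact. Qed.

Section measurable_matrix.
Context d (T : measurableType d) (m n : nat).

Definition matrix_measurable : set (set 'M[T]_(m, n)) :=
  <<s \bigcup_(ij in [set: 'I_m * 'I_n])
        preimage_set_system setT (fun M : 'M[T]_(m, n) => M ij.1 ij.2)
          measurable >>.

Let matrix_measurable0 : matrix_measurable set0.
Proof. exact: sigma_algebra0. Qed.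

Let matrix_measurableC A : matrix_measurable A -> matrix_measurable (~` A).
Proof. exact: sigma_algebraC. Qed.

Let matrix_measurable_bigcup (F : (set 'M[T]_(m, n))^nat) :
  (forall i, matrix_measurable (F i)) -> matrix_measurable (\bigcup_i F i).
Proof. exact: sigma_algebra_bigcup. Qed.

HB.instance Definition _ := @isMeasurable.Build (measure_matrix_display d)
  'M[T]_(m, n) matrix_measurable
  matrix_measurable0 matrix_measurableC matrix_measurable_bigcup.

Lemma measurable_entry i j :
  measurable_fun setT (fun M : 'M[T]_(m, n) => M i j).
Proof.
move=> _ B mB; rewrite setTI; apply: sub_sigma_algebra.
by exists (i, j) => //; exists B => //; rewrite setTI.
Qed.

Lemma measurable_to_matrix d' (S : measurableType d') (f : S -> 'M[T]_(m, n)) :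
  (forall i j, measurable_fun setT (fun s => f s i j)) -> measurable_fun setT f.
Proof.
move=> mf; apply: (measurability (\bigcup_(ij in [set: 'I_m * 'I_n])
  preimage_set_system setT (fun M : 'M[T]_(m, n) => M ij.1 ij.2) measurable))
  => //.
move=> _ [_ [[i j] _ [B mB <-]] <-]; rewrite !setTI.
by rewrite -[X in measurable X]setTI; exact: mf.
Qed.

End measurable_matrix.

(* C^(n+1) = C * C^n *)
Definition cons_cV (T : Type) (n : nat) (p : T * 'cV[T]_n) : 'cV[T]_(n.+1) :=
  col_mx (const_mx p.1 : 'cV[T]_1) p.2.

Lemma measurable_cons_cV d (T : measurableType d) (n : nat) :
  measurable_fun setT (@cons_cV T n).
Proof.
apply: measurable_to_matrix => i j; rewrite /cons_cV.
rewrite -(@splitK 1 n i); case: (@fintype.split 1 n i) => k /=.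
- under eq_fun do rewrite (@col_mxEu _ 1 n) mxE; exact: measurable_fst.
- under eq_fun do rewrite (@col_mxEd _ 1 n).
  exact: (measurableT_comp (measurable_entry k j) measurable_snd).
Qed.

Definition uncons_cV (T : Type) (n : nat) (v : 'cV[T]_n.+1) : T * 'cV[T]_n :=
  (v ord0 ord0, @dsubmx _ 1 n 1 v).

Lemma cons_cVK (T : Type) (n : nat) : cancel (@cons_cV T n) (@uncons_cV T n).
Proof.
move=> [x v]; rewrite /uncons_cV /cons_cV /= col_mxKd; congr pair.
have -> : ord0 = lshift n (ord0 : 'I_1) by exact/val_inj.
by rewrite (@col_mxEu _ 1 n) mxE.
Qed.

Lemma measurable_uncons_cV d (T : measurableType d) (n : nat) :
  measurable_fun setT (@uncons_cV T n).
Proof.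
apply: measurable_fun_pair; first exact: measurable_entry.
apply: measurable_to_matrix => i j.
by under eq_fun do rewrite mxE; exact: measurable_entry.
Qed.

Section lebesgue_Cn.
Variable R : realType.

Definition lebesgue_C : set R[i] -> \bar R :=
  pushforward (@lebesgue_measure R \x @lebesgue_measure R)%E
    (fun p : R * R => p.1 +i* p.2).

Fixpoint lebesgue_Cn (n : nat) : set 'cV[R[i]]_n -> \bar R :=
  match n with
  | 0 => dirac (0 : 'cV[R[i]]_0)
  | n'.+1 => pushforward (lebesgue_C \x @lebesgue_Cn n')%E (@cons_cV R[i] n')
  end.

(* No canonical sigma-finite structure on [_ \x _] is found by inference, the
   instance for subprobabilities being preferred. *)
Lemma sigma_finite_product d1 d2 (T1 : measurableType d1)
    (T2 : measurableType d2) (m1 : {sigma_finite_measure set T1 -> \bar R})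
    (m2 : {sigma_finite_measure set T2 -> \bar R}) :
  exists mu : {sigma_finite_measure set (T1 * T2)%type -> \bar R},
    mu = (m1 \x m2)%E :> (set (T1 * T2) -> \bar R).
Proof.
have sf : sigma_finite setT (m1 \x m2)%E.
  have /sigma_finiteP[F [TF ndF Foo]] := sigma_finiteT m1.
  have /sigma_finiteP[G [TG ndG Goo]] := sigma_finiteT m2.
  exists (fun n => F n `*` G n).
    rewrite -setXTT TF TG predeqE => -[x y]; split.
      move=> [/= [n _ Fnx] [k _ Gky]]; exists (maxn n k) => //; split.
      - by move: x Fnx; exact/subsetPset/ndF/leq_maxl.
      - by move: y Gky; exact/subsetPset/ndG/leq_maxr.
    by move=> [n _ []/= ? ?]; split; exists n.
  move=> k; have [? ?] := Foo k; have [? ?] := Goo k.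
  split; first exact: measurableX.
  by rewrite product_measure1E// lte_mul_pinfty// ge0_fin_numE.
pose m0 : {measure set (T1 * T2)%type -> \bar R} :=
  (m1 \x m2)%E.
pose H1 := isSFinite.Build _ _ _ m0 (sfinite_measure_sigma_finite sf).
pose H2 := isSigmaFinite.Build _ _ _ m0 sf.
pose nu := HB.pack_for {sigma_finite_measure set (T1 * T2)%type -> \bar R}
  (Measure.sort m0) H1 H2.
by exists nu.
Qed.

Lemma sigma_finite_pushforward d1 d2 (T1 : measurableType d1)
    (T2 : measurableType d2) (mu : {sigma_finite_measure set T1 -> \bar R})
    (f : T1 -> T2) (g : T2 -> T1) :
  measurable_fun setT f -> measurable_fun setT g -> cancel f g ->
  exists nu : {sigma_finite_measure set T2 -> \bar R},
    nu = pushforward mu f :> (set T2 -> \bar R).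
Proof.
move=> mf mg fK.
have sf : sigma_finite setT (pushforward mu f).
  have [F TF mF] := sigma_finiteT mu.
  exists (fun i => g @^-1` F i); first by rewrite -preimage_bigcup -TF.
  move=> i; have [mFi Fi] := mF i; split.
    by rewrite -[X in measurable X]setTI; exact: mg.
  by rewrite /pushforward -comp_preimage (_ : g \o f = id)//; apply/funext.
pose m0 : {measure set T2 -> \bar R} :=
  measure_function_pushforward__canonical__measure_function_Measure mu mf.
pose H1 := isSFinite.Build _ _ _ m0 (sfinite_measure_sigma_finite sf).
pose H2 := isSigmaFinite.Build _ _ _ m0 sf.
pose nu := HB.pack_for {sigma_finite_measure set T2 -> \bar R}
  (Measure.sort m0) H1 H2.
by exists nu.
Qed.

Lemma lebesgue_C_sigma_finite :
  exists mu : {sigma_finite_measure set R[i] -> \bar R},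
    mu = lebesgue_C :> (set R[i] -> \bar R).
Proof.
have mg : measurable_fun setT (@pair_of_complex R).
  by move=> _ B mB; exists B.
pose l : {sigma_finite_measure set (measurableTypeR R) -> \bar R} :=
  @lebesgue_measure R.
have [mu muE] := sigma_finite_product l l; rewrite /lebesgue_C -muE.
by apply: (sigma_finite_pushforward mu (@measurable_complex_of_pair R) mg) => -[].
Qed.

Lemma lebesgue_Cn_sigma_finite n :
  exists mu : {sigma_finite_measure set 'cV[R[i]]_n -> \bar R},
    mu = @lebesgue_Cn n :> (set 'cV[R[i]]_n -> \bar R).
Proof.
elim: n => [|n [mu muE]]; first by exists (dirac (0 : 'cV[R[i]]_0)).
have [mu1 mu1E] := lebesgue_C_sigma_finite.
have [mu2 mu2E] := sigma_finite_product mu1 mu.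
rewrite /= -mu1E -muE -mu2E.
exact: (sigma_finite_pushforward mu2 (@measurable_cons_cV _ R[i] n)
  (@measurable_uncons_cV _ R[i] n) (@cons_cVK R[i] n)).
Qed.

Let lebesgue_Cn0 n : @lebesgue_Cn n set0 = 0%E.
Proof. by have [mu <-] := lebesgue_Cn_sigma_finite n; exact: measure0. Qed.

Let lebesgue_Cn_ge0 n A : (0 <= @lebesgue_Cn n A)%E.
Proof. by have [mu <-] := lebesgue_Cn_sigma_finite n; exact: measure_ge0. Qed.

Let lebesgue_Cn_sigma_additive n : semi_sigma_additive (@lebesgue_Cn n).
Proof.
have [mu <-] := lebesgue_Cn_sigma_finite n.
exact: measure_semi_sigma_additive.
Qed.

HB.instance Definition _ n := isMeasure.Build _ _ _ (@lebesgue_Cn n)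
  (lebesgue_Cn0 n) (@lebesgue_Cn_ge0 n) (@lebesgue_Cn_sigma_additive n).

Let sigma_finite_lebesgue_Cn n : sigma_finite setT (@lebesgue_Cn n).
Proof. by have [mu <-] := lebesgue_Cn_sigma_finite n; exact: sigma_finiteT. Qed.

HB.instance Definition _ n := Measure_isSigmaFinite.Build _ _ _ (@lebesgue_Cn n)
  (sigma_finite_lebesgue_Cn n).

End lebesgue_Cn.

Definition Gamma (R : realType) (x : R) : R :=
  \int[@lebesgue_measure R]_(t in `]0, +oo[) (t `^ (x - 1) * expR (- t)).

Section bergman.
Variables (R : realType) (n : nat).
Implicit Types (lambda : R) (f g h : 'cV[R[i]]_n -> R[i]) (z : 'cV[R[i]]_n).

Local Notation v := (@lebesgue_Cn R n).

Definition sqnorm z : R :=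
  \sum_(i < n) (complex.Re (z i ord0) ^+ 2 + complex.Im (z i ord0) ^+ 2).

Definition unit_ball : set 'cV[R[i]]_n := [set z | sqnorm z < 1].

(* The density c_lambda (1 - |z|^2)^lambda of dv_lambda with respect to dv. *)
Definition weight lambda z : R :=
  Gamma (n%:R + lambda + 1) / (pi ^+ n * Gamma (lambda + 1))
  * (1 - sqnorm z) `^ lambda.

Definition square_integrable lambda : set ('cV[R[i]]_n -> R[i]) :=
  [set f | measurable_fun unit_ball f /\
    (\int[v]_(z in unit_ball) (Normc.normc (f z) ^+ 2 * weight lambda z)%:E < +oo)%E].

Definition holomorphic f := forall z, unit_ball z -> differentiable f z.

(* Functions are defined on all of C^n, but only their values on the unit ball
   matter. *)
Definition bergman_space lambda : set ('cV[R[i]]_n -> R[i]) :=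
  [set f | holomorphic f /\ square_integrable lambda f].

Definition inner_product lambda f g : R[i] :=
  (\int[v]_(z in unit_ball) (complex.Re (f z * conjc (g z)) * weight lambda z))
  +i*
  (\int[v]_(z in unit_ball) (complex.Im (f z * conjc (g z)) * weight lambda z)).

(* The orthogonal projection of g is the h in the Bergman space, unique on the
   unit ball, such that g - h is orthogonal to the Bergman space; it exists for
   square-integrable g because the Bergman space is closed. *)
Definition bergman_projection lambda g : 'cV[R[i]]_n -> R[i] :=
  xget (fun=> 0) [set h | bergman_space lambda h /\
    forall k, bergman_space lambda k ->
      inner_product lambda (fun z => g z - h z) k = 0].

Definition toeplitz lambda a f : 'cV[R[i]]_n -> R[i] :=
  bergman_projection lambda (fun z => a z * f z).

Definition Linfty_ball : set ('cV[R[i]]_n -> R[i]) :=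
  [set a | measurable_fun unit_ball a /\
    exists M : R, {ae v, forall z, unit_ball z -> Normc.normc (a z) <= M}].

(* Elements of L^oo are considered up to almost everywhere equality, hence so
   is the equality of a \o A and a; the null set may depend on A. *)
Definition invariant_symbol (H : set 'M[R[i]]_n) (a : 'cV[R[i]]_n -> R[i]) :=
  forall A, H A -> {ae v, forall z, unit_ball z -> a (A *m z) = a z}.

End bergman.

Definition U_block_circle (R : realType) (m n : nat) (k : 'I_m -> nat)
    (kn : (\sum_(i < m) k i)%N = n) (j : 'I_m) : set 'M[R[i]]_n :=
  [set A | exists B : forall i, 'M[R[i]]_(k i),
    [/\ forall i, i != j -> B i \is unitarymx,
        exists2 t : R[i], Normc.normc t = 1 & B j = t%:M
      & A = castmx (kn, kn) (\mxdiag_(i < m) B i)]].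

(* Main.v *)
(** Both Toeplitz operators are described by their matrices in the orthogonal basis of monomials.
    A bounded symbol [a] invariant under U(k, j, T) satisfies [<a z^be, z^al> = 0] unless [be]
    and [al] agree off the block [j] and have the same weight on it. Unitary invariance on another
    block says more: expanding [(c z_p - s z_q)^N] for a plane rotation inside that block shows
    that [<a z^be, z^al> / |z^be|^2] depends on the common part of [be] and [al] on that block only
    through its weight. Hence the [(ga, al)] entry of [T_a T_b] reduces to a single product, and so
    does that of [T_b T_a]; if [j1 <> j2] these two products have the same factors.

    The analysis consists of the existence of the projection (pointwise bounds on the ball,
    obtained from averages over roots of unity, show that the Bergman space is closed) and of the
    completeness of the monomials (a function orthogonal to all of them vanishes, since taking its
    homogeneous component in each coordinate preserves the coefficients of the same degree). *)

From HB Require Import structures.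
Require Import Defs.
From mathcomp Require Import all_boot all_order all_algebra spectral complex.
From mathcomp Require Import all_classical all_reals all_analysis measurable_realfun.
From mathcomp Require Import zify ring lra.

Set Implicit Arguments.
Unset Strict Implicit.
Unset Printing Implicit Defensive.

Import Order.TTheory GRing.Theory Num.Theory.
Import numFieldNormedType.Exports.

Local Open Scope classical_set_scope.
Local Open Scope ring_scope.
Local Open Scope complex_scope.

(** The predicate [differentiable] only provides a complex derivative at each point, so the complex
    analysis starts at Goursat's theorem. Everything is reduced to one-variable slices, and contour
    integrals occur only as circle means, which logarithmic coordinates turn into sides of a
    rectangle. Under an integral over the ball, circle means are replaced by averages over roots of
    unity: these are finite sums, to which measurability, invariance of the volume and limits apply
    directly.

    The algebraic obstacle is that a product of two infinite matrices is an infinite sum. A nonzero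
    entry preserves the total degree, so the adjoint maps a monomial to a polynomial and all sums
    become finite. The division by [|z^be|^2] is what leaves a dependence on weights alone: the
    rotation identity carries a binomial coefficient, the same for [a] and for the symbol 1, whose
    diagonal entries are these squared norms. In the product the intermediate index is forced, since
    it agrees with one outer index off the first block and with the other one off the second. *)

Local Notation cabs := (@Normc.normc _).

(** * Complex-valued integrals *)

Section complex_modulus.
Variable R : realType.
Implicit Types (x y : R) (z w : R[i]).

Lemma cabs_sqr z : cabs z ^+ 2 = complex.Re z ^+ 2 + complex.Im z ^+ 2.
Proof. by case: z => x y /=; rewrite sqr_sqrtr// addr_ge0// sqr_ge0. Qed.

Lemma cabs_ge0 z : 0 <= cabs z.
Proof. by case: z => x y /=; exact: sqrtr_ge0. Qed.

Lemma normr_cabs z : `|z| = (cabs z)%:C.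
Proof. by rewrite normc_def; case: z. Qed.

Lemma cabsE (x : R) : cabs x%:C = `|x|.
Proof. by rewrite /= expr0n addr0 sqrtr_sqr. Qed.

Lemma cabsX z n : cabs (z ^+ n) = cabs z ^+ n.
Proof.
elim: n => [|n IHn]; first by rewrite !expr0 Normc.normc1.
by rewrite !exprS Normc.normcM IHn.
Qed.

Lemma cabsJ z : cabs (conjc z) = cabs z.
Proof. by case: z => x y /=; rewrite sqrrN. Qed.

Lemma cabs_conj z : z * conjc z = (cabs z ^+ 2)%:C.
Proof.
rewrite cabs_sqr; case: z => x y; apply/eqP; rewrite eq_complex /=.
by apply/andP; split; apply/eqP; ring.
Qed.

Lemma cabs_gt0 z : (0 < cabs z) = (z != 0).
Proof.
rewrite lt_neqAle cabs_ge0 andbT eq_sym; congr (~~ _).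
apply/eqP/eqP => [/Normc.eq0_normc//|->]; exact: Normc.normc0.
Qed.

Lemma le_cabsB z w : cabs (z - w) <= cabs z + cabs w.
Proof. by rewrite -(normcN w); exact: le_normcD. Qed.

Lemma cabs_distC z w : cabs (z - w) = cabs (w - z).
Proof. by rewrite -normcN opprB. Qed.

Lemma ge_cabs_dist z w : `|cabs z - cabs w| <= cabs (z - w).
Proof.
rewrite ler_norml; apply/andP; split.
  rewrite lerNl opprB lerBlDr cabs_distC -{1}(subrK z w); exact: le_normcD.
rewrite lerBlDr -{1}(subrK w z); exact: le_normcD.
Qed.

Lemma normr_Re_le z : `|complex.Re z| <= cabs z.
Proof.
case: z => x y /=; rewrite -sqrtr_sqr ler_wsqrtr// lerDl; exact: sqr_ge0.
Qed.

Lemma normr_Im_le z : `|complex.Im z| <= cabs z.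
Proof.
case: z => x y /=; rewrite -sqrtr_sqr ler_wsqrtr// lerDr; exact: sqr_ge0.
Qed.

Lemma cabs_le_ReIm z : cabs z <= `|complex.Re z| + `|complex.Im z|.
Proof.
rewrite -(@ler_pXn2r _ 2)// ?nnegrE ?addr_ge0 ?cabs_ge0//.
rewrite cabs_sqr sqrrD !real_normK ?num_real//.
by rewrite lerD2r lerDl mulrn_wge0// mulr_ge0.
Qed.

Lemma le_cabs_sum (I : Type) (r : seq I) (P : pred I) (F : I -> R[i]) :
  cabs (\sum_(i <- r | P i) F i) <= \sum_(i <- r | P i) cabs (F i).
Proof.
elim/big_rec2 : _ => [|i x z _ h]; first by rewrite Normc.normc0.
by apply: (le_trans (le_normcD _ _)); rewrite lerD2l.
Qed.

Lemma ReD z w : complex.Re (z + w) = complex.Re z + complex.Re w.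
Proof. by case: z; case: w. Qed.
Lemma ImD z w : complex.Im (z + w) = complex.Im z + complex.Im w.
Proof. by case: z; case: w. Qed.
Lemma ReM z w : complex.Re (z * w) =
  complex.Re z * complex.Re w - complex.Im z * complex.Im w.
Proof. by case: z; case: w. Qed.
Lemma ImM z w : complex.Im (z * w) =
  complex.Re z * complex.Im w + complex.Im z * complex.Re w.
Proof. by case: z; case: w. Qed.

Lemma complex_eta z : z = complex.Re z +i* complex.Im z.
Proof. by case: z. Qed.

Lemma cabs_sumsq z w : cabs (z + w) ^+ 2 <= 2 * cabs z ^+ 2 + 2 * cabs w ^+ 2.
Proof.
rewrite !cabs_sqr ReD ImD.
have := sqr_ge0 (complex.Re z - complex.Re w).
have := sqr_ge0 (complex.Im z - complex.Im w).
by nra.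
Qed.

End complex_modulus.
Arguments Normc.normc : simpl never.

Section complex_integral.
Context d (T : measurableType d) (R : realType).
Variables (mu : {measure set T -> \bar R}) (D : set T).
Hypothesis mD : measurable D.
Implicit Types (f g : T -> R[i]).

Definition cintegrable f :=
  mu.-integrable D (EFin \o (fun x => complex.Re (f x))) /\
  mu.-integrable D (EFin \o (fun x => complex.Im (f x))).

Definition cint f : R[i] :=
  (\int[mu]_(x in D) complex.Re (f x)) +i* (\int[mu]_(x in D) complex.Im (f x)).

Lemma eq_cint f g : {in D, f =1 g} -> cint f = cint g.
Proof.
by move=> fg; congr Complex; apply: eq_Rintegral => x /fg ->.
Qed.

Lemma cintegrableD f g : cintegrable f -> cintegrable g ->
  cintegrable (fun x => f x + g x).
Proof.
move=> [f1 f2] [g1 g2]; split.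
  apply: (eq_integrable mD _ _ _ (integrableD mD f1 g1)) => //.
  by move=> x _ /=; rewrite ReD EFinD.
apply: (eq_integrable mD _ _ _ (integrableD mD f2 g2)) => //.
by move=> x _ /=; rewrite ImD EFinD.
Qed.

Lemma cintD f g : cintegrable f -> cintegrable g ->
  cint (fun x => f x + g x) = cint f + cint g.
Proof.
move=> [f1 f2] [g1 g2]; rewrite /cint.
transitivity ((\int[mu]_(x in D) (complex.Re (f x) + complex.Re (g x))) +i*
  (\int[mu]_(x in D) (complex.Im (f x) + complex.Im (g x)))).
  by congr Complex; apply: eq_Rintegral => x _; rewrite ?ReD ?ImD.
by rewrite !RintegralD.
Qed.

Lemma cintegrableZ (c : R[i]) f : cintegrable f -> cintegrable (fun x => c * f x).
Proof.
have Z (r : R) h : mu.-integrable D (EFin \o h) ->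
    mu.-integrable D (EFin \o (fun x => r * h x)).
  move=> /(integrableZl mD r) h'; exact: (eq_integrable mD _ _ _ h').
move=> [f1 f2]; split.
  have := integrableB mD (Z (complex.Re c) _ f1) (Z (complex.Im c) _ f2).
  by apply: eq_integrable => // x _ /=; rewrite ReM EFinB.
have := integrableD mD (Z (complex.Re c) _ f2) (Z (complex.Im c) _ f1).
by apply: eq_integrable => // x _ /=; rewrite ImM EFinD.
Qed.

Lemma cintZ (c : R[i]) f : cintegrable f ->
  cint (fun x => c * f x) = c * cint f.
Proof.
have Z (r : R) h : mu.-integrable D (EFin \o h) ->
    mu.-integrable D (EFin \o (fun x => r * h x)).
  move=> /(integrableZl mD r) h'; exact: (eq_integrable mD _ _ _ h').
move=> [f1 f2]; apply/eqP; rewrite eq_complex; apply/andP; split; apply/eqP.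
  rewrite ReM /= -!RintegralZl// -RintegralB//; [|exact: Z|exact: Z].
  by apply: eq_Rintegral => x _; rewrite ReM.
rewrite ImM /= -!RintegralZl// -RintegralD//; [|exact: Z|exact: Z].
by apply: eq_Rintegral => x _; rewrite ImM.
Qed.

Lemma cintegrable0 : cintegrable (fun=> 0).
Proof. by split; exact: integrable0. Qed.

Lemma cint0 : cint (fun=> 0) = 0.
Proof. by rewrite /cint !Rintegral_cst// !mul0r. Qed.

Lemma cintegrableN f : cintegrable f -> cintegrable (fun x => - f x).
Proof.
move=> /(cintegrableZ (-1)); rewrite [X in cintegrable X -> _](_ : _ = (fun x => - f x))//.
by apply/funext => x; rewrite mulN1r.
Qed.

Lemma cintN f : cintegrable f -> cint (fun x => - f x) = - cint f.
Proof.
by move=> fi; rewrite -mulN1r -cintZ//; apply: eq_cint => x _; rewrite mulN1r.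
Qed.

Lemma cintB f g : cintegrable f -> cintegrable g ->
  cint (fun x => f x - g x) = cint f - cint g.
Proof. by move=> fi gi; rewrite cintD ?cintN//; exact: cintegrableN. Qed.

Lemma cintegrable_sum (I : Type) (r : seq I) (P : pred I) (F : I -> T -> R[i]) :
  (forall i, P i -> cintegrable (F i)) ->
  cintegrable (fun x => \sum_(i <- r | P i) F i x).
Proof.
move=> Fi; elim: r => [|i r IH].
  by under eq_fun do rewrite big_nil; exact: cintegrable0.
under eq_fun do rewrite big_cons.
by case Pi: (P i) => //; apply: cintegrableD => //; exact: Fi.
Qed.

Lemma cint_sum (I : Type) (r : seq I) (P : pred I) (F : I -> T -> R[i]) :
  (forall i, P i -> cintegrable (F i)) ->
  cint (fun x => \sum_(i <- r | P i) F i x) = \sum_(i <- r | P i) cint (F i).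
Proof.
move=> Fi; elim: r => [|i r IH].
  by rewrite big_nil -[RHS]cint0; apply: eq_cint => x _; rewrite big_nil.
rewrite big_cons; case: ifPn => Pi; last first.
  by rewrite -IH; apply: eq_cint => x _; rewrite big_cons (negbTE Pi).
rewrite -IH -cintD//; [|exact: Fi|exact: cintegrable_sum].
by apply: eq_cint => x _; rewrite big_cons Pi.
Qed.

(** The factor 2 comes from bounding the real and the imaginary part separately; it reappears in
    Cauchy's estimates below, where only the existence of a constant matters. *)
Lemma cabs_cint_le f (g : T -> R) : cintegrable f ->
  mu.-integrable D (EFin \o g) -> (forall x, D x -> cabs (f x) <= g x) ->
  cabs (cint f) <= 2 * \int[mu]_(x in D) g x.
Proof.
move=> [f1 f2] gi fg; apply: (le_trans (cabs_le_ReIm _)) => /=.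
rewrite mulr_natl mulr2n lerD//.
- apply: (le_trans (le_normr_Rintegral mD f1)); apply: le_Rintegral => //.
    exact: (integrable_abse f1).
  by move=> x /fg; apply: le_trans; exact: normr_Re_le.
- apply: (le_trans (le_normr_Rintegral mD f2)); apply: le_Rintegral => //.
    exact: (integrable_abse f2).
  by move=> x /fg; apply: le_trans; exact: normr_Im_le.
Qed.

Lemma cintJ f : cintegrable f -> cint (fun x => conjc (f x)) = conjc (cint f).
Proof.
move=> [f1 f2]; congr Complex; first by apply: eq_Rintegral => x _; case: (f x).
rewrite -mulN1r -RintegralZl//; apply: eq_Rintegral => x _.
by rewrite mulN1r; case: (f x).
Qed.

End complex_integral.

(** * Goursat's theorem in polar coordinates *)

Section segment_integral.
Variable R : realType.
Local Notation mu := (@lebesgue_measure R).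

Definition seg_int (f : R -> R[i]) (a b : R) : R[i] := cint mu `[a, b] f.

(** Continuity is phrased with the real-valued modulus because the norm of [R[i]] takes its values
    in [R[i]]. *)
Definition pt_cont (f : R -> R[i]) (x : R) := forall e, 0 < e ->
  exists2 dl, 0 < dl & forall y, `|y - x| < dl -> cabs (f y - f x) <= e.

Lemma half_step (a a' h : R) : 0 < h -> a' = a \/ a' = a + h / 2 ->
  a <= a' /\ a' + h / 2 <= a + h.
Proof. by move=> h0 [->|->]; split; lra. Qed.

Lemma pt_cont_ReIm f x : pt_cont f x ->
  {for x, continuous (fun y => complex.Re (f y))} /\
  {for x, continuous (fun y => complex.Im (f y))}.
Proof.
move=> fx; split; apply/cvgrPdist_le => e e0; have [dl dl0 H] := fx e e0;
  apply/nbhs_normP; exists dl => // y /=; rewrite distrC => /H h;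
  apply: le_trans h; rewrite distrC.
  by apply: (le_trans _ (normr_Re_le _)); rewrite ReD; case: (f x).
by apply: (le_trans _ (normr_Im_le _)); rewrite ImD; case: (f x).
Qed.

Lemma pt_contB f g x : pt_cont f x -> pt_cont g x ->
  pt_cont (fun y => f y - g y) x.
Proof.
move=> fx gx e e0; have e2 : 0 < e / 2 by rewrite divr_gt0.
have [d1 d10 H1] := fx _ e2; have [d2 d20 H2] := gx _ e2.
exists (Num.min d1 d2) => [|y]; first by rewrite lt_min d10.
rewrite lt_min => /andP[/H1 h1 /H2 h2].
rewrite (_ : _ - _ = (f y - f x) - (g y - g x)); last by ring.
by rewrite (le_trans (le_cabsB _ _))// [leRHS](splitr e) lerD.
Qed.

Definition seg_cont f (a b : R) := forall x, a <= x <= b -> pt_cont f x.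

Lemma seg_contB f g a b : seg_cont f a b -> seg_cont g a b ->
  seg_cont (fun y => f y - g y) a b.
Proof. by move=> fx gx x xab; apply: pt_contB; [exact: fx|exact: gx]. Qed.

Lemma seg_cont_integrable f a b : seg_cont f a b -> cintegrable mu `[a, b] f.
Proof.
move=> fc; split; apply: continuous_compact_integrable;
  try exact: segment_compact; apply: continuous_in_subspaceT => x;
  rewrite inE /= in_itv /= => /fc /pt_cont_ReIm [] //.
Qed.

Lemma seg_int_split f a m b : a <= m -> m <= b -> seg_cont f a b ->
  seg_int f a b = seg_int f a m + seg_int f m b.
Proof.
move=> am mb /seg_cont_integrable [i1 i2].
have H (h : R -> R) : mu.-integrable `[a, b] (EFin \o h) ->
    \int[mu]_(x in `[a, b]) h x =
    \int[mu]_(x in `[a, m]) h x + \int[mu]_(x in `[m, b]) h x.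
  move=> ih; rewrite -[X in _ = _ + X]Rintegral_itv_obnd_cbnd; last first.
    apply: integrableS ih => //; apply: subset_itvr => //.
  have <- : \int[mu]_(t in `[a, b]) h t - \int[mu]_(t in `[a, m]) h t =
      \int[mu]_(t in `]m, b]) h t by apply: Rintegral_itvB; rewrite ?bnd_simp.
  by rewrite addrC subrK.
by apply/eqP; rewrite eq_complex /= !H ?eqxx.
Qed.

Lemma fine_itv a b : a <= b -> fine (mu `[a, b]) = b - a.
Proof.
move=> ab; rewrite lebesgue_measure_itv/= lte_fin; case: ltP => [//|ba].
by rewrite (@le_anti _ _ a b) ?ab//= subrr.
Qed.

Lemma cabs_seg_int_le f a b C : a <= b -> seg_cont f a b ->
  (forall x, a <= x <= b -> cabs (f x) <= C) ->
  cabs (seg_int f a b) <= 2 * (C * (b - a)).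
Proof.
move=> ab fc fC; have : cabs (seg_int f a b) <= 2 * \int[mu]_(x in `[a, b]) C.
  apply: cabs_cint_le => //; first exact: seg_cont_integrable.
    apply: continuous_compact_integrable; first exact: segment_compact.
    by apply: continuous_subspaceT => x; exact: cvg_cst.
by move/le_trans; apply; rewrite Rintegral_cst// fine_itv.
Qed.

End segment_integral.

Section goursat.
Variable R : realType.
Variable F : R -> R -> R[i].

(** This is complex differentiability in the variable [s + it], with the two real coordinates kept
    apart so that they can be the logarithm of the radius and the angle. *)
Definition rect_diff (s t : R) := exists A : R[i], forall e : R, 0 < e ->
  exists2 dl, 0 < dl & forall s' t', `|s' - s| < dl -> `|t' - t| < dl ->
    cabs (F s' t' - F s t - A * ((s' - s) +i* (t' - t))) <=
      e * (`|s' - s| + `|t' - t|).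

Lemma cabs_pair_le (x y : R) : cabs (x +i* y) <= `|x| + `|y|.
Proof. exact: cabs_le_ReIm. Qed.

Lemma rect_diff_cont s t : rect_diff s t ->
  forall e, 0 < e -> exists2 dl, 0 < dl &
  forall s' t', `|s' - s| < dl -> `|t' - t| < dl -> cabs (F s' t' - F s t) <= e.
Proof.
move=> [A H] e e0; have [dl dl0 {}H] := H 1 ltr01.
have c0 : 0 < 2 * (1 + cabs A) by rewrite mulr_gt0// ltr_wpDr// cabs_ge0.
exists (Num.min dl (e / (2 * (1 + cabs A)))) => [|s' t'].
  by rewrite lt_min dl0 divr_gt0.
rewrite !lt_min => /andP[/H{}H h1] /andP[/H{}H h2].
rewrite -(subrK (A * ((s' - s) +i* (t' - t))) (_ - _)).
apply: (le_trans (le_normcD _ _)); rewrite Normc.normcM.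
apply: (@le_trans _ _ ((1 + cabs A) * (`|s' - s| + `|t' - t|))).
  rewrite mulrDl lerD// ler_wpM2l ?cabs_ge0//; exact: cabs_pair_le.
apply: (@le_trans _ _ ((1 + cabs A) * (2 * (e / (2 * (1 + cabs A)))))).
  rewrite ler_wpM2l//; first by rewrite addr_ge0// cabs_ge0.
  by rewrite mulr_natl mulr2n lerD// ltW.
have : 1 + cabs A != 0 by rewrite gt_eqF// ltr_wpDr// cabs_ge0.
by move=> h; rewrite le_eqVlt; apply/orP; left; apply/eqP; field.
Qed.

(** The integral of [F d(s + it)] along the positively oriented boundary of [[a, b] x [c, d]],
    opposite sides being paired under one integral sign. *)
Definition bdry_int (a b c d : R) : R[i] :=
  seg_int (fun s => F s c - F s d) a b + 'i * seg_int (fun t => F b t - F a t) c d.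

Variables (a0 c0 h0 k0 : R).
Hypotheses (h00 : 0 < h0) (k00 : 0 < k0).
Hypothesis Fd : forall s t, a0 <= s <= a0 + h0 -> c0 <= t <= c0 + k0 ->
  rect_diff s t.

Let contl s c d : a0 <= s <= a0 + h0 -> c0 <= c -> d <= c0 + k0 ->
  seg_cont (F s) c d.
Proof.
move=> sab cc dd t /andP[ct td] e e0.
have [|dl dl0 H] := rect_diff_cont (Fd sab (_ : c0 <= t <= c0 + k0)) e0.
  by rewrite (le_trans cc ct) (le_trans td dd).
by exists dl => // y hy; apply: H => //; rewrite subrr normr0.
Qed.

Let contr t a b : c0 <= t <= c0 + k0 -> a0 <= a -> b <= a0 + h0 ->
  seg_cont (fun s => F s t) a b.
Proof.
move=> tab aa bb s /andP[ct td] e e0.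
have [|dl dl0 H] := rect_diff_cont (Fd (_ : a0 <= s <= a0 + h0) tab) e0.
  by rewrite (le_trans aa ct) (le_trans td bb).
by exists dl => // y hy; apply: H => //; rewrite subrr normr0.
Qed.

Let bdry_splitl a m b c d : a0 <= a -> a <= m -> m <= b -> b <= a0 + h0 ->
  c0 <= c -> c <= d -> d <= c0 + k0 ->
  bdry_int a b c d = bdry_int a m c d + bdry_int m b c d.
Proof.
move=> aa am mb bb cc cd dd; rewrite /bdry_int (seg_int_split am mb); last first.
  by apply: seg_contB; apply: contr => //; apply/andP; split; lra.
rewrite -[RHS]addrACA -[in RHS]mulrDr; congr (_ + 'i * _).
rewrite -cintD//; last 2 first.
- by apply: seg_cont_integrable; apply: seg_contB; apply: contl => //; apply/andP; split; lra.
- by apply: seg_cont_integrable; apply: seg_contB; apply: contl => //; apply/andP; split; lra.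
by apply: eq_cint => x _; ring.
Qed.

Let bdry_splitr a b c m d : a0 <= a -> a <= b -> b <= a0 + h0 ->
  c0 <= c -> c <= m -> m <= d -> d <= c0 + k0 ->
  bdry_int a b c d = bdry_int a b c m + bdry_int a b m d.
Proof.
move=> aa ab bb cc cm md dd; rewrite /bdry_int (seg_int_split cm md); last first.
  by apply: seg_contB; apply: contl => //; apply/andP; split; lra.
rewrite mulrDr -[RHS]addrACA; congr (_ + _).
rewrite -cintD//; last 2 first.
- by apply: seg_cont_integrable; apply: seg_contB; apply: contr => //; apply/andP; split; lra.
- by apply: seg_cont_integrable; apply: seg_contB; apply: contr => //; apply/andP; split; lra.
by apply: eq_cint => x _; ring.
Qed.

(** The affine approximation has boundary integral 0: its differences between opposite sides are the
    constants [u1] and [u2], whose contributions cancel. Only the errors remain, two for each pair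
    of opposite sides, and the factor 2 of [cabs_seg_int_le] makes the constant 4. *)
Lemma bdry_int_small a b c d s t A e : a0 <= a -> a <= s <= b -> b <= a0 + h0 ->
  c0 <= c -> c <= t <= d -> d <= c0 + k0 -> 0 <= e ->
  (forall s' t', a <= s' <= b -> c <= t' <= d ->
    cabs (F s' t' - F s t - A * ((s' - s) +i* (t' - t))) <= e) ->
  cabs (bdry_int a b c d) <= 4 * e * ((b - a) + (d - c)).
Proof.
move=> aa /andP[as_ sb] bb cc /andP[ct td] dd e0 H.
pose E s' t' := F s' t' - F s t - A * ((s' - s) +i* (t' - t)).
have ab := le_trans as_ sb; have cd := le_trans ct td.
have cstI (x : R[i]) u v : u <= v -> seg_int (fun=> x) u v = x * (v - u)%:C.
  move=> uv; rewrite /seg_int /cint !Rintegral_cst// fine_itv//.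
  by apply/eqP; rewrite eq_complex /=; case: x => x y /=; apply/andP; split; apply/eqP; ring.
have cstC (x : R[i]) u v : seg_cont (fun=> x) u v.
  by move=> y _ r r0; exists 1 => // y' _; rewrite subrr Normc.normc0 ltW.
have i1 : seg_cont (fun s' => F s' c - F s' d) a b.
  by apply: seg_contB; apply: contr => //; apply/andP; split; lra.
have i2 : seg_cont (fun t' => F b t' - F a t') c d.
  by apply: seg_contB; apply: contl => //; apply/andP; split; lra.
pose u1 : R[i] := A * (0 +i* (c - d)); pose u2 : R[i] := A * (b - a)%:C.
have -> : bdry_int a b c d =
    seg_int (fun s' => (F s' c - F s' d) - u1) a b +
    'i * seg_int (fun t' => (F b t' - F a t') - u2) c d.
  have -> : seg_int (fun s' => (F s' c - F s' d) - u1) a b =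
      seg_int (fun s' => F s' c - F s' d) a b - u1 * (b - a)%:C.
    by rewrite -cstI// -cintB//; exact: seg_cont_integrable.
  have -> : seg_int (fun t' => (F b t' - F a t') - u2) c d =
      seg_int (fun t' => F b t' - F a t') c d - u2 * (d - c)%:C.
    by rewrite -cstI// -cintB//; exact: seg_cont_integrable.
  rewrite /bdry_int /u1 /u2.
  rewrite mulrBr addrACA -[LHS]addr0; congr (_ + _).
  case: A {E H u1 u2} => x y; apply/eqP; rewrite eq_complex /=.
  by apply/andP; split; apply/eqP; ring.
have -> : 4 * e * (b - a + (d - c)) =
    2 * ((e + e) * (b - a)) + 2 * ((e + e) * (d - c)) by ring.
apply: (le_trans (le_normcD _ _)); apply: lerD; last first.
  rewrite Normc.normcM (_ : cabs 'i = 1) ?mul1r; last first.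
    by rewrite /Normc.normc expr0n expr1n add0r sqrtr1.
  apply: cabs_seg_int_le => //; first exact: seg_contB.
  move=> t' ht'; rewrite (_ : _ - _ = E b t' - E a t'); last first.
    rewrite /E /u2 (_ : (b - a)%:C = ((b - s) +i* (t' - t)) - ((a - s) +i* (t' - t))).
      by ring.
    by apply/eqP; rewrite eq_complex /=; apply/andP; split; apply/eqP; ring.
  by rewrite (le_trans (le_cabsB _ _))// lerD// H// ?lexx ?ab.
apply: cabs_seg_int_le => //; first exact: seg_contB.
move=> s' hs'; rewrite (_ : _ - _ = E s' c - E s' d); last first.
  rewrite /E /u1 (_ : (0 +i* (c - d)) = ((s' - s) +i* (c - t)) - ((s' - s) +i* (d - t))).
    by ring.
  by apply/eqP; rewrite eq_complex /=; apply/andP; split; apply/eqP; ring.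
by rewrite (le_trans (le_cabsB _ _))// lerD// H// ?lexx ?cd.
Qed.

(** Pigeonhole: the inner sides cancel, so the boundary integral is the sum of those of the four
    quarters. *)
Let quarter a c h k : 0 < h -> 0 < k -> a0 <= a -> a + h <= a0 + h0 ->
  c0 <= c -> c + k <= c0 + k0 ->
  exists p : R * R, [/\ (p.1 = a \/ p.1 = a + h / 2), (p.2 = c \/ p.2 = c + k / 2) &
    cabs (bdry_int a (a + h) c (c + k)) <=
    4 * cabs (bdry_int p.1 (p.1 + h / 2) p.2 (p.2 + k / 2))].
Proof.
move=> h1 k1 aa hh cc kk; set a' := a + h / 2; set c' := c + k / 2.
have -> : bdry_int a (a + h) c (c + k) =
    (bdry_int a (a + h / 2) c (c + k / 2) +
     bdry_int a (a + h / 2) c' (c' + k / 2)) +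
    (bdry_int a' (a' + h / 2) c (c + k / 2) +
     bdry_int a' (a' + h / 2) c' (c' + k / 2)).
  have ea : a' + h / 2 = a + h by rewrite /a'; lra.
  have ec : c' + k / 2 = c + k by rewrite /c'; lra.
  rewrite ea ec -/a' -/c' -(bdry_splitr (m := c'));
    [|rewrite /a' /c'; lra..].
  rewrite -(bdry_splitr (m := c')); [|rewrite /a' /c'; lra..].
  by rewrite -(bdry_splitl (m := a')) //; rewrite /a' /c'; lra.
set X := bdry_int a _ c _; set Y := bdry_int a _ c' _.
set Z := bdry_int a' _ c _; set W := bdry_int a' _ c' _.
have S : cabs (X + Y + (Z + W)) <= cabs X + cabs Y + (cabs Z + cabs W).
  by rewrite (le_trans (le_normcD _ _))// lerD// le_normcD.
set N := cabs (_ + _).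
have [hX|hX] := leP N (4 * cabs X).
  by exists (a, c); split => //=; left.
have [hY|hY] := leP N (4 * cabs Y).
  by exists (a, c'); split => //=; [left|right].
have [hZ|hZ] := leP N (4 * cabs Z).
  by exists (a', c); split => //=; [right|left].
exists (a', c'); split => //=; [by right|by right|].
have {S} : N <= cabs X + cabs Y + (cabs Z + cabs W) by [].
by rewrite -/W; move: N (cabs X) (cabs Y) (cabs Z) (cabs W) hX hY hZ; intros; lra.
Qed.

Let nested (u l : nat -> R) : (forall n, u n <= u n.+1) ->
  (forall n, u n.+1 + l n.+1 <= u n + l n) -> (forall n, 0 <= l n) ->
  exists s, forall n, u n <= s <= u n + l n.
Proof.
move=> u1 u2 l0.
have uh : {homo u : m n / (m <= n)%N >-> m <= n} by apply: homo_leq => //; exact: le_trans.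
have lh : {homo (fun n => - (u n + l n)) : m n / (m <= n)%N >-> m <= n}.
  by apply: homo_leq => [//|x y z|n]; [exact: le_trans|rewrite lerN2].
have ul m n : u m <= u n + l n.
  apply: (le_trans (uh _ _ (leq_maxl m n))).
  apply: (le_trans (y := u (maxn m n) + l (maxn m n))); first by rewrite lerDl.
  by rewrite -lerN2; apply: lh; exact: leq_maxr.
have hs : has_sup (range u).
  by split; [exists (u 0); exists 0|exists (u 0 + l 0) => _ [m _ <-]].
exists (sup (range u)) => n; apply/andP; split.
  by apply: sup_upper_bound => //; exists n.
by apply: ge_sup => [|_ [m _ <-]]; [case: hs|].
Qed.

(** Bisection: after [n] steps the boundary integral is still at least [4^-n cabs X], while
    differentiability at the common point of the nested rectangles bounds it by an arbitrarily small
    multiple of [4^-n (h0 + k0)^2]. *)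
Theorem goursat : bdry_int a0 (a0 + h0) c0 (c0 + k0) = 0.
Proof.
set X := bdry_int _ _ _ _.
pose h n := h0 / 2 ^+ n; pose k n := k0 / 2 ^+ n.
have hS n : h n.+1 = h n / 2 by rewrite /h exprS invfM mulrCA mulrC.
have kS n : k n.+1 = k n / 2 by rewrite /k exprS invfM mulrCA mulrC.
have h1 n : 0 < h n by rewrite divr_gt0// exprn_gt0.
have k1 n : 0 < k n by rewrite divr_gt0// exprn_gt0.
pose inv n (p : R * R) := [/\ a0 <= p.1, p.1 + h n <= a0 + h0, c0 <= p.2,
  p.2 + k n <= c0 + k0 &
  cabs X <= 4 ^+ n * cabs (bdry_int p.1 (p.1 + h n) p.2 (p.2 + k n))].
pose nxt n (p p' : R * R) := [/\ p.1 <= p'.1, p'.1 + h n.+1 <= p.1 + h n,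
  p.2 <= p'.2, p'.2 + k n.+1 <= p.2 + k n & inv n.+1 p'].
(* The implication makes the successor total, as [choice] requires; the pair [(0, 0)] is a default
   outside of the invariant. *)
have ex (np : nat * (R * R)) : exists p', inv np.1 np.2 -> nxt np.1 np.2 p'.
  case: np => n [a c]; have [ip|nip] := pselect (inv n (a, c)); last by exists (0, 0).
  case: (ip) => /= aa hh cc kk XX.
  have [[a' c'] /= [ea ec H]] := quarter (h1 n) (k1 n) aa hh cc kk.
  exists (a', c') => _.
  have hn := h1 n; have kn := k1 n.
  have I : [/\ a <= a', a' + h n.+1 <= a + h n, c <= c' & c' + k n.+1 <= c + k n].
    rewrite hS kS.
    by have [? ?] := half_step hn ea; have [? ?] := half_step kn ec.
  case: I => I1 I2 I3 I4; split => //; split; rewrite /=.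
  - exact: le_trans I1.
  - exact: le_trans I2 _.
  - exact: le_trans I3.
  - exact: le_trans I4 _.
  apply: (le_trans XX); by rewrite hS kS exprSr -mulrA ler_wpM2l// exprn_ge0.
have [f fP] := choice ex.
pose q := fix q n := if n is m.+1 then f (m, q m) else (a0, c0).
have qi n : inv n (q n).
  elim: n => [|n IH] /=; last by case: (fP (n, q n) IH).
  by rewrite /inv /h /k !expr0 !divr1 mul1r; split; rewrite //= lexx.
have qn n : nxt n (q n) (q n.+1) by exact: (fP (n, q n) (qi n)).
have [s sP] : exists s, forall n, (q n).1 <= s <= (q n).1 + h n.
  apply: (@nested (fun n => (q n).1) h) => n; last exact: ltW.
  - by case: (qn n).
  - by case: (qn n).
have [t tP] : exists t, forall n, (q n).2 <= t <= (q n).2 + k n.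
  apply: (@nested (fun n => (q n).2) k) => n; last exact: ltW.
  - by case: (qn n).
  - by case: (qn n).
have hs : a0 <= s <= a0 + h0 by have := sP 0%N; rewrite /= /h expr0 divr1.
have ht : c0 <= t <= c0 + k0 by have := tP 0%N; rewrite /= /k expr0 divr1.
have [A AP] := Fd hs ht.
have hk0 : 0 < h0 + k0 by rewrite addr_gt0.
apply/eqP; rewrite -[_ == _]negbK -cabs_gt0; apply/negP => X0.
(* Since [h n + k n = (h0 + k0) / 2^n], this precision leads to [cabs X <= cabs X / 2]. *)
have e0 : 0 < cabs X / (8 * (h0 + k0) ^+ 2) by rewrite divr_gt0// mulr_gt0// exprn_gt0.
have [dl dl0 {}AP] := AP _ e0.
have [n nP] : exists n, h n + k n < dl.
  have := @upper_nthrootP _ ((h0 + k0) / dl) _ (leqnn _).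
  move: (Num.Def.archi_bound _) => n hn.
  exists n; rewrite /h /k -mulrDl ltr_pdivrMr ?exprn_gt0//.
  by rewrite -ltr_pdivrMl// mulrC.
have := qi n; case: (q n) (sP n) (tP n) => a c /= /andP[s1 s2] /andP[t1 t2] [aa hh cc kk XX].
have hn := h1 n; have kn := k1 n.
have := @bdry_int_small a (a + h n) c (c + k n) s t A
  (cabs X / (8 * (h0 + k0) ^+ 2) * (h n + k n)) aa.
have -> : a + h n - a + (c + k n - c) = h n + k n by ring.
rewrite s1 s2 t1 t2 => /(_ isT hh cc isT kk) B.
suff : cabs X <= cabs X / 2 by lra.
apply: (le_trans XX).
have -> : cabs X / 2 = 4 ^+ n * (4 * (cabs X / (8 * (h0 + k0) ^+ 2) * (h n + k n)) *
   (h n + k n)).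
  rewrite /h /k -mulrDl; have -> : (4 : R) ^+ n = 2 ^+ n * 2 ^+ n.
    by rewrite -exprMn -natrM.
  have : (2 : R) ^+ n != 0 by rewrite expf_neq0.
  by move: (2 ^+ n) => z z0; field; rewrite z0 gt_eqF.
rewrite ler_wpM2l ?exprn_ge0//; apply: B.
  by rewrite mulr_ge0 ?ltW// addr_gt0.
move=> s' t' /andP[s1' s2'] /andP[t1' t2'].
have S : `|s' - s| <= h n by rewrite ler_norml; apply/andP; split; lra.
have T : `|t' - t| <= k n by rewrite ler_norml; apply/andP; split; lra.
apply: (le_trans (AP _ _ _ _)); [by apply: le_lt_trans S _; lra|by lra|].
by rewrite ler_wpM2l ?lerD// ltW.
Qed.

End goursat.

(** * Complex differentiability and circle integrals *)

Section circle.
Variable R : realType.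
Implicit Types (g : R[i] -> R[i]) (z w : R[i]) (r s t : R).

Lemma is_derive_small (f : R -> R) (x df : R) : is_derive x 1 f df ->
  forall e : R, 0 < e -> exists2 dl : R, 0 < dl & forall h, `|h| < dl ->
    `|f (h + x) - f x - df * h| <= e * `|h|.
Proof.
move=> [fd <-] e e0; move/cvgrPdist_le : fd => /(_ e e0).
rewrite near_withinE => /nbhs_normP[dl /= dl0 H]; exists dl => // h hdl.
have [->|h0] := eqVneq h 0.
  by rewrite add0r subrr mulr0 subr0 !normr0 mulr0.
have := H h; rewrite /= distrC subr0 => /(_ hdl h0).
rewrite /GRing.scale /= mulr1 -(@ler_pM2r _ `|h|) ?normr_gt0// -normrM => h1.
apply: le_trans h1; rewrite mulrBl [X in _ <= `|_ - X|]mulrAC mulVf// mul1r.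
by rewrite distrC.
Qed.

Definition cis t : R[i] := cos t +i* sin t.

Lemma cisD s t : cis (s + t) = cis s * cis t.
Proof.
apply/eqP; rewrite eq_complex /= cosD sinD; apply/andP; split; apply/eqP; ring.
Qed.

Lemma cabs_cis t : cabs (cis t) = 1.
Proof. by rewrite /Normc.normc /= cos2Dsin2 sqrtr1. Qed.

Lemma cis0 : cis 0 = 1.
Proof. by rewrite /cis cos0 sin0. Qed.

Lemma cis2pi : cis (2 * pi) = 1.
Proof. by rewrite /cis mulr_natl cos2pi sin2pi. Qed.

Definition polar s t : R[i] := (expR s)%:C * cis t.

Lemma polarD s t h k : polar (s + h) (t + k) = polar s t * polar h k.
Proof. by rewrite /polar expRD cisD rmorphM /= mulrACA. Qed.

(** [polar h k] is [exp (h + ik)]; its first-order expansion at 0 is assembled from the derivatives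
    of [expR], [cos] and [sin] there. *)
Lemma polar_small (e : R) : 0 < e -> exists2 dl : R, 0 < dl & forall h k,
  `|h| < dl -> `|k| < dl ->
  cabs (polar h k - 1 - (h +i* k)) <= e * (`|h| + `|k|).
Proof.
move=> e0; have [e1 [e10 e14 e11]] : exists e1 : R, [/\ 0 < e1, e1 <= e / 8 & e1 <= 1].
  exists (Num.min (e / 8) 1); split; last by rewrite ge_min lexx orbT.
    by rewrite lt_min ltr01 andbT divr_gt0.
  by rewrite ge_min lexx.
have [d1 d10 H1] := is_derive_small (is_derive_expR 0) e10.
have [d2 d20 H2] := is_derive_small (is_derive_cos 0) e10.
have [d3 d30 H3] := is_derive_small (is_derive_sin 0) e10.
exists (Num.min (Num.min d1 d2) (Num.min d3 e1)) => [|h k].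
  by rewrite !lt_min d10 d20 d30.
rewrite !lt_min => /andP[/andP[hd1 _] /andP[_ he]] /andP[/andP[_ kd2] /andP[kd3 ke]].
have := H1 _ hd1; have := H2 _ kd2; have := H3 _ kd3.
rewrite !addr0 expR0 cos0 sin0 oppr0 mul0r mul1r mul1r !subr0 => K3 K2 K1.
pose u := cis k - 1; pose x := expR h - 1.
have -> : polar h k - 1 - (h +i* k) = x%:C * u + (x - h)%:C + (u - (0 +i* k)).
  rewrite /u /x /polar.
  by apply/eqP; rewrite eq_complex /=; apply/andP; split; apply/eqP; ring.
have U : cabs (u - (0 +i* k)) <= 2 * e1 * `|k|.
  apply: (le_trans (cabs_le_ReIm _)); rewrite /= subr0 -addrA addrA.
  by move: K2 K3; rewrite !oppr0 !addr0; lra.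
have U' : cabs u <= 3 * `|k|.
  rewrite -(subrK (0 +i* k) u); apply: (le_trans (le_normcD _ _)).
  have : cabs (0 +i* k) <= `|k|.
    by apply: (le_trans (cabs_le_ReIm _)); rewrite /= normr0 add0r.
  have : 2 * e1 * `|k| <= 2 * `|k| by rewrite ler_wpM2r//; lra.
  by move: U; lra.
have X : `|x| <= 2 * `|h|.
  have : `|x| <= `|x - h| + `|h| by rewrite -{1}(subrK h x) ler_normD.
  have : e1 * `|h| <= 1 * `|h| by rewrite ler_wpM2r.
  by move: K1; rewrite /x; lra.
apply: (le_trans (le_normcD _ _)); apply: (le_trans (lerD (le_normcD _ _) U)).
rewrite Normc.normcM !cabsE.
have : `|x| * cabs u <= 2 * `|h| * (3 * `|k|) by rewrite ler_pM// cabs_ge0.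
have : 2 * `|h| * (3 * `|k|) <= 2 * `|h| * (3 * e1).
  by rewrite !ler_wpM2l ?mulr_ge0// ltW.
have : e1 * `|h| <= e / 8 * `|h| by rewrite ler_wpM2r.
have : e1 * `|k| <= e / 8 * `|k| by rewrite ler_wpM2r.
have : 0 <= e * `|k| by rewrite mulr_ge0// ltW.
have : 0 <= e * `|h| by rewrite mulr_ge0// ltW.
by move: K1; rewrite /x; lra.
Qed.

Definition cder g z := exists A : R[i], forall e : R, 0 < e ->
  exists2 dl : R, 0 < dl & forall z', cabs (z' - z) < dl ->
    cabs (g z' - g z - A * (z' - z)) <= e * cabs (z' - z).

Definition ccont g z := forall e : R, 0 < e -> exists2 dl : R, 0 < dl &
  forall z', cabs (z' - z) < dl -> cabs (g z' - g z) <= e.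

Lemma cder_ccont g z : cder g z -> ccont g z.
Proof.
move=> [A H] e e0; have [dl dl0 {}H] := H 1 ltr01.
have c0 : 0 < 1 + cabs A by rewrite ltr_wpDr// cabs_ge0.
exists (Num.min dl (e / (1 + cabs A))) => [|z'].
  by rewrite lt_min dl0 divr_gt0.
rewrite lt_min => /andP[/H{}H h]; rewrite -(subrK (A * (z' - z)) (_ - _)).
apply: (le_trans (le_normcD _ _)); rewrite Normc.normcM.
apply: (le_trans (lerD H (lexx _))); rewrite -mulrDl mulrC.
by rewrite -ler_pdivlMr// ltW.
Qed.

Lemma ccontM f g z : ccont f z -> ccont g z -> ccont (fun z => f z * g z) z.
Proof.
move=> cf cg e e0; pose C := 1 + cabs (f z) + cabs (g z).
have C1 : 1 <= C by rewrite /C -addrA lerDl addr_ge0 ?cabs_ge0.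
have C0 : 0 < C by apply: lt_le_trans C1.
pose e1 := Num.min 1 (e / (2 * C)).
have e10 : 0 < e1 by rewrite lt_min ltr01 divr_gt0// mulr_gt0.
have [d1 d10 H1] := cf _ e10; have [d2 d20 H2] := cg _ e10.
exists (Num.min d1 d2) => [|z']; first by rewrite lt_min d10.
rewrite lt_min => /andP[/H1{}H1 /H2{}H2].
rewrite (_ : _ - _ = (f z' - f z) * (g z' - g z) + ((f z' - f z) * g z + f z * (g z' - g z))); last by ring.
have e11 : e1 <= 1 by rewrite ge_min lexx.
have e1C : e1 * C <= e / 2.
  rewrite -ler_pdivlMr// -[_ / 2 / C]mulrA -invfM.
  by rewrite ge_min lexx orbT.
apply: (@le_trans _ _ (e1 * C)); last by lra.
apply: (le_trans (le_normcD _ _)).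
have -> : e1 * C = e1 + (e1 * cabs (g z) + cabs (f z) * e1) by rewrite /C; ring.
rewrite lerD//.
  by rewrite Normc.normcM; apply: le_trans (ler_pM (cabs_ge0 _) (cabs_ge0 _) H1 (le_trans H2 e11)) _; rewrite mulr1.
apply: (le_trans (le_normcD _ _)); rewrite !Normc.normcM lerD//.
  by rewrite ler_wpM2r// cabs_ge0.
by rewrite ler_wpM2l// cabs_ge0.
Qed.

Lemma cder_mul f g z : cder f z -> cder g z -> cder (fun z => f z * g z) z.
Proof.
move=> df dg; have cf := cder_ccont df; have cg := cder_ccont dg.
case: df => A HA; case: dg => B HB.
exists (A * g z + f z * B) => e e0.
pose C := 1 + cabs (f z) + cabs (g z) + cabs A.
have a0 := cabs_ge0 (f z); have b0 := cabs_ge0 (g z); have c0 := cabs_ge0 A.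
have C0 : 0 < C by rewrite /C; lra.
pose e1 := Num.min 1 (e / (2 * C)).
have e10 : 0 < e1 by rewrite lt_min ltr01 divr_gt0// mulr_gt0.
have e11 : e1 <= 1 by rewrite ge_min lexx.
have e1C : e1 * C <= e / 2.
  rewrite -ler_pdivlMr// -[_ / 2 / C]mulrA -invfM.
  by rewrite ge_min lexx orbT.
have [d1 d10 H1] := HA _ e10; have [d2 d20 H2] := HB _ e10.
have [d3 d30 H3] := cg _ e10.
exists (Num.min (Num.min d1 d2) d3) => [|z']; first by rewrite !lt_min d10 d20.
rewrite !lt_min => /andP[/andP[/H1{}H1 /H2{}H2] /H3{}H3].
set w := z' - z in H1 H2 *.
rewrite (_ : _ - _ = (f z' - f z - A * w) * (g z' - g z) +
  (f z' - f z - A * w) * g z + A * w * (g z' - g z) + f z * (g z' - g z - B * w)); last by ring.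
apply: (@le_trans _ _ (e1 * C * cabs w)); last first.
  by rewrite ler_wpM2r ?cabs_ge0//; lra.
have w0 := cabs_ge0 w.
apply: (le_trans (le_normcD _ _)).
have -> : e1 * C * cabs w = e1 * cabs w * 1 + e1 * cabs w * cabs (g z) +
  cabs A * cabs w * e1 + cabs (f z) * (e1 * cabs w) by rewrite /C; ring.
rewrite lerD//; last by rewrite Normc.normcM ler_wpM2l.
apply: (le_trans (le_normcD _ _)); rewrite lerD//; last first.
  by rewrite !Normc.normcM ler_wpM2l// mulr_ge0.
apply: (le_trans (le_normcD _ _)); rewrite lerD//; rewrite Normc.normcM.
  by rewrite ler_pM ?cabs_ge0// (le_trans H3).
by rewrite ler_wpM2r.
Qed.

Lemma cder_cst (c : R[i]) z : cder (fun=> c) z.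
Proof.
by exists 0 => e e0; exists 1 => // z' _; rewrite subrr mul0r subr0 Normc.normc0 mulr_ge0 ?cabs_ge0// ltW.
Qed.

Lemma cder_id z : cder id z.
Proof.
by exists 1 => e e0; exists 1 => // z' _; rewrite mul1r subrr Normc.normc0 mulr_ge0 ?cabs_ge0// ltW.
Qed.

Lemma cderD f g z : cder f z -> cder g z -> cder (fun z => f z + g z) z.
Proof.
move=> [A HA] [B HB]; exists (A + B) => e e0.
have e2 : 0 < e / 2 by rewrite divr_gt0.
have [d1 d10 H1] := HA _ e2; have [d2 d20 H2] := HB _ e2.
exists (Num.min d1 d2) => [|z']; first by rewrite !lt_min d10 d20.
rewrite !lt_min => /andP[/H1{}H1 /H2{}H2].
rewrite (_ : _ - _ = (f z' - f z - A * (z' - z)) + (g z' - g z - B * (z' - z))); last by ring.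
by apply: (le_trans (le_normcD _ _)); rewrite [e](splitr e) mulrDl lerD.
Qed.

Lemma cder_inv z : z != 0 -> cder (fun z => z^-1) z.
Proof.
move=> z0; exists (- z ^- 2) => e e0.
have c0 : 0 < cabs z by rewrite cabs_gt0.
(* The first bound keeps [cabs z'] above [cabs z / 2]; the second one then makes the exact error
   [(z' - z)^2 / (z^2 z')] at most [e * cabs (z' - z)]. *)
exists (Num.min (cabs z / 2) (e * (cabs z ^+ 3 / 2))) => [|z'].
  by rewrite lt_min !divr_gt0//= mulr_gt0// divr_gt0// exprn_gt0.
rewrite lt_min => /andP[h1 h2].
have c1 : cabs z / 2 <= cabs z'.
  have : cabs z <= cabs (z' - z) + cabs z'.
    by rewrite cabs_distC -{1}(subrK z' z) le_normcD.
  by lra.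
have z'0 : z' != 0 by rewrite -cabs_gt0; lra.
rewrite (_ : _ - _ = (z' - z) * ((z' - z) * (z^-2 * z'^-1))); last first.
  by field; rewrite z0 z'0.
rewrite !Normc.normcM mulrC ler_wpM2r ?cabs_ge0// !Normc.normcV cabsX.
rewrite -invfM ler_pdivrMr; last by rewrite mulr_gt0 ?exprn_gt0 ?cabs_gt0.
apply: (le_trans (ltW h2)); rewrite ler_wpM2l ?(ltW e0)//.
by rewrite exprSr -mulrA ler_wpM2l// exprn_ge0// ltW.
Qed.

(** Chain rule: by [polarD] an increment [(h, k)] multiplies [z = polar s t] by [polar h k], which
    is [1 + (h + ik)] to first order; the coefficient is therefore [A * z]. *)
Lemma rect_diff_polar g s t : cder g (polar s t) ->
  rect_diff (fun s t => g (polar s t)) s t.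
Proof.
move=> [A HA]; set z := polar s t in HA *.
exists (A * z) => e e0.
pose C := 2 * cabs z + cabs (A * z).
have C0 : 0 <= C by rewrite addr_ge0 ?mulr_ge0 ?cabs_ge0.
have C1 : 0 < 1 + C by lra.
pose e1 := Num.min 1 (e / (1 + C)).
have e10 : 0 < e1 by rewrite lt_min ltr01 divr_gt0.
have e11 : e1 <= 1 by rewrite ge_min lexx.
have e1C : e1 * (1 + C) <= e by rewrite -ler_pdivlMr// ge_min lexx orbT.
have [d1 d10 H1] := HA _ e10; have [d2 d20 H2] := polar_small e10.
exists (Num.min d2 (d1 / (2 * (1 + C)))) => [|s' t'].
  by rewrite lt_min d20 divr_gt0// mulr_gt0.
rewrite !lt_min => /andP[h1 h3] /andP[h2 h4].
have := H2 _ _ h1 h2; set h := s' - s in h1 h3 *; set k := t' - t in h2 h4 *.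
set S := `|h| + `|k|; move=> H.
have S0 : 0 <= S by rewrite addr_ge0.
have hk : cabs (h +i* k) <= S by exact: cabs_pair_le.
have zE : polar s' t' = z * polar h k by rewrite -polarD /h /k ![_ + (_ - _)]addrC !subrK.
pose u := polar h k - 1 - (h +i* k).
have dz : polar s' t' - z = z * u + z * (h +i* k) by rewrite zE /u; ring.
have P1 : cabs (polar h k - 1) <= 2 * S.
  rewrite -(subrK (h +i* k) (_ - 1)); apply: (le_trans (le_normcD _ _)).
  have : e1 * S <= 1 * S by rewrite ler_wpM2r.
  by move: H; lra.
have D : cabs (polar s' t' - z) <= 2 * cabs z * S.
  have -> : polar s' t' - z = z * (polar h k - 1) by rewrite zE; ring.
  by rewrite Normc.normcM mulrAC [leRHS]mulrC ler_wpM2l ?cabs_ge0.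
have Sd : S < d1 / (1 + C) by move: h3 h4; rewrite invfM /S; lra.
have Dd : cabs (polar s' t' - z) < d1.
  apply: (le_lt_trans D); apply: (@le_lt_trans _ _ ((1 + C) * S)).
    by apply: ler_wpM2r => //; have := cabs_ge0 (A * z); rewrite /C; lra.
  by rewrite mulrC -ltr_pdivlMr.
rewrite (_ : _ - _ = (g (polar s' t') - g z - A * (polar s' t' - z)) + A * z * u);
  last by rewrite dz; ring.
apply: (le_trans (le_normcD _ _)).
apply: (@le_trans _ _ (e1 * (1 + C) * S)); last by rewrite ler_wpM2r.
apply: (@le_trans _ _ (e1 * (2 * cabs z * S) + cabs (A * z) * (e1 * S))).
  apply: lerD.
    by apply: (le_trans (H1 _ Dd)); rewrite ler_wpM2l// ltW.
  by rewrite Normc.normcM ler_wpM2l// cabs_ge0.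
have : 0 <= e1 * S by rewrite mulr_ge0// ltW.
by rewrite /C; lra.
Qed.

Lemma cis_lip : exists2 dl : R, 0 < dl & forall s t, `|s - t| < dl ->
  cabs (cis s - cis t) <= 2 * `|s - t|.
Proof.
have [dl dl0 H] := polar_small (@ltr01 R).
exists dl => // s t st; have := H 0 (s - t); rewrite normr0 add0r mul1r => /(_ dl0 st).
have -> : polar 0 (s - t) = cis (s - t) by rewrite /polar expR0 mul1r.
have -> : cis s - cis t = cis t * (cis (s - t) - 1).
  by rewrite mulrBr mulr1 -cisD [t + _]addrC subrK.
rewrite Normc.normcM cabs_cis mul1r => h.
rewrite -(subrK (0 +i* (s - t)) (_ - 1)); apply: (le_trans (le_normcD _ _)).
have : cabs (0 +i* (s - t)) <= `|s - t|.
  by apply: (le_trans (cabs_le_ReIm _)); rewrite /= normr0 add0r.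
by move: h; lra.
Qed.

Lemma cabs_rcis r t : cabs (r%:C * cis t) = `|r|.
Proof. by rewrite Normc.normcM cabs_cis mulr1 cabsE. Qed.

Lemma ccont_rcis g r t : ccont g (r%:C * cis t) -> forall e : R, 0 < e ->
  exists2 dl : R, 0 < dl & forall r' t', `|r' - r| < dl -> `|t' - t| < dl ->
    cabs (g (r'%:C * cis t') - g (r%:C * cis t)) <= e.
Proof.
move=> cg e e0; have [d1 d10 H1] := cg _ e0; have [d2 d20 H2] := cis_lip.
have c0 : 0 < 1 + 2 * `|r| by rewrite ltr_wpDr// mulr_ge0.
exists (Num.min d2 (d1 / (1 + 2 * `|r|))) => [|r' t'].
  by rewrite lt_min d20 divr_gt0.
rewrite !lt_min => /andP[h1 h3] /andP[h2 h4]; apply: H1.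
set q := d1 / _ in h3 h4.
rewrite (_ : _ - _ = (r' - r)%:C * cis t' + r%:C * (cis t' - cis t)); last first.
  by rewrite rmorphB /=; ring.
apply: (le_lt_trans (le_normcD _ _)); rewrite cabs_rcis Normc.normcM cabsE.
apply: (@lt_le_trans _ _ (q + `|r| * (2 * q))); last first.
  by rewrite /q le_eqVlt; apply/orP; left; apply/eqP; field; rewrite gt_eqF.
apply: ltr_leD => //; rewrite ler_wpM2l//; apply: (le_trans (H2 _ _ h2)).
by rewrite ler_wpM2l// ltW.
Qed.

Lemma seg_cont_rcis g r a b : (forall t, ccont g (r%:C * cis t)) ->
  seg_cont (fun t => g (r%:C * cis t)) a b.
Proof.
move=> cg t _ e e0; have [dl dl0 H] := ccont_rcis (cg t) e0.
by exists dl => // t' ht; apply: H => //; rewrite subrr normr0.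
Qed.

(** The integral is taken against the angle and not against [dz]: it is [2 pi] times the mean value
    on the circle and still makes sense for [r = 0]. *)
Definition circ g r := seg_int (fun t => g (r%:C * cis t)) 0 (2 * pi).

Let twopi_ge0 : 0 <= 2 * pi :> R.
Proof. by rewrite mulr_ge0// pi_ge0. Qed.

(** In logarithmic polar coordinates the annulus is a rectangle. Its sides of angle 0 and [2 pi]
    carry the same values and cancel, so Goursat's theorem says that the other two sides, which are
    the two circles, have equal integrals. *)
Lemma circ_const g r1 r2 : 0 < r1 -> r1 <= r2 ->
  (forall z, r1 <= cabs z <= r2 -> cder g z) -> circ g r1 = circ g r2.
Proof.
move=> r10; rewrite le_eqVlt => /orP[/eqP->//|r12] dg.
have r20 : 0 < r2 by apply: lt_trans r12.
have h0 : 0 < ln r2 - ln r1 by rewrite subr_gt0 ltr_ln ?posrE.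
have k0 : 0 < 2 * pi :> R by rewrite mulr_gt0 ?pi_gt0.
have := @goursat R (fun s t => g (polar s t)) (ln r1) 0 _ _ h0 k0.
rewrite add0r [ln r1 + _]addrC subrK => G.
have {G} : bdry_int (fun s t => g (polar s t)) (ln r1) (ln r2) 0 (2 * pi) = 0.
  apply: G => s t /andP[s1 s2] _; apply: rect_diff_polar; apply: dg.
  rewrite Normc.normcM cabs_cis mulr1 cabsE ger0_norm ?expR_ge0//.
  by rewrite -{1}(lnK r10) -{1}(lnK r20) !ler_expR s1.
rewrite /bdry_int; set I := seg_int _ (ln r1) _.
have -> : I = 0.
  rewrite /I /seg_int -[RHS](cint0 lebesgue_measure (D := `[ln r1, ln r2]))//.
  by apply: eq_cint => x _; rewrite /polar cis0 cis2pi subrr.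
have cr r : r1 <= r <= r2 -> seg_cont (fun t => g (r%:C * cis t)) 0 (2 * pi).
  move=> rr; apply: seg_cont_rcis => t; apply: cder_ccont; apply: dg.
  by rewrite cabs_rcis ger0_norm// (le_trans (ltW r10)); case/andP: rr.
rewrite add0r => /eqP; rewrite mulf_eq0 eq_complex /= oner_eq0 andbF /=.
rewrite /seg_int; under eq_cint do rewrite /polar !lnK ?posrE//.
rewrite cintB//; last 2 first.
- by apply: seg_cont_integrable; apply: cr; rewrite lexx ltW.
- by apply: seg_cont_integrable; apply: cr; rewrite lexx ltW.
by rewrite /circ /seg_int subr_eq0 => /eqP ->.
Qed.

Lemma circ_le g r C : (forall t, ccont g (r%:C * cis t)) ->
  (forall t, 0 <= t <= 2 * pi -> cabs (g (r%:C * cis t)) <= C) -> cabs (circ g r) <= 2 * (C * (2 * pi)).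
Proof.
move=> cg gC; rewrite -[X in _ * (_ * X)]subr0; apply: cabs_seg_int_le => //.
exact: seg_cont_rcis.
Qed.

Lemma eq_circ f g r : (forall t, f (r%:C * cis t) = g (r%:C * cis t)) ->
  circ f r = circ g r.
Proof. by move=> fg; apply: eq_cint => t _. Qed.

Lemma circD f g r : (forall t, ccont f (r%:C * cis t)) ->
  (forall t, ccont g (r%:C * cis t)) ->
  circ (fun z => f z + g z) r = circ f r + circ g r.
Proof.
by move=> cf cg; rewrite /circ /seg_int cintD//; apply: seg_cont_integrable;
  apply: seg_cont_rcis.
Qed.

Lemma circZ c g r : (forall t, ccont g (r%:C * cis t)) ->
  circ (fun z => c * g z) r = c * circ g r.
Proof.
by move=> cg; rewrite /circ /seg_int cintZ//; apply: seg_cont_integrable;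
  apply: seg_cont_rcis.
Qed.

Lemma circ_cst c r : circ (fun=> c) r = c * (2 * pi)%:C.
Proof.
rewrite /circ /seg_int /cint !Rintegral_cst// fine_itv// subr0.
by apply/eqP; rewrite eq_complex /=; case: c => x y /=; apply/andP; split; apply/eqP; ring.
Qed.

(** Compactness of the interval of angles makes the continuity at radius [r0] uniform in the
    angle. *)
Lemma circ_cont g r0 : (\forall r \near r0, forall t, ccont g (r%:C * cis t)) ->
  forall e : R, 0 < e -> \forall r \near r0, cabs (circ g r - circ g r0) <= e.
Proof.
move=> cg e e0.
have p0 : 0 < 2 * (2 * pi) :> R by rewrite !mulr_gt0 ?pi_gt0.
have cg0 : forall t, ccont g (r0%:C * cis t) by exact: nbhs_singleton cg.
pose e1 := e / (2 * (2 * pi)).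
have e10 : 0 < e1 by rewrite divr_gt0.
have K : \forall r \near r0, `[0, 2 * pi] `<=`
    (fun t => cabs (g (r%:C * cis t) - g (r0%:C * cis t)) <= e1).
  have /compact_near_coveringP C := @segment_compact R 0 (2 * pi).
  apply: (C R (nbhs r0) (fun r t =>
    cabs (g (r%:C * cis t) - g (r0%:C * cis t)) <= e1)) => t _.
  have [dl dl0 H] := ccont_rcis (cg0 t) (divr_gt0 e10 (@ltr0n R 2)).
  exists (ball t dl, ball r0 dl) => [|[t' r] /= [h1 h2]].
    by split; exact: nbhsx_ballx.
  rewrite -(subrK (g (r0%:C * cis t)) (g (r%:C * _))) -addrA.
  apply: (le_trans (le_normcD _ _)); rewrite [e1](splitr e1) lerD//.
    by apply: H; rewrite distrC.
  by rewrite cabs_distC; apply: H; rewrite ?subrr ?normr0// distrC.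
near=> r.
have hK : `[0, 2 * pi] `<=`
    (fun t => cabs (g (r%:C * cis t) - g (r0%:C * cis t)) <= e1) by near: r.
have cr : forall t, ccont g (r%:C * cis t) by near: r.
rewrite /circ /seg_int -cintB//; last 2 first.
- exact/seg_cont_integrable/seg_cont_rcis.
- exact/seg_cont_integrable/seg_cont_rcis.
apply: (@le_trans _ _ (2 * (e1 * (2 * pi - 0)))).
  apply: cabs_seg_int_le => //; first by apply: seg_contB; exact: seg_cont_rcis.
by rewrite subr0 /e1 mulrCA divfK// gt_eqF.
Unshelve. all: by end_near. Qed.

(* The circle means of [g] are constant on either side of [cabs w], and they
   are continuous at [0] and at [cabs w]. *)
Lemma circ_punctured g w r rho : cabs w < r -> r < rho ->
  (forall z, cabs z < rho -> ccont g z) ->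
  (forall z, cabs z < rho -> z != w -> cder g z) -> circ g r = circ g 0.
Proof.
move=> wr rrho cg dg.
have r0 : 0 < r by apply: le_lt_trans wr; exact: cabs_ge0.
have cnear r1 : 0 <= r1 -> r1 <= r -> \forall x \near r1, forall t, ccont g (x%:C * cis t).
  move=> r10 r1r; near=> x => t; apply: cg; rewrite cabs_rcis.
  near: x; apply/nbhs_normP; exists (rho - r1); first by rewrite /= subr_gt0; lra.
  move=> x /=; rewrite distrC => h; rewrite -(subrK r1 x).
  by apply: (le_lt_trans (ler_normD _ _)); rewrite (ger0_norm r10); move: h; lra.
have step r1 r2 : 0 <= r1 -> r1 < r2 -> r2 <= r ->
    (forall x y, r1 < x -> x <= y -> y < r2 -> circ g x = circ g y) ->
    circ g r1 = circ g r2.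
  move=> r10 r12 r2r H; apply/eqP; rewrite -subr_eq0 -[_ == _]negbK -cabs_gt0; apply/negP => X0.
  set e := cabs _ in X0; have e0 : 0 < e / 3 by rewrite divr_gt0.
  have /nbhs_normP[d1 /= d10 H1] := circ_cont (cnear r1 r10 (le_trans (ltW r12) r2r)) e0.
  have /nbhs_normP[d2 /= d20 H2] := circ_cont (cnear r2 (le_trans r10 (ltW r12)) r2r) e0.
  pose x := r1 + Num.min (d1 / 2) ((r2 - r1) / 2).
  pose y := r2 - Num.min (d2 / 2) ((r2 - r1) / 2).
  have m1 : Num.min (d1 / 2) ((r2 - r1) / 2) <= d1 / 2 by rewrite ge_min lexx.
  have m1' : Num.min (d1 / 2) ((r2 - r1) / 2) <= (r2 - r1) / 2 by rewrite ge_min lexx orbT.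
  have m10 : 0 < Num.min (d1 / 2) ((r2 - r1) / 2) by rewrite lt_min; apply/andP; split; lra.
  have m2 : Num.min (d2 / 2) ((r2 - r1) / 2) <= d2 / 2 by rewrite ge_min lexx.
  have m2' : Num.min (d2 / 2) ((r2 - r1) / 2) <= (r2 - r1) / 2 by rewrite ge_min lexx orbT.
  have m20 : 0 < Num.min (d2 / 2) ((r2 - r1) / 2) by rewrite lt_min; apply/andP; split; lra.
  have := H1 x; rewrite /= ltr_norml => /(_ _)H1x.
  have {H1x} B1 : cabs (circ g x - circ g r1) <= e / 3.
    by apply: H1x; rewrite /x; apply/andP; split; lra.
  have {H2} B2 : cabs (circ g y - circ g r2) <= e / 3.
    by apply: H2; rewrite /= ltr_norml /y; apply/andP; split; lra.
  have xy : circ g x = circ g y by apply: H; rewrite /x /y; lra.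
  have : e <= cabs (circ g y - circ g r2) + cabs (circ g x - circ g r1).
    rewrite /e (_ : _ - _ = (circ g y - circ g r2) - (circ g x - circ g r1)); last first.
      by rewrite xy; ring.
    exact: le_cabsB.
  by lra.
have [w0|w0] := eqVneq (cabs w) 0.
  apply/esym/step => // x y x0 xy yr; apply: circ_const => // z /andP[z1 z2].
  apply: dg; first by lra.
  by apply/eqP => zw; move: z1; rewrite zw w0; lra.
have wp : 0 < cabs w by rewrite lt_def w0 cabs_ge0.
transitivity (circ g (cabs w)); apply/esym/step => //; try (exact: ltW);
    move=> x y x0 xy yr; apply: circ_const; (try lra) => z /andP[z1 z2].
- apply: dg; first by lra.
  by apply/eqP => zw; move: z1; rewrite zw; lra.
- apply: dg; first by lra.
  by apply/eqP => zw; move: z2; rewrite zw; lra.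
Unshelve. all: by end_near. Qed.

End circle.

(** * Taylor coefficients *)

Section power_series.
Variable R : realType.
Implicit Types (g phi : R[i] -> R[i]) (z w : R[i]) (r s t : R).

Lemma cder_shift g w z : cder g (z - w) -> cder (fun z => g (z - w)) z.
Proof.
move=> [A H]; exists A => e /H[dl dl0 {}H]; exists dl => // z'.
have -> : z' - z = z' - w - (z - w) by ring.
exact: H.
Qed.

Lemma cder_sum (I : Type) (s : seq I) (F : I -> R[i] -> R[i]) z :
  (forall i, cder (F i) z) -> cder (fun z => \sum_(i <- s) F i z) z.
Proof.
move=> dF; elim: s => [|i s IH].
  by under eq_fun do rewrite big_nil; exact: cder_cst.
by under eq_fun do rewrite big_cons; exact: cderD.
Qed.

Lemma eq_cder f g z (d : R) : 0 < d ->
  (forall z', cabs (z' - z) < d -> f z' = g z') -> cder f z -> cder g z.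
Proof.
move=> d0 fg [A H]; exists A => e /H[dl dl0 {}H].
exists (Num.min d dl) => [|z']; first by rewrite lt_min d0.
rewrite lt_min => /andP[h1 h2]; rewrite -fg// -fg; first exact: H.
by rewrite subrr Normc.normc0.
Qed.

(** This is the Cauchy kernel for integration against the angle. A finite geometric sum with exact
    remainder avoids exchanging a series with an integral. *)
Lemma geometric_kernel z w (K : nat) : z != 0 -> z != w ->
  z / (z - w) = \sum_(k < K) (w * z^-1) ^+ k + (w * z^-1) ^+ K * (z / (z - w)).
Proof.
move=> z0 zw; elim: K => [|K IH]; first by rewrite big_ord0 add0r mul1r.
rewrite {1}IH big_ord_recr /= -addrA; congr (_ + _).
have d0 : z - w != 0 by rewrite subr_eq0.
by rewrite exprSr -mulrA -{2}[_ ^+ K]mulr1 -mulrDr; congr (_ * _); field; rewrite z0 d0.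
Qed.

Lemma rcis_neq0 r t : 0 < r -> r%:C * cis t != 0.
Proof. by move=> r0; rewrite -cabs_gt0 cabs_rcis gtr0_norm. Qed.

Lemma circ_sum (I : Type) (s : seq I) (F : I -> R[i] -> R[i]) r :
  (forall i t, ccont (F i) (r%:C * cis t)) ->
  circ (fun z => \sum_(i <- s) F i z) r = \sum_(i <- s) circ (F i) r.
Proof.
move=> cF; rewrite /circ /seg_int cint_sum// => i _.
exact/seg_cont_integrable/seg_cont_rcis.
Qed.

Lemma cder_expV z (k : nat) : z != 0 -> cder (fun z => z^-1 ^+ k) z.
Proof.
move=> z0; elim: k => [|k IH]; first by under eq_fun do rewrite expr0; exact: cder_cst.
under eq_fun do rewrite exprS; apply: cder_mul => //; exact: cder_inv.
Qed.

Let twopi_neq0 : (2 * pi)%:C != 0 :> R[i].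
Proof. by rewrite eq_complex /= eqxx andbT gt_eqF// mulr_gt0// pi_gt0. Qed.

(** For [k > 0] the integrals on the circles of radius [r] and [2 r] are equal by [circ_const], but
    the second is [2^-k] times the first; hence both vanish. *)
Lemma circ_expV r (k : nat) : 0 < r ->
  circ (fun z => z^-1 ^+ k) r = if k == 0%N then (2 * pi)%:C else 0.
Proof.
move=> r0; case: eqP => [->|/eqP k0].
  by rewrite (eq_circ (g := fun=> 1)) ?circ_cst ?mul1r.
have := @circ_const R (fun z => z^-1 ^+ k) r (2 * r) r0.
have -> : circ (fun z => z^-1 ^+ k) (2 * r) = 2^-1 ^+ k * circ (fun z => z^-1 ^+ k) r.
  rewrite -circZ; last by move=> t; apply/cder_ccont/cder_expV/rcis_neq0.
  rewrite /circ; apply: eq_cint => t _; rewrite -exprMn -invfM mulrCA; congr (_^-1 ^+ _).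
  by rewrite (rmorphM (real_complex R)) (rmorph_nat (real_complex R)); ring.
move=> H; have {H} H : circ (fun z => z^-1 ^+ k) r = 2^-1 ^+ k * circ (fun z => z^-1 ^+ k) r.
  apply: H; first by lra.
  by move=> z /andP[z1 _]; apply: cder_expV; rewrite -cabs_gt0; lra.
apply/eqP; move/eqP: H; rewrite -subr_eq0 -{1}[circ _ _]mul1r -mulrBl mulf_eq0.
case/orP => //; rewrite subr_eq0 => /eqP/(congr1 cabs).
rewrite Normc.normc1 cabsX Normc.normcV => /esym/eqP.
have -> : cabs (2 : R[i]) = 2.
  by rewrite -(rmorph_nat (real_complex R)) cabsE ger0_norm.
have h2 : (2^-1 : R) ^+ k < 1.
  by rewrite exprn_ilt1// invf_lt1// ltr1n.
by rewrite lt_eqF.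
Qed.

Lemma circ_bounded g r : (forall t, ccont g (r%:C * cis t)) ->
  exists M, forall t, 0 <= t <= 2 * pi -> cabs (g (r%:C * cis t)) <= M.
Proof.
move=> cg; have p0 : 0 <= 2 * pi :> R by rewrite mulr_ge0// pi_ge0.
have : {within `[0, 2 * pi], continuous (fun t => cabs (g (r%:C * cis t)))}.
  apply: continuous_subspaceT => t; apply/cvgrPdist_le => e e0.
  have [dl dl0 H] := ccont_rcis (cg t) e0; apply/nbhs_normP; exists dl => // t' /=.
  rewrite distrC => h; rewrite distrC (le_trans (ge_cabs_dist _ _))//.
  by apply: H => //; rewrite subrr normr0.
move=> /(EVT_max p0)[c _ H]; exists (cabs (g (r%:C * cis c))) => t tI.
by apply: H; rewrite in_itv.
Qed.

(** Cauchy's formula for the coefficient; against the angle the kernel is [z^-k] rather than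
    [z^-(k+1)]. The radius [rho / 2] is one choice among all those below [rho], see
    [taylor_coefE]. *)
Definition taylor_coef phi rho (k : nat) : R[i] :=
  circ (fun z => phi z * z^-1 ^+ k) (rho / 2) / (2 * pi)%:C.

Section taylor.
Variables (phi : R[i] -> R[i]) (rho : R).
Hypothesis rho0 : 0 < rho.
Hypothesis dphi : forall z, cabs z < rho -> cder phi z.

Let a := taylor_coef phi rho.

Let c_circ r (k : nat) t : 0 < r -> r < rho ->
  ccont (fun z => phi z * z^-1 ^+ k) (r%:C * cis t).
Proof.
move=> r0 rr; apply: cder_ccont; apply: cder_mul.
  by apply: dphi; rewrite cabs_rcis gtr0_norm.
by apply: cder_expV; exact: rcis_neq0.
Qed.

Lemma taylor_coefE r k : 0 < r -> r < rho ->
  circ (fun z => phi z * z^-1 ^+ k) r = (2 * pi)%:C * a k.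
Proof.
move=> r0 rr; rewrite /a /taylor_coef; set c := circ _ (rho / 2).
rewrite mulrCA mulfV// mulr1 /c.
have dg r1 r2 z : 0 < r1 -> r2 < rho -> r1 <= cabs z <= r2 ->
    cder (fun z => phi z * z^-1 ^+ k) z.
  move=> r10 r2r /andP[z1 z2]; apply: cder_mul; first by apply: dphi; lra.
  by apply: cder_expV; rewrite -cabs_gt0; lra.
have [rl|rl] := leP r (rho / 2).
  by apply: circ_const => // z hz; apply: (dg r (rho / 2)) => //; lra.
apply/esym/circ_const; [by lra|by lra|].
by move=> z hz; apply: (dg (rho / 2) r) => //; lra.
Qed.

Lemma taylor_coef_le r M k : 0 < r -> r < rho ->
  (forall t, 0 <= t <= 2 * pi -> cabs (phi (r%:C * cis t)) <= M) ->
  cabs (a k) * r ^+ k <= 2 * M.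
Proof.
move=> r0 rr phiM.
have := @circ_le R (fun z => phi z * z^-1 ^+ k) r (M / r ^+ k).
rewrite taylor_coefE// Normc.normcM cabsE gtr0_norm ?mulr_gt0 ?pi_gt0// => H.
have {}H : 2 * pi * cabs (a k) <= 2 * (M / r ^+ k * (2 * pi)).
  apply: H => [t|t tI]; first exact: c_circ.
  rewrite Normc.normcM cabsX Normc.normcV cabs_rcis gtr0_norm// exprVn.
  by rewrite ler_wpM2r ?invr_ge0 ?exprn_ge0 ?phiM// ltW.
have p0 : 0 < 2 * pi :> R by rewrite mulr_gt0// pi_gt0.
have rk : 0 < r ^+ k by rewrite exprn_gt0.
by rewrite -ler_pdivlMr// -(ler_pM2l p0); apply: (le_trans H);
  rewrite le_eqVlt; apply/orP; left; apply/eqP; ring.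
Qed.

(** The function [g z = z (phi z - phi w) / (z - w)], completed at [w], is continuous there and
    vanishes at 0. By [circ_punctured] its integral on a circle enclosing [w] is the one at radius
    0, hence 0. Inserting the finite geometric sum for [z / (z - w)] expresses the Taylor remainder
    by an integral with the factor [(w / z)^K]. *)
Lemma taylor_remainder w : cabs w < rho -> exists C q : R,
  [/\ 0 <= q, q < 1 & forall K : nat,
    cabs (phi w - \sum_(k < K) a k * w ^+ k) <= C * q ^+ K].
Proof.
move=> wr; have w0 := cabs_ge0 w.
pose r := (cabs w + rho) / 2.
have wr' : cabs w < r by rewrite /r; lra.
have rr : r < rho by rewrite /r; lra.
have r0 : 0 < r by lra.
have [A HA] := dphi wr.
pose q z := if z == w then A else (phi z - phi w) / (z - w).
pose g z := q z * z.
have qE z : z != w -> q z = (phi z - phi w) / (z - w).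
  by rewrite /q => /negbTE ->.
have dq z : cabs z < rho -> z != w -> cder q z.
  move=> zr zw; have : cder (fun z => (phi z - phi w) * (z - w)^-1) z.
    apply: cder_mul; first by apply: cderD; [exact: dphi|exact: cder_cst].
    apply: (@cder_shift (fun z => z^-1)).
    by apply: cder_inv; rewrite subr_eq0.
  apply: (@eq_cder _ _ _ (cabs (z - w))); first by rewrite cabs_gt0 subr_eq0.
  move=> z' h; rewrite qE//; apply/eqP => zw'; move: h.
  by rewrite zw' cabs_distC ltxx.
have cq : ccont q w.
  move=> e e0; have [dl dl0 H] := HA _ e0; exists dl => // z' h.
  have [->|zw] := eqVneq z' w; first by rewrite subrr Normc.normc0 ltW.
  have d0 : z' - w != 0 by rewrite subr_eq0.
  rewrite qE// /q eqxx -(ler_pM2r (_ : 0 < cabs (z' - w))) ?cabs_gt0//.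
  rewrite -Normc.normcM mulrBl divfK//; exact: H.
have cg z : cabs z < rho -> ccont g z.
  move=> zr; have [->|zw] := eqVneq z w.
    by apply: ccontM => //; apply/cder_ccont/cder_id.
  by apply/cder_ccont/cder_mul; [exact: dq|exact: cder_id].
have dg z : cabs z < rho -> z != w -> cder g z.
  by move=> zr zw; apply: cder_mul; [exact: dq|exact: cder_id].
have G0 : circ g r = 0.
  rewrite (circ_punctured wr' rr cg dg) (eq_circ (g := fun=> 0)) ?circ_cst ?mul0r//.
  by move=> t; rewrite mul0r /g mulr0.
have r0' t : cabs (r%:C * cis t) < rho by rewrite cabs_rcis gtr0_norm.
have cgr t : ccont g (r%:C * cis t) by exact: cg.
have [M HM] := circ_bounded cgr.
have M0 : 0 <= M.
  by apply: le_trans (HM 0 _); rewrite ?cabs_ge0// lexx mulr_ge0// pi_ge0.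
have cV k t : ccont (fun z => z^-1 ^+ k) (r%:C * cis t).
  by apply/cder_ccont/cder_expV/rcis_neq0.
have cgV k t : ccont (fun z => g z * z^-1 ^+ k) (r%:C * cis t) by exact: ccontM.
have p0 : 0 < 2 * pi :> R by rewrite mulr_gt0// pi_gt0.
(* [2 * M] bounds the remainder integral; the summand [cabs (phi w)] takes care of [K = 0], where
   the sum is empty. *)
exists (2 * M + cabs (phi w)), (cabs w / r); split.
- by rewrite divr_ge0// ltW.
- by rewrite ltr_pdivrMr// mul1r.
case=> [|K]; first by rewrite big_ord0 subr0 expr0 mulr1 lerDr mulr_ge0.
have E : (2 * pi)%:C * (phi w - \sum_(k < K.+1) a k * w ^+ k) =
    w ^+ K.+1 * circ (fun z => g z * z^-1 ^+ K.+1) r.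
  pose F (k : nat) z := w ^+ k * (phi z * z^-1 ^+ k + - phi w * z^-1 ^+ k).
  have dF k t : cder (F k) (r%:C * cis t).
    apply: cder_mul; first exact: cder_cst.
    have z0 := rcis_neq0 t r0; apply: cderD; apply: cder_mul.
    - exact: dphi.
    - exact: cder_expV.
    - exact: cder_cst.
    - exact: cder_expV.
  have cF k t := cder_ccont (dF k t).
  have circF k : circ (F k) r =
      w ^+ k * ((2 * pi)%:C * a k - phi w * (if k == 0%N then (2 * pi)%:C else 0)).
    rewrite /F circZ; last first.
      move=> t; have z0 := rcis_neq0 t r0; apply/cder_ccont/cderD; apply: cder_mul.
      - exact: dphi.
      - exact: cder_expV.
      - exact: cder_cst.
      - exact: cder_expV.
    rewrite circD => [|t|t]; [|exact: c_circ|]; last first.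
      by apply/cder_ccont/cder_mul; [exact: cder_cst|exact/cder_expV/rcis_neq0].
    rewrite taylor_coefE// circZ => [|t]; last exact/cder_ccont/cder_expV/rcis_neq0.
    by rewrite circ_expV// mulNr.
  have : circ g r = \sum_(k < K.+1) circ (F k) r +
      w ^+ K.+1 * circ (fun z => g z * z^-1 ^+ K.+1) r.
    rewrite -circ_sum// -circZ// -circD => [|t|t]; last 2 first.
    - by apply/cder_ccont/cder_sum => k; exact: dF.
    - by apply: ccontM => //; exact/cder_ccont/cder_cst.
    apply: eq_circ => t; set z := _ * cis t; have z0 : z != 0 by exact: rcis_neq0.
    have zw : z != w.
      by apply/eqP => zw; move: wr'; rewrite -zw cabs_rcis gtr0_norm// ltxx.
    have gz : g z = (phi z - phi w) * (z / (z - w)).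
      by rewrite /g qE// mulrAC mulrA.
    rewrite {1}gz (geometric_kernel K.+1)// mulrDr mulr_sumr; congr (_ + _).
      by apply: eq_bigr => k _; rewrite /F exprMn; ring.
    by rewrite gz exprMn; ring.
  rewrite G0 => /esym/eqP; rewrite addr_eq0 => /eqP H.
  rewrite -[RHS]opprK -H mulrBr mulr_sumr big_ord_recl [in RHS]big_ord_recl !circF /=.
  rewrite !expr0 !mulr1 !mul1r.
  have -> : \sum_(i < K) circ (F (bump 0 i)) r = \sum_(i < K) (2 * pi)%:C * (a (bump 0 i) * w ^+ bump 0 i).
    by apply: eq_bigr => k _; rewrite circF /= mulr0 subr0; ring.
  by ring.
have : (2 * pi) * cabs (phi w - \sum_(k < K.+1) a k * w ^+ k) <=
    cabs w ^+ K.+1 * (2 * (M / r ^+ K.+1 * (2 * pi))).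
  have -> : 2 * pi = cabs ((2 * pi)%:C : R[i]) by rewrite cabsE gtr0_norm.
  rewrite -Normc.normcM E Normc.normcM cabsX ler_wpM2l ?exprn_ge0//.
  rewrite cabsE gtr0_norm//; apply: circ_le => // t tI.
  rewrite Normc.normcM cabsX Normc.normcV cabs_rcis gtr0_norm// exprVn.
  by rewrite ler_wpM2r ?HM// invr_ge0 exprn_ge0// ltW.
have aux (x y N p : R) : x * (2 * (N * y * p)) = p * (2 * N * (x * y)) by ring.
rewrite aux -expr_div_n (ler_pM2l p0) => /le_trans; apply.
by rewrite ler_wpM2r ?lerDl ?cabs_ge0// exprn_ge0// divr_ge0// ltW.
Qed.

End taylor.

End power_series.

(** * Lebesgue measure on C^n *)

Section complex_measurability.
Context d (T : measurableType d) (R : realType).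
Implicit Types (D : set T) (f g : T -> R[i]).

Lemma measurable_Re_Im D f : measurable_fun D f ->
  measurable_fun D (fun x => complex.Re (f x)) /\
  measurable_fun D (fun x => complex.Im (f x)).
Proof.
have mp : measurable_fun setT (@pair_of_complex R).
  by move=> _ B mB; exists B => //; rewrite setTI.
move=> mf; have m2 : measurable_fun D (@pair_of_complex R \o f).
  exact: measurableT_comp.
by split; [exact: (measurableT_comp measurable_fst m2)|
           exact: (measurableT_comp measurable_snd m2)].
Qed.

Lemma measurable_complex D f : measurable_fun D (fun x => complex.Re (f x)) ->
  measurable_fun D (fun x => complex.Im (f x)) -> measurable_fun D f.
Proof.
move=> m1 m2.
move=> mD.
have r1 := (measurable_restrictT _ mD).1 m1.
have r2 := (measurable_restrictT _ mD).1 m2.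
have := measurableT_comp (@measurable_complex_of_pair R) (measurable_fun_pair r1 r2).
move/(measurable_funS measurableT (@subsetT _ D)) => r3.
suff: measurable_fun D f by exact.
by apply: eq_measurable_fun r3 => x xD /=; rewrite !patchE xD; case: (f x).
Qed.

Lemma cmeasurableD D f g : measurable_fun D f -> measurable_fun D g ->
  measurable_fun D (fun x => f x + g x).
Proof.
move=> /measurable_Re_Im[f1 f2] /measurable_Re_Im[g1 g2].
apply: measurable_complex.
  under eq_fun do rewrite ReD; exact: measurable_funD.
under eq_fun do rewrite ImD; exact: measurable_funD.
Qed.

Lemma cmeasurableM D f g : measurable_fun D f -> measurable_fun D g ->
  measurable_fun D (fun x => f x * g x).
Proof.
move=> /measurable_Re_Im[f1 f2] /measurable_Re_Im[g1 g2].
apply: measurable_complex.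
  under eq_fun do rewrite ReM.
  by apply: measurable_funB; exact: measurable_funM.
under eq_fun do rewrite ImM.
by apply: measurable_funD; exact: measurable_funM.
Qed.

Lemma cmeasurable_conj D f : measurable_fun D f ->
  measurable_fun D (fun x => conjc (f x)).
Proof.
move=> /measurable_Re_Im[f1 f2]; apply: measurable_complex.
  by apply: eq_measurable_fun f1 => x _; case: (f x).
have := measurable_funN f2.
by apply: eq_measurable_fun => x _ /=; case: (f x).
Qed.

Lemma cmeasurable_sum D (I : Type) (s : seq I) (P : pred I) (F : I -> T -> R[i]) :
  (forall i, measurable_fun D (F i)) ->
  measurable_fun D (fun x => \sum_(i <- s | P i) F i x).
Proof.
move=> mF; elim: s => [|i s IH].
  by under eq_fun do rewrite big_nil; exact: measurable_cst.
under eq_fun do rewrite big_cons.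
by case: (P i) => //; exact: cmeasurableD.
Qed.

Lemma cmeasurable_prod D (I : Type) (s : seq I) (P : pred I) (F : I -> T -> R[i]) :
  (forall i, measurable_fun D (F i)) ->
  measurable_fun D (fun x => \prod_(i <- s | P i) F i x).
Proof.
move=> mF; elim: s => [|i s IH].
  by under eq_fun do rewrite big_nil; exact: measurable_cst.
under eq_fun do rewrite big_cons.
by case: (P i) => //; exact: cmeasurableM.
Qed.

Lemma cmeasurableX D f (n : nat) : measurable_fun D f ->
  measurable_fun D (fun x => f x ^+ n).
Proof.
move=> mf; elim: n => [|n IH].
  by under eq_fun do rewrite expr0; exact: measurable_cst.
by under eq_fun do rewrite exprS; exact: cmeasurableM.
Qed.

Lemma measurable_cabs_sqr D f : measurable_fun D f ->
  measurable_fun D (fun x => cabs (f x) ^+ 2).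
Proof.
move=> /measurable_Re_Im[f1 f2]; under eq_fun do rewrite cabs_sqr.
by apply: measurable_funD; exact: measurable_funX.
Qed.

Lemma measurable_cabs D f : measurable_fun D f ->
  measurable_fun D (fun x => cabs (f x)).
Proof.
move=> mf; have := measurableT_comp (measurable_powR 2^-1) (measurable_cabs_sqr mf).
apply: eq_measurable_fun => x _ /=.
by rewrite powR12_sqrt ?sqr_ge0// sqrtr_sqr ger0_norm// cabs_ge0.
Qed.

Lemma cmeasurable_real D (h : T -> R) : measurable_fun D h ->
  measurable_fun D (fun x => (h x)%:C).
Proof. by move=> mh; apply: measurable_complex => //=; exact: measurable_cst. Qed.

End complex_measurability.

(** * Maps that multiply a measure by a constant *)

Section scales.
Context (R : realType).

(** With preimages no inverse map has to be named, and [c] is the inverse of the Jacobian. *)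
Definition scales d (T : measurableType d) (mu : set T -> \bar R) (c : R)
    (phi : T -> T) :=
  measurable_fun setT phi /\
  forall A, measurable A -> mu (phi @^-1` A) = (c%:E * mu A)%E.

Lemma measurable_preimage d d' (T : measurableType d) (T' : measurableType d')
    (f : T -> T') A : measurable_fun setT f -> measurable A ->
  measurable (f @^-1` A).
Proof. by move=> mf mA; rewrite -[X in measurable X]setTI; exact: mf. Qed.

Lemma scales_comp d (T : measurableType d) (mu : set T -> \bar R) (c1 c2 : R)
    (f g : T -> T) :
  scales mu c1 f -> scales mu c2 g -> scales mu (c1 * c2) (fun x => g (f x)).
Proof.
move=> [mf Hf] [mg Hg]; split; first exact: measurableT_comp.
move=> A mA; rewrite (_ : _ @^-1` A = f @^-1` (g @^-1` A))//.
by rewrite Hf ?Hg ?EFinM ?muleA//; exact: measurable_preimage.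
Qed.

Lemma scales_id d (T : measurableType d) (mu : set T -> \bar R) :
  scales mu 1 id.
Proof. by split => [|A mA]; [exact: measurable_id|rewrite mul1e]. Qed.

Lemma eq_scales d (T : measurableType d) (mu : set T -> \bar R) c (f g : T -> T) :
  f =1 g -> scales mu c f -> scales mu c g.
Proof. by move=> /funext ->. Qed.

Lemma scales_pushforward d d' (T : measurableType d) (T' : measurableType d')
    (mu : set T -> \bar R) (f : T -> T') c (phi : T -> T) (psi : T' -> T') :
  measurable_fun setT f -> measurable_fun setT psi ->
  (forall x, psi (f x) = f (phi x)) -> scales mu c phi ->
  scales (pushforward mu f) c psi.
Proof.
move=> mf mpsi fE [mphi H]; split => // A mA; rewrite /pushforward -H.
  by congr (mu _); apply/seteqP; split => x /=; rewrite fE.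
exact: measurable_preimage.
Qed.

Section product.
Context d1 d2 (T1 : measurableType d1) (T2 : measurableType d2).
Variables (m1 : {sigma_finite_measure set T1 -> \bar R})
  (m2 : {sigma_finite_measure set T2 -> \bar R}).

(** The map stays inside each fibre over the first coordinate and scales it by [c]; integrating the
    measures of the fibres gives the claim. All linear maps below are products of maps of this
    kind. *)
Lemma scales_skewr (g : T1 -> T2 -> T2) (c : R) : 0 <= c ->
  measurable_fun setT (fun p : T1 * T2 => g p.1 p.2) ->
  (forall x, scales m2 c (g x)) ->
  scales (m1 \x m2)%E c (fun p => (p.1, g p.1 p.2)).
Proof.
move=> c0 mg H.
have mphi : measurable_fun setT (fun p : T1 * T2 => (p.1, g p.1 p.2)).
  exact: measurable_fun_pair.
split => // A mA; rewrite /product_measure1.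
transitivity (\int[m1]_x (c%:E * m2 (xsection A x)))%E.
  apply: eq_integral => x _ /=; rewrite -(H x).2; last exact: measurable_xsection.
  congr (m2 _); apply/seteqP; split => y; rewrite /xsection /= !inE //.
by rewrite ge0_integralZl//; exact: measurable_fun_xsection.
Qed.

Lemma scales_skewl (f : T2 -> T1 -> T1) (c : R) : 0 <= c ->
  measurable_fun setT (fun p : T1 * T2 => f p.2 p.1) ->
  (forall y, scales m1 c (f y)) ->
  scales (m1 \x m2)%E c (fun p => (f p.2 p.1, p.2)).
Proof.
move=> c0 mf H.
have mphi : measurable_fun setT (fun p : T1 * T2 => (f p.2 p.1, p.2)).
  exact: measurable_fun_pair.
(* Uniqueness of the product measure allows slicing along the other coordinate. *)
have E X : measurable X -> (m1 \x m2)%E X = (m1 \x^ m2)%E X.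
  apply: product_measure_unique => A B mA mB; exact: product_measure2E.
split => // A mA; rewrite !E//; last exact: measurable_preimage.
rewrite /product_measure2.
transitivity (\int[m2]_y (c%:E * m1 (ysection A y)))%E.
  apply: eq_integral => y _ /=; rewrite -(H y).2; last exact: measurable_ysection.
  congr (m1 _); apply/seteqP; split => x; rewrite /ysection /= !inE //.
by rewrite ge0_integralZl//; exact: measurable_fun_ysection.
Qed.

End product.

Section lebesgue_real.
Local Notation mu := (@lebesgue_measure R).

Lemma scales_translation (c : R) : scales mu 1 (fun x : R => x + c).
Proof.
have mf : measurable_fun setT (fun x : measurableTypeR R => (x + c : measurableTypeR R)).
  exact: measurable_funD.
split => // A mA; rewrite mul1e.
pose m0 : {measure set (measurableTypeR R) -> \bar R} :=
  measure_function_pushforward__canonical__measure_function_Measure mu mf.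
apply/esym/(@lebesgue_measure_unique _ m0) => // _ [[a b]] _ <-.
rewrite /m0 /= /pushforward.
have -> : (fun x : R => x + c) @^-1` `]a, b] = `](a - c), (b - c)]%classic.
  by apply/seteqP; split => x /=; rewrite !in_itv /= ltrBlDr lerBrDr.
rewrite !lebesgue_measure_itv/= !lte_fin ltrD2r; case: ifPn => // _.
by rewrite -!EFinB; congr (_%:E); ring.
Qed.

Lemma scales_dilation (c : R) : 0 < c -> scales mu c^-1 (fun x : R => c * x).
Proof.
move=> c0.
have mf : measurable_fun setT (fun x : measurableTypeR R => (c * x : measurableTypeR R)).
  exact: measurable_funM.
split => // A mA.
pose m0 : {measure set (measurableTypeR R) -> \bar R} :=
  measure_function_pushforward__canonical__measure_function_Measure mu mf.
pose m1 : {measure set (measurableTypeR R) -> \bar R} := mscale (NngNum (ltW c0)) m0.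
have -> : mu A = m1 A.
  apply: (@lebesgue_measure_unique _ m1) => // _ [[a b]] _ <-.
  rewrite /m1 /= /mscale /= /pushforward.
  have -> : (fun x : R => c * x) @^-1` `]a, b] = `](c^-1 * a), (c^-1 * b)]%classic.
    by apply/seteqP; split => x /=; rewrite !in_itv /= ltr_pdivrMl// ler_pdivlMl.
  rewrite !lebesgue_measure_itv/= !lte_fin ltr_pM2l ?invr_gt0//.
  case: ifPn => _; last by rewrite mule0.
  by rewrite -!EFinB -EFinM; congr (_%:E); rewrite -mulrBr mulrA mulfV ?gt_eqF// mul1r.
by rewrite /m1 /= /mscale /= muleA -EFinM mulVf ?gt_eqF// mul1e.
Qed.

End lebesgue_real.

Section lebesgue_complex.
Local Notation l := (@lebesgue_measure R).
Let l0 : {sigma_finite_measure set (measurableTypeR R) -> \bar R} := l.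
Let pr (p : R * R) : R[i] := p.1 +i* p.2.

Let scales_C c (phi : R * R -> R * R) (psi : R[i] -> R[i]) :
  (forall p, psi (pr p) = pr (phi p)) -> scales (l0 \x l0)%E c phi ->
  scales (@lebesgue_C R) c psi.
Proof.
move=> H sc; apply: (scales_pushforward (phi := phi)) => //.
- exact: measurable_complex_of_pair.
- apply: (@eq_measurable_fun _ _ _ _ _ (fun z => pr (phi (pair_of_complex z)))).
    by move=> z _; rewrite -H; case: z.
  apply: measurableT_comp; first exact: measurable_complex_of_pair.
  apply: (measurableT_comp sc.1) => _ B mB; rewrite setTI; by exists B => //; rewrite setTI.
Qed.

Let scales_r (g : R -> R -> R) c : 0 <= c ->
  measurable_fun setT (fun p : R * R => g p.1 p.2) -> (forall x, scales l c (g x)) ->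
  scales (l0 \x l0)%E c (fun p : R * R => (p.1, g p.1 p.2)).
Proof. by move=> c0 mg H; exact: scales_skewr. Qed.

Let scales_l (f : R -> R -> R) c : 0 <= c ->
  measurable_fun setT (fun p : R * R => f p.2 p.1) -> (forall x, scales l c (f x)) ->
  scales (l0 \x l0)%E c (fun p : R * R => (f p.2 p.1, p.2)).
Proof. by move=> c0 mg H; exact: scales_skewl. Qed.

Lemma scales_C_translation (w : R[i]) : scales (@lebesgue_C R) 1 (fun z => z + w).
Proof.
pose s1 := @scales_l (fun _ x => x + complex.Re w) 1 ler01.
pose s2 := @scales_r (fun _ x => x + complex.Im w) 1 ler01.
have -> : 1 = 1 * 1 :> R by rewrite mulr1.
apply: (@scales_C _ _ _ _ (scales_comp (s1 _ _) (s2 _ _))).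
- by case=> x y; rewrite /pr [in LHS](complex_eta w).
- by apply: measurable_funD => //; exact: measurable_fst.
- by move=> _; exact: scales_translation.
- by apply: measurable_funD => //; exact: measurable_snd.
- by move=> _; exact: scales_translation.
Qed.

Lemma scales_C_dilation (c : R) : 0 < c -> scales (@lebesgue_C R) (c ^- 2) (fun z => c%:C * z).
Proof.
move=> c0; have ci : 0 <= c^-1 by rewrite invr_ge0 ltW.
pose s1 := @scales_l (fun _ x => c * x) c^-1 ci.
pose s2 := @scales_r (fun _ x => c * x) c^-1 ci.
rewrite -exprVn expr2.
apply: (@scales_C _ _ _ _ (scales_comp (s1 _ _) (s2 _ _))).
- case=> x y; rewrite /pr /=; apply/eqP; rewrite eq_complex /=.
  by apply/andP; split; apply/eqP; ring.
- by apply: measurable_funM => //; exact: measurable_fst.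
- by move=> _; exact: scales_dilation.
- by apply: measurable_funM => //; exact: measurable_snd.
- by move=> _; exact: scales_dilation.
Qed.

(* A plane rotation of angle in ]0, pi[ is a product of three shears. *)
Lemma scales_C_rotation (u : R[i]) : cabs u = 1 -> scales (@lebesgue_C R) 1 (fun z => u * z).
Proof.
have main (v : R[i]) : cabs v = 1 -> complex.Im v != 0 ->
    scales (@lebesgue_C R) 1 (fun z => v * z).
  (* [tau] is minus the tangent of half the angle. *)
  case: v => c s /= cs s0; pose tau := (c - 1) / s.
  have {}cs : c ^+ 2 + s ^+ 2 = 1.
    by have := congr1 (fun x => x ^+ 2) cs; rewrite expr1n cabs_sqr.
  pose s1 := @scales_l (fun y x => x + tau * y) 1 ler01.
  pose s2 := @scales_r (fun x y => y + s * x) 1 ler01.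
  have -> : 1 = 1 * (1 * 1) :> R by rewrite !mulr1.
  apply: (@scales_C _ _ _ _ (scales_comp (s1 _ _) (scales_comp (s2 _ _) (s1 _ _)))).
  - have ts : tau * s = c - 1 by rewrite divfK.
    have tc : tau * (1 + c) = - s.
      by apply: (mulIf s0); rewrite mulrAC ts; move: cs; lra.
    case=> x y; rewrite /pr /=; apply/eqP; rewrite eq_complex /=.
    apply/andP; split; apply/eqP.
      have -> : x + tau * y + tau * (y + s * (x + tau * y)) =
        x + tau * s * x + tau * (2 + tau * s) * y by ring.
      by rewrite ts (_ : 2 + (c - 1) = 1 + c) ?tc; ring.
    have -> : y + s * (x + tau * y) = y + s * x + tau * s * y by ring.
    by rewrite ts; ring.
  all: try by move=> x; exact: scales_translation.
  - apply: measurable_funD; first exact: measurable_fst.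
    by apply: measurable_funM => //; exact: measurable_snd.
  - apply: measurable_funD; first exact: measurable_snd.
    by apply: measurable_funM => //; exact: measurable_fst.
  - apply: measurable_funD; first exact: measurable_fst.
    by apply: measurable_funM => //; exact: measurable_snd.
(* The factorization divides by the imaginary part. The two remaining units are 1, the identity, and
   -1, the square of ['i]. *)
have [u0 nu|u0] := eqVneq (complex.Im u) 0; last by move=> nu; exact: main.
have n1 : cabs ('i : R[i]) = 1 by rewrite /Normc.normc expr0n expr1n add0r sqrtr1.
have i0 : complex.Im ('i : R[i]) != 0 by rewrite /= oner_neq0.
have [c1|c1] : complex.Re u = 1 \/ complex.Re u = -1.
- have : complex.Re u ^+ 2 == 1.
    by rewrite -[X in _ == X](expr1n _ 2) -nu cabs_sqr u0 expr0n addr0.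
  by rewrite sqrf_eq1 => /orP[/eqP|/eqP]; [left|right].
- apply: (@eq_scales _ _ _ _ id); last exact: scales_id.
  by move=> z; rewrite (complex_eta u) u0 c1 -[LHS]mul1r.
have -> : 1 = 1 * 1 :> R by rewrite mulr1.
apply: (eq_scales _ (scales_comp (main _ n1 i0) (main _ n1 i0))) => z.
rewrite mulrA -expr2 sqr_i (complex_eta u) u0 c1; congr (_ * _).
by apply/eqP; rewrite eq_complex /= oppr0 !eqxx.
Qed.

End lebesgue_complex.

End scales.

(** * Translations, dilations, shears and rotations of C^n *)

Section scales_Cn.
Variable R : realType.
Local Notation C := R[i].

Lemma cons_cV0 (T : Type) n (p : T * 'cV[T]_n) j : cons_cV p ord0 j = p.1.
Proof.
rewrite /cons_cV; have -> : ord0 = lshift n (ord0 : 'I_1) by exact/val_inj.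
by rewrite (@col_mxEu _ 1 n) mxE.
Qed.

Lemma cons_cVS (T : Type) n (p : T * 'cV[T]_n) i j :
  cons_cV p (lift ord0 i) j = p.2 i j.
Proof.
rewrite /cons_cV; have -> : lift ord0 i = rshift 1 i by exact/val_inj.
by rewrite (@col_mxEd _ 1 n).
Qed.

Lemma uncons_cVK (T : Type) (n : nat) : cancel (@uncons_cV T n) (@cons_cV T n).
Proof.
move=> z; apply/matrixP => i j; have [k ->|->] := unliftP ord0 i.
  by rewrite cons_cVS mxE; congr (z _ _); exact/val_inj.
by rewrite cons_cV0 ord1.
Qed.

Definition upd n (p : 'I_n) (w : C) (z : 'cV[C]_n) : 'cV[C]_n :=
  \col_i (if i == p then w else z i ord0).

Lemma updE n (p : 'I_n) w z i j : upd p w z i j = if i == p then w else z i ord0.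
Proof. by rewrite mxE. Qed.

Lemma upd_cons0 n (w : C) (p : C * 'cV[C]_n) : upd ord0 w (cons_cV p) = cons_cV (w, p.2).
Proof.
apply/matrixP => i j; rewrite updE; have [k ->|->] := unliftP ord0 i.
  by rewrite eq_sym (negbTE (neq_lift _ _)) !cons_cVS (ord1 j).
by rewrite eqxx cons_cV0.
Qed.

Lemma upd_consS n (q : 'I_n) (w : C) (p : C * 'cV[C]_n) :
  upd (lift ord0 q) w (cons_cV p) = cons_cV (p.1, upd q w p.2).
Proof.
apply/matrixP => i j; rewrite updE; have [k ->|->] := unliftP ord0 i.
  by rewrite (inj_eq lift_inj) !cons_cVS updE ord1.
by rewrite -(inj_eq val_inj) /= !cons_cV0.
Qed.

Section step.
Variable n : nat.
Let v := @lebesgue_Cn R n.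

Let sf : exists2 m1 : {sigma_finite_measure set C -> \bar R},
  m1 = lebesgue_C (R := R) :> (set C -> \bar R) &
  @lebesgue_Cn R n.+1 = pushforward (m1 \x v)%E (@cons_cV C n) :> (set _ -> \bar R).
Proof. by have [m1 m1E] := lebesgue_C_sigma_finite R; exists m1 => //=; rewrite m1E. Qed.

Let scales_cons c (phi : C * 'cV[C]_n -> C * 'cV[C]_n) psi
    (m1 : {sigma_finite_measure set C -> \bar R}) :
  (forall p, psi (cons_cV p) = cons_cV (phi p)) -> scales (m1 \x v)%E c phi ->
  scales (pushforward (m1 \x v)%E (@cons_cV C n)) c psi.
Proof.
move=> H sc; apply: (scales_pushforward (phi := phi)) => //.
  exact: measurable_cons_cV.
apply: (@eq_measurable_fun _ _ _ _ _ (fun z => cons_cV (phi (uncons_cV z)))).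
  by move=> z _; rewrite -H uncons_cVK.
apply: measurableT_comp; first exact: measurable_cons_cV.
by apply: (measurableT_comp sc.1); exact: measurable_uncons_cV.
Qed.

Lemma scales_consl (f : 'cV[C]_n -> C -> C) c psi : 0 <= c ->
  (forall p, psi (cons_cV p) = cons_cV (f p.2 p.1, p.2)) ->
  measurable_fun setT (fun p : C * 'cV[C]_n => f p.2 p.1) ->
  (forall y, scales (lebesgue_C (R := R)) c (f y)) -> scales (@lebesgue_Cn R n.+1) c psi.
Proof.
move=> c0 H mf fc; have [m1 m1E ->] := sf; apply: scales_cons H _.
by apply: scales_skewl => // y; rewrite m1E.
Qed.

Lemma scales_consr (g : C -> 'cV[C]_n -> 'cV[C]_n) c psi : 0 <= c ->
  (forall p, psi (cons_cV p) = cons_cV (p.1, g p.1 p.2)) ->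
  measurable_fun setT (fun p : C * 'cV[C]_n => g p.1 p.2) ->
  (forall x, scales v c (g x)) -> scales (@lebesgue_Cn R n.+1) c psi.
Proof.
move=> c0 H mf fc; have [m1 m1E ->] := sf; apply: scales_cons H _.
by apply: scales_skewr.
Qed.

End step.

Lemma cons_split n (z : 'cV[C]_n.+1) : exists x v, z = cons_cV (x, v).
Proof. by exists (uncons_cV z).1, (uncons_cV z).2; rewrite -[LHS]uncons_cVK; case: (uncons_cV z). Qed.

Lemma cons_cVD n (p q : C * 'cV[C]_n) : cons_cV p + cons_cV q = cons_cV (p.1 + q.1, p.2 + q.2).
Proof.
apply/matrixP => i j; rewrite mxE; have [k ->|->] := unliftP ord0 i.
  by rewrite !cons_cVS mxE.
by rewrite !cons_cV0.
Qed.

Lemma cons_cVZ n (c : C) (p : C * 'cV[C]_n) : c *: cons_cV p = cons_cV (c * p.1, c *: p.2).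
Proof.
apply/matrixP => i j; rewrite mxE; have [k ->|->] := unliftP ord0 i.
  by rewrite !cons_cVS mxE.
by rewrite !cons_cV0.
Qed.

Lemma measurable_cV d (T : measurableType d) n (f : T -> 'cV[C]_n) :
  (forall i, measurable_fun setT (fun x => f x i ord0)) -> measurable_fun setT f.
Proof. by move=> H; apply: measurable_to_matrix => i j; rewrite ord1. Qed.

Lemma scales_Cn_translation n (c : 'cV[C]_n) : scales (@lebesgue_Cn R n) 1 (fun z => z + c).
Proof.
elim: n c => [|n IH] c.
  by apply: (@eq_scales _ _ _ _ _ id); [move=> z; rewrite [c]flatmx0 addr0|exact: scales_id].
have [x [w ->]] := cons_split c.
have -> : 1 = 1 * 1 :> R by rewrite mulr1.
apply: (eq_scales _ (scales_comp
  (@scales_consl n (fun _ y => y + x) 1 (fun z => z + cons_cV (x, 0)) _ _ _ _)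
  (@scales_consr n (fun _ y => y + w) 1 (fun z => z + cons_cV (0, w)) _ _ _ _))) => //.
- by move=> z; rewrite -addrA cons_cVD /= addr0 add0r.
- by move=> p; rewrite cons_cVD addr0.
- by apply: cmeasurableD => //; exact: measurable_fst.
- by move=> _; exact: scales_C_translation.
- by move=> p; rewrite cons_cVD addr0.
- apply: measurable_cV => i; under eq_fun do rewrite mxE.
  apply: cmeasurableD => //.
  by apply: (measurableT_comp (measurable_entry i ord0)); exact: measurable_snd.
Qed.

Lemma scales_Cn_dilation n (c : R) : 0 < c ->
  scales (@lebesgue_Cn R n) ((c ^- 2) ^+ n) (fun z => c%:C *: z).
Proof.
move=> c0; have ci : 0 <= c ^- 2 by rewrite invr_ge0 exprn_ge0// ltW.
elim: n => [|n IH].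
  apply: (@eq_scales _ _ _ _ _ id); last by rewrite expr0; exact: scales_id.
  by move=> z; rewrite [z]flatmx0 scaler0.
rewrite exprS.
apply: (eq_scales _ (scales_comp
  (@scales_consl n (fun _ y => c%:C * y) _ (fun z => upd ord0 (c%:C * z ord0 ord0) z) _ _ _ _)
  (@scales_consr n (fun _ y => c%:C *: y) _
     (fun z => cons_cV (z ord0 ord0, c%:C *: (uncons_cV z).2)) _ _ _ _))) => //.
- move=> z; have [x [w ->]] := cons_split z.
  have -> : upd ord0 (c%:C * cons_cV (x, w) ord0 ord0) (cons_cV (x, w)) =
      cons_cV (c%:C * x, w) by rewrite cons_cV0 upd_cons0.
  by rewrite cons_cVK cons_cV0 cons_cVZ.
- by move=> p; rewrite cons_cV0 upd_cons0.
- by apply: cmeasurableM => //; exact: measurable_fst.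
- by move=> _; exact: scales_C_dilation.
- exact: exprn_ge0.
- by move=> p; rewrite cons_cV0 cons_cVK.
- apply: measurable_cV => i; under eq_fun do rewrite mxE.
  apply: cmeasurableM => //.
  by apply: (measurableT_comp (measurable_entry i ord0)); exact: measurable_snd.
Qed.

Lemma measurable_upd n (p : 'I_n) (f : 'cV[C]_n -> C) :
  measurable_fun setT f -> measurable_fun setT (fun z => upd p (f z) z).
Proof.
move=> mf; apply: measurable_cV => i; under eq_fun do rewrite updE.
by case: eqP => // _; exact: measurable_entry.
Qed.

Lemma scales_Cn_phase n (p : 'I_n) (u : C) : cabs u = 1 ->
  scales (@lebesgue_Cn R n) 1 (fun z => upd p (u * z p ord0) z).
Proof.
move=> u1; elim: n p => [[]//|n IH] p; have [q ->|->] := unliftP ord0 p.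
  apply: (@scales_consr n (fun _ y => upd q (u * y q ord0) y)) => //.
  - by move=> y; rewrite cons_cVS upd_consS.
  - have : measurable_fun setT (fun y : 'cV[C]_n => upd q (u * y q ord0) y).
      by apply: measurable_upd; apply: cmeasurableM => //; exact: measurable_entry.
    by move/measurableT_comp; apply; exact: measurable_snd.
apply: (@scales_consl n (fun _ y => u * y)) => //.
- by move=> y; rewrite cons_cV0 upd_cons0.
- by apply: cmeasurableM => //; exact: measurable_fst.
- by move=> _; exact: scales_C_rotation.
Qed.

(** A shear translates coordinate [p] by an amount that depends on coordinate [q]. If both lie in
    the tail, induction applies; if one of them is the head, the map is a translation in each
    fibre. *)
Lemma scales_Cn_shear n (p q : 'I_n) (t : C) : p != q ->
  scales (@lebesgue_Cn R n) 1 (fun z => upd p (z p ord0 + t * z q ord0) z).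
Proof.
elim: n p q => [[]//|n IH] p q; have [p' ->|->] := unliftP ord0 p;
  have [q' ->|->] := unliftP ord0 q => //.
- rewrite (inj_eq lift_inj) => pq.
  apply: (@scales_consr n (fun _ y => upd p' (y p' ord0 + t * y q' ord0) y)) => //.
  - by move=> y; rewrite !cons_cVS upd_consS.
  - have : measurable_fun setT (fun y : 'cV[C]_n => upd p' (y p' ord0 + t * y q' ord0) y).
      apply: measurable_upd; apply: cmeasurableD; first exact: measurable_entry.
      by apply: cmeasurableM => //; exact: measurable_entry.
    by move/measurableT_comp; apply; exact: measurable_snd.
  - by move=> _; exact: IH.
- move=> _; apply: (@scales_consr n (fun x y => upd p' (y p' ord0 + t * x) y)) => //.
  - by move=> y; rewrite cons_cVS cons_cV0 upd_consS.
  - apply: measurable_cV => i; under eq_fun do rewrite updE.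
    have m2 : measurable_fun setT (fun y : C * 'cV[C]_n => y.2 i ord0).
      by apply: (measurableT_comp (measurable_entry i ord0)); exact: measurable_snd.
    case: eqP => // <-; apply: cmeasurableD => //.
    by apply: cmeasurableM => //; exact: measurable_fst.
  - move=> x; apply: eq_scales (scales_Cn_translation (\col_i (if i == p' then t * x else 0))).
    move=> y; apply/matrixP => i j; rewrite updE !mxE ord1.
    by case: eqP => [->//|_]; rewrite addr0.
- move=> _; apply: (@scales_consl n (fun y x => x + t * y q' ord0)) => //.
  - by move=> y; rewrite cons_cVS cons_cV0 upd_cons0.
  - apply: cmeasurableD; first exact: measurable_fst.
    apply: cmeasurableM => //.
    by apply: (measurableT_comp (measurable_entry q' ord0)); exact: measurable_snd.
  - by move=> y; exact: scales_C_translation.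
Qed.

Definition plane_rot n (p q : 'I_n) (c s : R) (z : 'cV[C]_n) : 'cV[C]_n :=
  \col_i (if i == p then c%:C * z p ord0 - s%:C * z q ord0
          else if i == q then s%:C * z p ord0 + c%:C * z q ord0 else z i ord0).

(** The factorization into three shears used for [scales_C_rotation] is an algebraic identity and
    holds with complex coordinates as well. *)
Lemma scales_Cn_plane_rot n (p q : 'I_n) (c s : R) : p != q ->
  c ^+ 2 + s ^+ 2 = 1 -> s != 0 -> scales (@lebesgue_Cn R n) 1 (plane_rot p q c s).
Proof.
move=> pq cs s0; pose t := (c - 1) / s.
have qp : q != p by rewrite eq_sym.
have -> : 1 = 1 * (1 * 1) :> R by rewrite !mulr1.
apply: (eq_scales _ (scales_comp (scales_Cn_shear t%:C pq)
  (scales_comp (scales_Cn_shear s%:C qp) (scales_Cn_shear t%:C pq)))) => z.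
have ts : t%:C * s%:C = c%:C - 1 :> C by rewrite -rmorphM divfK// rmorphB rmorph1.
have tc : t%:C * (1 + c%:C) = - s%:C :> C.
  rewrite -(rmorph1 (real_complex R)) -rmorphD -rmorphM -rmorphN; congr (_%:C).
  by apply: (mulIf s0); rewrite mulrAC divfK//; move: cs; lra.
apply/matrixP => i j; rewrite !updE !eqxx !mxE (negbTE pq) (negbTE qp).
move: (t%:C) (s%:C) (c%:C) ts tc => T S K ts tc.
have [_|_] := eqVneq i p; last first.
  case: eqVneq => // _.
  set x := z p ord0; set y := z q ord0.
  have -> : y + S * (x + T * y) = y + S * x + T * S * y by ring.
  by rewrite ts; ring.
set x := z p ord0; set y := z q ord0.
have -> : x + T * y + T * (y + S * (x + T * y)) =
  x + T * S * x + T * (2 + T * S) * y by ring.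
by rewrite ts (_ : 2 + (K - 1) = 1 + K) ?tc; ring.
Qed.

Lemma scales_Cn_rotation n (u : C) : cabs u = 1 ->
  scales (@lebesgue_Cn R n) 1 (fun z => u *: z).
Proof.
move=> u1.
have H (s : seq 'I_n) : uniq s -> scales (@lebesgue_Cn R n) 1
    (fun z => \col_i (if i \in s then u * z i ord0 else z i ord0)).
  elim: s => [_|p s IH /= /andP[ps us]].
    by apply: eq_scales (scales_id _) => z; apply/matrixP => i j; rewrite mxE ord1.
  have -> : 1 = 1 * 1 :> R by rewrite mulr1.
  apply: (eq_scales _ (scales_comp (IH us) (scales_Cn_phase p u1))) => z.
  apply/matrixP => i j; rewrite updE !mxE inE (negbTE ps).
  by case: eqP => [->|].
apply: (eq_scales _ (H _ (enum_uniq 'I_n))) => z.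
by apply/matrixP => i j; rewrite !mxE mem_enum (ord1 j) inE.
Qed.

End scales_Cn.

(** * Integrals under measure-preserving maps *)

Section change_of_variables.
Context (R : realType) d (T : measurableType d).
Variables (mu : {measure set T -> \bar R}) (phi : T -> T) (D : set T).
Hypotheses (mD : measurable D) (sphi : scales mu 1 phi) (phiD : phi @^-1` D = D).

Let mphi := sphi.1.

Let pf : {measure set T -> \bar R} :=
  measure_function_pushforward__canonical__measure_function_Measure mu mphi.

Let pfE A : measurable A -> A `<=` D -> pf A = mu A.
Proof. by move=> mA _; rewrite /pf /= /pushforward sphi.2// mul1e. Qed.

Lemma ge0_integral_scales (f : T -> \bar R) : measurable_fun D f ->
  (forall x, D x -> 0 <= f x)%E ->
  (\int[mu]_(x in D) f (phi x) = \int[mu]_(x in D) f x)%E.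
Proof.
move=> mf f0; transitivity (\int[pf]_(x in D) f x)%E; last first.
  by apply: eq_measure_integral => A mA AD; exact: pfE.
rewrite /pf /= [RHS]ge0_integral_pushforward// ?phiD// => y; rewrite inE; exact: f0.
Qed.

Lemma measurable_fun_scales d' (T' : measurableType d') (f : T -> T') :
  measurable_fun D f -> measurable_fun D (fun x => f (phi x)).
Proof.
move=> mf _ B mB.
have -> : D `&` (fun x => f (phi x)) @^-1` B = phi @^-1` (D `&` f @^-1` B).
  by rewrite preimage_setI phiD.
by apply: measurable_preimage => //; exact: mf.
Qed.

Lemma Rintegral_scales (f : T -> R) : mu.-integrable D (EFin \o f) ->
  \int[mu]_(x in D) f (phi x) = \int[mu]_(x in D) f x.
Proof.
move=> fi; rewrite /Rintegral; congr fine.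
rewrite integralE [RHS]integralE; congr (_ - _)%E.
  rewrite -[RHS]ge0_integral_scales//; first by apply: eq_integral => x _; rewrite !funeposE.
  by apply: measurable_funepos; exact: (measurable_int mu).
rewrite -[RHS]ge0_integral_scales//; first by apply: eq_integral => x _; rewrite !funenegE.
by apply: measurable_funeneg; exact: (measurable_int mu).
Qed.

Lemma cint_scales (f : T -> R[i]) : cintegrable mu D f ->
  cint mu D (fun x => f (phi x)) = cint mu D f.
Proof.
move=> [f1 f2]; congr Complex.
  exact: (@Rintegral_scales (fun x => complex.Re (f x))).
exact: (@Rintegral_scales (fun x => complex.Im (f x))).
Qed.

End change_of_variables.

(** * Balls and boxes in C^n *)

Section ball.
Variables (R : realType) (n : nat).
Local Notation C := R[i].
Local Notation V := ('cV[R[i]]_n).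
Local Notation v := (@lebesgue_Cn R n).
Implicit Types (z u : V).

Lemma sqnormE z : sqnorm z = \sum_(i < n) cabs (z i ord0) ^+ 2.
Proof. by apply: eq_bigr => i _; rewrite cabs_sqr. Qed.

Lemma sqnorm_ge0 z : 0 <= sqnorm z.
Proof. by rewrite sqnormE sumr_ge0// => i _; rewrite exprn_ge0// cabs_ge0. Qed.

Lemma sqnormZ (c : C) z : sqnorm (c *: z) = cabs c ^+ 2 * sqnorm z.
Proof.
by rewrite !sqnormE mulr_sumr; apply: eq_bigr => i _; rewrite mxE Normc.normcM exprMn.
Qed.

Lemma sqnorm0 : sqnorm (0 : V) = 0.
Proof. by rewrite -(scale0r (0 : V)) sqnormZ Normc.normc0 expr0n mul0r. Qed.

Lemma cabs_le_sqnorm z i : cabs (z i ord0) ^+ 2 <= sqnorm z.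
Proof.
rewrite sqnormE (bigD1 i)//= lerDl sumr_ge0// => j _.
by rewrite exprn_ge0// cabs_ge0.
Qed.

Lemma measurable_sqnorm : measurable_fun setT (@sqnorm R n).
Proof.
rewrite (_ : @sqnorm R n = fun z => \sum_(i < n) cabs (z i ord0) ^+ 2); last first.
  by apply/funext => z; rewrite sqnormE.
apply: measurable_sum => i; apply: measurable_cabs_sqr; exact: measurable_entry.
Qed.

Definition cball (s : R) : set V := [set z | sqnorm z < s].

Lemma measurable_cball s : measurable (cball s).
Proof.
rewrite (_ : cball s = @sqnorm R n @^-1` `]-oo, s[); last first.
  by apply/seteqP; split => z /=; rewrite in_itv.
apply: measurable_preimage; [exact: measurable_sqnorm|exact: measurable_itv].
Qed.

Lemma measurable_unit_ball : measurable (unit_ball (R := R) (n := n)).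
Proof. exact: measurable_cball. Qed.

(** Young's inequality [2xy <= e x^2 + y^2 / e] in each real coordinate. The factor of [sqnorm z]
    can be made close to 1, which a fixed factor 2 would not allow near the sphere. *)
Lemma le_sqnormD (e : R) z u : 0 < e ->
  sqnorm (z + u) <= (1 + e) * sqnorm z + (1 + e^-1) * sqnorm u.
Proof.
move=> e0; rewrite !mulr_sumr -big_split; apply: ler_sum => i _; rewrite mxE ReD ImD.
have H (x y : R) : (x + y) ^+ 2 <= (1 + e) * x ^+ 2 + (1 + e^-1) * y ^+ 2.
  have := sqr_ge0 (e * x - y); rewrite -(ler_pM2l (_ : 0 < e^-1)) ?invr_gt0// mulr0.
  have -> : e^-1 * (e * x - y) ^+ 2 = e * x ^+ 2 - 2 * x * y + e^-1 * y ^+ 2.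
    by field; rewrite gt_eqF.
  by move: (e^-1) => e'; lra.
by rewrite /= !mulrDr addrACA lerD.
Qed.

Lemma sqnormD_near (r : R) : 0 <= r < 1 -> exists2 dl : R, 0 < dl &
  forall z u, sqnorm z <= r -> sqnorm u <= dl -> sqnorm (z + u) <= (1 + r) / 2.
Proof.
(* Chosen so that [(1 + e) r + e <= r + 2 e = (1 + r) / 2]. *)
move=> /andP[r0 r1]; pose e := (1 - r) / 4.
have e0 : 0 < e by rewrite /e; lra.
have e1 : 0 < 1 + e^-1 by rewrite addr_gt0// invr_gt0.
exists (e / (1 + e^-1)); first by rewrite divr_gt0.
move=> z u zr ud; apply: (le_trans (le_sqnormD _ _ e0)).
have : (1 + e) * sqnorm z <= (1 + e) * r by rewrite ler_wpM2l//; lra.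
have : (1 + e^-1) * sqnorm u <= e by rewrite mulrC -ler_pdivlMr.
have : e * r <= e * 1 by rewrite ler_wpM2l ?ltW.
by rewrite /e; lra.
Qed.

(** The parameter of [cball] is the square of the radius, so the real dimension [2n] becomes the
    exponent [n]. *)
Lemma measure_cball s : 0 < s -> v (cball s) = ((s ^+ n)%:E * v (cball 1))%E.
Proof.
move=> s0; have c0 : 0 < (Num.sqrt s)^-1 by rewrite invr_gt0 sqrtr_gt0.
have [_ /(_ _ (measurable_cball 1))] := scales_Cn_dilation n c0.
have -> : (Num.sqrt s)^-1 ^- 2 = s by rewrite exprVn invrK sqr_sqrtr// ltW.
move=> <-; congr (v _).
apply/seteqP; split => z; rewrite /cball /= sqnormZ cabsE gtr0_norm//;
  by rewrite exprVn sqr_sqrtr ?ltW// mulrC ltr_pdivrMr// mul1r.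
Qed.

End ball.

Section box.
Variable R : realType.
Local Notation C := R[i].

Definition sq_box (eta : R) : set C :=
  [set z | `|complex.Re z| < eta /\ `|complex.Im z| < eta].

Definition box n (eta : R) : set 'cV[C]_n := [set z | forall i, sq_box eta (z i ord0)].

Lemma lebesgue_C_sq_box eta : 0 < eta ->
  lebesgue_C (sq_box eta) = ((2 * eta) ^+ 2)%:E.
Proof.
move=> e0; pose l : {sigma_finite_measure set (measurableTypeR R) -> \bar R} :=
  @lebesgue_measure R.
rewrite /lebesgue_C /pushforward.
have -> : (fun p : R * R => p.1 +i* p.2) @^-1` sq_box eta =
    `](- eta), eta[%classic `*` `](- eta), eta[%classic.
  by apply/seteqP; split => -[x y]; rewrite /sq_box /= !in_itv /= !ltr_norml.
pose A : set (measurableTypeR R) := `](- eta), eta[%classic.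
transitivity (@lebesgue_measure R A * @lebesgue_measure R A)%E.
  by apply: (@product_measure1E _ _ _ _ R l l); exact: measurable_itv.
rewrite /A lebesgue_measure_itv /= lte_fin gtrN// -EFinB opprK -EFinM.
by congr (_%:E); ring.
Qed.

Lemma measurable_sq_box eta : measurable (sq_box eta).
Proof.
have mi : measurable_fun setT (@id C) by exact: measurable_id.
have [m1 m2] := measurable_Re_Im mi.
rewrite (_ : sq_box eta = (fun z => complex.Re z) @^-1` `](- eta), eta[%classic `&`
   (fun z => complex.Im z) @^-1` `](- eta), eta[%classic); last first.
  by apply/seteqP; split => z; rewrite /sq_box /= !in_itv /= !ltr_norml.
by apply: measurableI; apply: measurable_preimage => //; exact: measurable_itv.
Qed.

Lemma measurable_box n eta : measurable (@box n eta).
Proof.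
rewrite (_ : box eta = \bigcap_(i in [set: 'I_n]) (fun z : 'cV[C]_n => z i ord0) @^-1` sq_box eta); last first.
  by apply/seteqP; split => z H i; [move=> _|]; exact: H.
apply: fin_bigcap_measurable => // i _; apply: measurable_preimage.
  exact: measurable_entry.
exact: measurable_sq_box.
Qed.

Lemma measure_box n eta : 0 < eta -> lebesgue_Cn (@box n eta) = (((2 * eta) ^+ 2) ^+ n)%:E.
Proof.
move=> e0; elim: n => [|n IH].
  by rewrite /= diracE expr0 mem_set// => -[].
have [m1 m1E] := lebesgue_C_sigma_finite R.
rewrite /= /pushforward -m1E.
have -> : @cons_cV C n @^-1` box eta = sq_box eta `*` box eta.
  apply/seteqP; split => -[x w] /=.
    by move=> H; split; [have := H ord0; rewrite cons_cV0|
      move=> i; have := H (lift ord0 i); rewrite cons_cVS].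
  move=> [H1 H2] i; have [k ->|->] := unliftP ord0 i; rewrite ?cons_cVS ?cons_cV0//.
rewrite product_measure1E; [|exact: measurable_sq_box|exact: measurable_box].
transitivity (lebesgue_C (sq_box eta) * lebesgue_Cn (@box n eta))%E; first by rewrite -m1E.
by rewrite lebesgue_C_sq_box// [X in (_ * X)%E]IH -EFinM -exprS.
Qed.

Lemma measure_unit_ball_lty n : (lebesgue_Cn (unit_ball (R := R) (n := n)) < +oo)%E.
Proof.
apply: (@le_lt_trans _ _ (lebesgue_Cn (@box n 1))); last by rewrite measure_box ?ltry.
apply: le_measure; rewrite ?inE; [exact: measurable_unit_ball|exact: measurable_box|].
move=> z z1 i; have h : cabs (z i ord0) < 1.
  have : cabs (z i ord0) ^+ 2 < 1 by apply: le_lt_trans z1; exact: cabs_le_sqnorm.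
  by rewrite -[X in _ < X](expr1n _ 2) ltr_pXn2r ?nnegrE ?cabs_ge0.
split; apply: le_lt_trans h; [exact: normr_Re_le|exact: normr_Im_le].
Qed.

Lemma measure_unit_ball_gt0 n : (0 < lebesgue_Cn (unit_ball (R := R) (n := n)))%E.
Proof.
(* With this half-side the box lies in the ball because [n * 2 eta^2 < 1], also for [n = 0]. *)
pose eta : R := (2 * n.+1%:R)^-1.
have e0 : 0 < eta by rewrite invr_gt0 mulr_gt0.
apply: (@lt_le_trans _ _ (lebesgue_Cn (@box n eta))).
  by rewrite measure_box// lte_fin !exprn_gt0// mulr_gt0.
apply: le_measure; rewrite ?inE; [exact: measurable_box|exact: measurable_unit_ball|].
move=> z zb; rewrite /unit_ball /=.
apply: (@le_lt_trans _ _ (\sum_(i < n) (2 * eta ^+ 2))).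
  apply: ler_sum => i _; have [h1 h2] := zb i.
  have H (x : R) : `|x| < eta -> x ^+ 2 <= eta ^+ 2.
    by move=> /ltW hx; rewrite -(real_normK (num_real x)) !expr2 ler_pM.
  by rewrite mulr_natl mulr2n lerD// H.
have e1 : eta * (2 * n.+1%:R) = 1 by rewrite mulVf// mulf_neq0.
rewrite sumr_const card_ord -[_ *+ n]mulr_natr.
have xE : n%:R = n.+1%:R - 1 :> R by rewrite -natr1 addrK.
have x1 : 1 <= n.+1%:R :> R by rewrite ler1n.
move: (n.+1%:R) eta e0 e1 x1 xE {zb} => x y y0 yx x1 ->.
have -> : 2 * y ^+ 2 * (x - 1) = y * (y * (2 * x)) - 2 * y ^+ 2 by ring.
rewrite yx mulr1; have : y * 2 <= y * (2 * x) by rewrite ler_pM2l//; lra.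
by have := sqr_ge0 y; lra.
Qed.

End box.

Lemma le_exprB (R : realType) (r s : R) (m : nat) : 0 <= r -> r <= s -> s <= 1 ->
  s ^+ m - r ^+ m <= m%:R * (s - r).
Proof.
move=> r0 rs s1; elim: m => [|m IH]; first by rewrite !expr0 subrr mul0r.
have -> : s ^+ m.+1 - r ^+ m.+1 = s * (s ^+ m - r ^+ m) + (s - r) * r ^+ m.
  by rewrite !exprS; ring.
rewrite -(natr1 m) [(m%:R + 1) * _]mulrDl mul1r; apply: lerD.
  apply: le_trans IH; rewrite -[leRHS]mul1r; apply: ler_wpM2r => //.
  by rewrite subr_ge0 lerXn2r// nnegrE// (le_trans r0).
rewrite -[leRHS]mulr1; apply: ler_wpM2l; first by rewrite subr_ge0.
by apply: exprn_ile1 => //; apply: le_trans s1.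
Qed.

Lemma powR_exprn (R : realType) (x p : R) (m : nat) : 0 <= x ->
  (x ^+ m) `^ p = (x `^ p) ^+ m.
Proof.
move=> x0; elim: m => [|m IH]; first by rewrite !expr0 powR1.
by rewrite !exprS powRM ?IH// exprn_ge0.
Qed.

(** * Integrability of the radial weight *)

Section weight.
Variables (R : realType) (n : nat) (lambda : R).
Hypothesis lambda_gtN1 : -1 < lambda.
Local Notation C := R[i].
Local Notation V := ('cV[R[i]]_n).
Local Notation v := (@lebesgue_Cn R n).
Local Notation B := (unit_ball (R := R) (n := n)).

Lemma measurable_radial_powR : measurable_fun setT (fun z : V => (1 - sqnorm z) `^ lambda).
Proof.
apply: (measurableT_comp (measurable_powR lambda)).
by apply: measurable_funB => //; exact: measurable_sqnorm.
Qed.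

(** Dyadic decomposition towards the sphere: here [1 - sqnorm z] lies between [2^-(k+1)] and
    [2^-k]. *)
Let shell k : set V := cball (1 - 2^-1 ^+ k.+1) `\` cball (1 - 2^-1 ^+ k).

Let half_pos k : 0 < 2^-1 ^+ k :> R.
Proof. by rewrite exprn_gt0// invr_gt0. Qed.

Let half_le1 k : 2^-1 ^+ k <= 1 :> R.
Proof. by rewrite exprn_ile1// invf_le1// ler1n. Qed.

Let measurable_shell k : measurable (shell k).
Proof. by apply: measurableD; exact: measurable_cball. Qed.

Let cball_le r s : r <= s -> cball r `<=` (cball s : set V).
Proof. by move=> rs z /= zr; apply: lt_le_trans rs. Qed.

Let shell_sub k : shell k `<=` B.
Proof. by move=> z [zk _]; apply: lt_le_trans zk _; rewrite gerBl ltW. Qed.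

Let bigcup_shell : \bigcup_k shell k = B.
Proof.
apply/seteqP; split => [z [k _]|z zB]; first exact: shell_sub.
have ex : exists k, sqnorm z < 1 - 2^-1 ^+ k.
  have d0 : 0 < 1 - sqnorm z by rewrite subr_gt0.
  have := @upper_nthrootP _ (1 - sqnorm z)^-1 _ (leqnn _).
  move: (Num.Def.archi_bound _) => k hk; exists k.
  rewrite ltrBrDr addrC -ltrBrDr exprVn -[X in _ < X]invrK.
  by rewrite ltf_pV2 ?posrE ?invr_gt0 ?exprn_gt0.
case: (ex_minnP ex) => -[|k] hk kmin.
  by move: hk; rewrite expr0 subrr ltNge sqnorm_ge0.
exists k => //; split => //= /kmin; by rewrite ltnn.
Qed.

Let trivIset_shell : trivIset setT shell.
Proof.
apply/ltn_trivIset => i j ij; apply/seteqP; split => // z [[h2 _] [_ h1]].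
apply: h1; apply: cball_le h2; rewrite lerD2l lerN2.
by apply: ler_wiXn2l => //; rewrite ?invr_ge0// invf_le1// ler1n.
Qed.

Let vB : exists V0 : R, 0 <= V0 /\ v B = V0%:E.
Proof.
have h := measure_unit_ball_lty R n; have h0 : (0 <= v B)%E by [].
by exists (fine (v B)); rewrite fine_ge0 ?fineK ?ge0_fin_numE.
Qed.

(** By [measure_cball] and [le_exprB] the volume is at most [n] times the increment of the squared
    radius. For [k = 0] the inner ball is empty, which [measure_cball] does not cover; there the
    factor 2 makes the volume of the whole ball a sufficient bound. *)
Let measure_shell k : (v (shell k) <= (2 * n.+1%:R * 2^-1 ^+ k.+1)%:E * v B)%E.
Proof.
have [V0 [V00 vBE]] := vB.
case: k => [|k].
  apply: (@le_trans _ _ (v B)).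
    apply: le_measure; rewrite ?inE; [exact: measurable_shell|exact: measurable_unit_ball|].
    exact: shell_sub.
  have -> : 2 * n.+1%:R * 2^-1 ^+ 1 = n.+1%:R :> R by rewrite expr1; field.
  by rewrite vBE -EFinM lee_fin ler_peMl// ler1n.
have r0 : 0 < 1 - 2^-1 ^+ k.+1 :> R.
  by rewrite subr_gt0 exprn_ilt1// invf_lt1// ltr1n.
have s0 : 0 < 1 - 2^-1 ^+ k.+2 :> R.
  by rewrite subr_gt0 exprn_ilt1// invf_lt1// ltr1n.
have rs : 1 - 2^-1 ^+ k.+1 <= 1 - 2^-1 ^+ k.+2 :> R.
  by rewrite lerD2l lerN2 ler_wiXn2l// invf_le1// ler1n.
rewrite measureD; last 3 first.
- exact: measurable_cball.
- exact: measurable_cball.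
- apply: le_lt_trans (measure_unit_ball_lty R n); apply: le_measure; rewrite ?inE.
  + exact: measurable_cball.
  + exact: measurable_unit_ball.
  + by apply: cball_le; rewrite gerBl ltW.
rewrite setIidr; last exact: cball_le.
move: r0 s0 rs; set r := 1 - 2^-1 ^+ k.+1; set s := 1 - 2^-1 ^+ k.+2 => r0 s0 rs.
have mc x : 0 < x -> v (cball x) = (x ^+ n * V0)%:E.
  by move=> x0; rewrite measure_cball// [v (cball 1)]vBE EFinM.
apply: (@le_trans _ _ (v (cball s) - v (cball r))%E) => //.
rewrite mc// mc// vBE -EFinB -EFinM lee_fin -mulrBl ler_wpM2r//.
have sr : s - r = 2^-1 ^+ k.+2 by rewrite /s /r [2^-1 ^+ k.+2]exprS; lra.
rewrite -sr.
have s1 : s <= 1 by rewrite gerBl ltW.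
apply: (le_trans (@le_exprB _ _ _ n (ltW r0) rs s1)); rewrite ler_wpM2r ?subr_ge0// -(natr1 n).
by have : 0 <= n%:R :> R by []; lra.
Qed.

(* For negative [lambda], the density is at most [2^-((k + 1) lambda)] on [shell k], whose volume
   is [O(2^-k)]. *)
Lemma radial_powR_lty : (\int[v]_(z in B) ((1 - sqnorm z) `^ lambda)%:E < +oo)%E.
Proof.
have mB : measurable B by exact: measurable_unit_ball.
have [V0 [V00 vBE]] := vB.
have mf D : measurable_fun D (fun z : V => ((1 - sqnorm z) `^ lambda)%:E).
  apply/measurable_EFinP; apply: measurable_funTS; exact: measurable_radial_powR.
have [l0|l0] := leP 0 lambda.
  apply: (@le_lt_trans _ _ (\int[v]_(z in B) 1%:E)%E).
    apply: ge0_le_integral => //.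
    - by move=> z _; rewrite lee_fin powR_ge0.
    - move=> z zB; rewrite lee_fin.
      apply: (@le_trans _ _ (1 `^ lambda)); last by rewrite powR1.
      have h0 := sqnorm_ge0 z; have h1 : sqnorm z < 1 := zB.
      by apply: ge0_ler_powR => //; rewrite ?nnegrE; lra.
  by rewrite integral_cst// mul1e; exact: measure_unit_ball_lty.
rewrite -bigcup_shell ge0_integral_bigcup//; last first.
  by move=> z _; rewrite lee_fin powR_ge0.
(* [q] is [2^-(lambda + 1)], the ratio of the dominating geometric series; [lambda > -1] is what
   makes it less than 1. *)
pose b : R := 2^-1 `^ lambda; pose q := b / 2.
have b0 : 0 < b by rewrite powR_gt0// invr_gt0.
have q0 : 0 <= q by rewrite divr_ge0// ltW.
have q1 : q < 1.
  rewrite /q /b -[X in _ * X](powRr1 (_ : 0 <= 2^-1)) ?invr_ge0//.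
  rewrite -powRD; last by rewrite invr_eq0 pnatr_eq0 implybT.
  rewrite /powR invr_eq0 pnatr_eq0 /= -[X in _ < X]expR0 ltr_expR.
  have ln2 : 0 < ln 2 :> R by rewrite ln_gt0// ltr1n.
  have l1 : 0 < lambda + 1 by rewrite -ltrBlDr sub0r.
  by rewrite lnV ?posrE// mulrN oppr_lt0 mulr_gt0.
pose K : R := 2 * n.+1%:R * V0.
have K0 : 0 <= K by rewrite !mulr_ge0.
have step k : (\int[v]_(z in shell k) ((1 - sqnorm z) `^ lambda)%:E <= (K * q ^+ k.+1)%:E)%E.
  apply: (@le_trans _ _ (\int[v]_(z in shell k) (b ^+ k.+1)%:E)%E).
    apply: ge0_le_integral => //.
    - by move=> z _; rewrite lee_fin powR_ge0.
    - move=> z [z1 _]; rewrite lee_fin.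
      have -> : b ^+ k.+1 = (2^-1 ^+ k.+1) `^ lambda.
        by rewrite powR_exprn// invr_ge0.
      have h : 2^-1 ^+ k.+1 < 1 - sqnorm z by move: z1; rewrite /cball /=; lra.
      rewrite /powR !gt_eqF//; last by apply: lt_trans h.
      rewrite ler_expR ler_wnM2l ?ltW// ltr_ln ?posrE//; apply: lt_trans h => //.
  rewrite integral_cst//.
  apply: (@le_trans _ _ ((b ^+ k.+1)%:E * ((2 * n.+1%:R * 2^-1 ^+ k.+1)%:E * v B))%E).
    apply: lee_wpmul2l; last exact: measure_shell.
    by rewrite lee_fin exprn_ge0// ltW.
  rewrite vBE -!EFinM lee_fin /K /q exprMn le_eqVlt; apply/orP; left; apply/eqP.
  by rewrite !exprVn; move: (b ^+ k.+1) ((2 ^+ k.+1)^-1) => x y; ring.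
apply: (@le_lt_trans _ _ (K * (q / (1 - q)))%:E); last exact: ltry.
apply: lime_le => //.
  by apply: is_cvg_nneseries => k _ _; apply: integral_ge0 => z _; rewrite lee_fin powR_ge0.
near=> N.
apply: (@le_trans _ _ (\sum_(0 <= k < N) (K * q ^+ k.+1)%:E)%E).
  by apply: lee_sum => k _; exact: step.
rewrite sumEFin lee_fin -mulr_sumr ler_wpM2l//.
have -> : \sum_(0 <= k < N) q ^+ k.+1 = q * \sum_(k < N) q ^+ k.
  by rewrite big_mkord mulr_sumr; apply: eq_bigr => k _; rewrite exprS.
rewrite ler_wpM2l// -[leRHS]mul1r ler_pdivlMr ?subr_gt0//.
have -> : (\sum_(k < N) q ^+ k) * (1 - q) = 1 - q ^+ N.
  by rewrite -opprB mulrN mulrC -subrX1 opprB.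
by rewrite gerBl exprn_ge0.
Unshelve. all: by end_near. Qed.

End weight.

Section complex_sequences.
Variable R : realType.
Local Notation C := R[i].

Definition ccvg (u : nat -> C) (l : C) := forall e : R, 0 < e ->
  exists N0, forall N, (N0 <= N)%N -> cabs (u N - l) <= e.

Lemma eq_ccvg (u u' : nat -> C) l : (forall N, u N = u' N) -> ccvg u l -> ccvg u' l.
Proof. by move=> /funext ->. Qed.

Lemma ccvg_ReIm (u : nat -> C) l : ccvg u l <->
  ((fun N => complex.Re (u N)) @ \oo --> complex.Re l) /\
  ((fun N => complex.Im (u N)) @ \oo --> complex.Im l).
Proof.
split.
  move=> H; split; apply/cvgrPdist_le => e /H[N0 HN]; exists N0 => // N /= /HN h;
    apply: le_trans h; rewrite distrC.
    by apply: le_trans (normr_Re_le _); rewrite ReD; case: (l).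
  by apply: le_trans (normr_Im_le _); rewrite ImD; case: (l).
move=> [/cvgrPdist_le H1 /cvgrPdist_le H2] e e0.
have e2 : 0 < e / 2 by rewrite divr_gt0.
have [N1 _ {}H1] := H1 _ e2; have [N2 _ {}H2] := H2 _ e2.
exists (maxn N1 N2) => N; rewrite geq_max => /andP[/H1 h1 /H2 h2].
apply: (le_trans (cabs_le_ReIm _)); rewrite [leRHS](splitr e); apply: lerD.
  by rewrite ReD (_ : complex.Re (- l) = - complex.Re l) 1?distrC//; case: (l).
by rewrite ImD (_ : complex.Im (- l) = - complex.Im l) 1?distrC//; case: (l).
Qed.

Lemma ccvg_cauchy (u : nat -> C) : (forall e : R, 0 < e ->
  exists N0, forall N M, (N0 <= N)%N -> (N0 <= M)%N -> cabs (u N - u M) <= e) ->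
  exists l, ccvg u l.
Proof.
move=> H.
have cv (p : C -> R) : (forall x y, `|p x - p y| <= cabs (x - y)) ->
    cvgn (fun N => p (u N)).
  move=> pL; apply/cauchy_cvgP/cauchy_exP => e e0.
  have [N0 HN] := H (e / 2) (divr_gt0 e0 (@ltr0Sn R 1)).
  exists (p (u N0)); exists N0 => // N /= hN; rewrite /ball /=.
  apply: (le_lt_trans (pL _ _)); apply: (le_lt_trans (HN _ _ (leqnn _) hN)).
  by move: e0; lra.
exists (lim ((fun N => complex.Re (u N)) @ \oo) +i* lim ((fun N => complex.Im (u N)) @ \oo)).
apply/ccvg_ReIm; split => /=.
  apply: (cv (@complex.Re R)) => x y; apply: le_trans (normr_Re_le _).
  by rewrite ReD; case: y.
apply: (cv (@complex.Im R)) => x y; apply: le_trans (normr_Im_le _).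
by rewrite ImD; case: y.
Qed.

Lemma ccvg_uniq (u : nat -> C) l l' : ccvg u l -> ccvg u l' -> l = l'.
Proof.
move=> H H'; apply/eqP; rewrite -subr_eq0 -[_ == _]negbK -cabs_gt0; apply/negP => e0.
have e3 : 0 < cabs (l - l') / 3 by rewrite divr_gt0.
have [N1 {}H] := H _ e3; have [N2 {}H'] := H' _ e3.
have := H _ (leq_maxl N1 N2); have := H' _ (leq_maxr N1 N2).
move: (u _) => w h h'.
have : cabs (l - l') <= cabs (w - l') + cabs (w - l).
  by rewrite (_ : l - l' = (w - l') - (w - l)) ?le_cabsB//; ring.
by lra.
Qed.

Lemma ccvg_le (u : nat -> C) l (M : R) : ccvg u l -> (forall N, cabs (u N) <= M) ->
  cabs l <= M.
Proof.
move=> H uM; apply/ler_addgt0Pr => e e0; have [N0 HN] := H _ e0.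
rewrite -(subrK (u N0) l); apply: (le_trans (le_normcD _ _)); rewrite addrC lerD//.
by rewrite cabs_distC; exact: HN.
Qed.

Lemma ccvgD u u' l l' : ccvg u l -> ccvg u' l' -> ccvg (fun N => u N + u' N) (l + l').
Proof.
move=> H H' e e0; have e2 : 0 < e / 2 by rewrite divr_gt0.
have [N1 {}H] := H _ e2; have [N2 {}H'] := H' _ e2.
exists (maxn N1 N2) => N; rewrite geq_max => /andP[/H h /H' h'].
rewrite (_ : _ - _ = (u N - l) + (u' N - l')); last by ring.
by apply: (le_trans (le_normcD _ _)); rewrite [leRHS](splitr e) lerD.
Qed.

Lemma ccvgZ (c : C) u l : ccvg u l -> ccvg (fun N => c * u N) (c * l).
Proof.
move=> H e e0; have c0 : 0 < 1 + cabs c by rewrite ltr_wpDr// cabs_ge0.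
have [N0 HN] := H _ (divr_gt0 e0 c0); exists N0 => N /HN h.
rewrite -mulrBr Normc.normcM; apply: (@le_trans _ _ ((1 + cabs c) * cabs (u N - l))).
  by rewrite ler_wpM2r ?cabs_ge0// lerDr.
by rewrite mulrC -ler_pdivlMr.
Qed.

Lemma ccvg_cst (c : C) : ccvg (fun=> c) c.
Proof. by move=> e e0; exists 0%N => N _; rewrite subrr Normc.normc0 ltW. Qed.

Lemma ccvg_sum (I : Type) (s : seq I) (u : I -> nat -> C) (l : I -> C) :
  (forall i, ccvg (u i) (l i)) ->
  ccvg (fun N => \sum_(i <- s) u i N) (\sum_(i <- s) l i).
Proof.
move=> H; elim: s => [|i s IH].
  by rewrite big_nil; under eq_fun do rewrite big_nil; exact: ccvg_cst.
by rewrite big_cons; under eq_fun do rewrite big_cons; exact: ccvgD.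
Qed.

End complex_sequences.

Section taylor_estimates.
Variable R : realType.
Variables (phi : R[i] -> R[i]) (rho M : R).
Hypothesis rho0 : 0 < rho.
Hypothesis dphi : forall z, cabs z < rho -> cder phi z.
Hypothesis phiM : forall z, cabs z < rho -> cabs (phi z) <= M.

Let a := taylor_coef phi rho.

Let M0 : 0 <= M.
Proof.
by apply: le_trans (phiM (_ : cabs 0 < rho)); rewrite ?cabs_ge0// Normc.normc0.
Qed.

Lemma taylor_coef_bound k : cabs (a k) * (rho / 2) ^+ k <= 2 * M.
Proof.
have r2 : rho / 2 < rho by move: rho0; lra.
apply: taylor_coef_le => //; first by rewrite divr_gt0.
by move=> t _; apply: phiM; rewrite cabs_rcis gtr0_norm ?divr_gt0.
Qed.

Lemma taylor_cvg w : cabs w < rho -> ccvg (fun K => \sum_(k < K) a k * w ^+ k) (phi w).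
Proof.
move=> wr e e0; have [C [q [q0 q1 H]]] := taylor_remainder dphi wr.
have : geometric C q @ \oo --> (0 : R) by apply: cvg_geometric; rewrite ger0_norm.
move/cvgrPdist_le => /(_ e e0)[N0 _ HN]; exists N0 => N /HN.
rewrite /geometric /= sub0r normrN cabs_distC => h.
exact: le_trans (H N) (le_trans (ler_norm _) h).
Qed.

Lemma taylor_coef0 : a 0 = phi 0.
Proof.
have h0 : cabs (0 : R[i]) < rho by rewrite Normc.normc0.
apply: (ccvg_uniq _ (taylor_cvg h0)) => e e0; exists 1%N => -[//|K] _.
rewrite big_ord_recl /= expr0 mulr1 big1 ?addr0 ?subrr ?Normc.normc0 ?(ltW e0)// => i _.
by rewrite expr0n /= mulr0.
Qed.

(** Cauchy's estimate bounds each term by [2 M q^k]; since [q <= 1 / 2], a geometric tail is at most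
    twice its first term. *)
Lemma taylor_tail (m K : nat) w : cabs w <= rho / 4 ->
  cabs (\sum_(m <= k < m + K) a k * w ^+ k) <= 4 * M * (cabs w / (rho / 2)) ^+ m.
Proof.
move=> wr; set q := cabs w / (rho / 2).
have r2 : 0 < rho / 2 by rewrite divr_gt0.
have q0 : 0 <= q by rewrite divr_ge0 ?cabs_ge0// ltW.
have q1 : q <= 1 / 2 by rewrite ler_pdivrMr//; lra.
have step k : cabs (a k * w ^+ k) <= 2 * M * q ^+ k.
  rewrite Normc.normcM cabsX /q expr_div_n mulrCA [leRHS]mulrC.
  rewrite -mulrA [leRHS]mulrCA mulrC [leRHS]mulrA [leRHS]mulrC.
  apply: ler_wpM2l; first by rewrite exprn_ge0 ?cabs_ge0.
  by rewrite mulrC ler_pdivlMr ?exprn_gt0// taylor_coef_bound.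
elim: K m => [|K IH] m.
  by rewrite addn0 big_geq// Normc.normc0 !mulr_ge0// exprn_ge0.
rewrite addnS big_ltn ?ltnS ?leq_addr// -addSn; apply: (le_trans (le_normcD _ _)).
apply: (le_trans (lerD (step m) (IH m.+1))).
have : q ^+ m.+1 <= 1 / 2 * q ^+ m by rewrite exprS ler_wpM2r// exprn_ge0.
move=> h; have : 4 * M * q ^+ m.+1 <= 4 * M * (1 / 2 * q ^+ m) by rewrite ler_wpM2l// mulr_ge0.
by lra.
Qed.

Lemma taylor_remainder_le (m : nat) w : cabs w <= rho / 4 ->
  cabs (phi w - \sum_(k < m) a k * w ^+ k) <= 4 * M * (cabs w / (rho / 2)) ^+ m.
Proof.
move=> wr; have wr' : cabs w < rho by move: rho0 wr; lra.
apply: (@ccvg_le _ (fun K => \sum_(m <= k < m + K) a k * w ^+ k)); last first.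
  by move=> K; exact: taylor_tail.
move=> e e0; have [N0 HN] := taylor_cvg wr' e0; exists N0 => N hN.
have := HN (m + N)%N (leq_trans hN (leq_addl _ _)).
rewrite -!(big_mkord xpredT (fun k => a k * w ^+ k)).
rewrite (big_cat_nat (n := m)) ?leq_addr//=.
move: (\sum_(0 <= i < m) _) (\sum_(m <= i < _) _) (phi w) => x y z.
by rewrite (_ : x + y - z = y - (z - x)); last ring.
Qed.

(** The constant depends on [phi] only through the bound [M]. This uniformity is what lets limits of
    holomorphic functions be treated. *)
Lemma taylor_order2 w : cabs w <= rho / 4 ->
  cabs (phi w - phi 0 - a 1 * w) <= 16 * M * cabs w ^+ 2 / rho ^+ 2.
Proof.
move=> /(taylor_remainder_le 2); rewrite !big_ord_recl big_ord0 /= expr0 expr1 mulr1 addr0.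
rewrite taylor_coef0 opprD addrA => /le_trans; apply.
rewrite le_eqVlt; apply/orP; left; apply/eqP; rewrite !expr_div_n.
by field; rewrite gt_eqF.
Qed.

End taylor_estimates.

(** * Holomorphic functions of several variables *)

Lemma differentiable_intro (K : numFieldType) (V W : normedModType K) (f : V -> W)
    (df : {linear V -> W}) z : continuous df ->
  (forall e : K, 0 < e -> \forall h \near 0, `|f (h + z) - f z - df h| <= e * `|h|) ->
  differentiable f z.
Proof.
move=> dfc H.
have E : f \o shift z = cst (f z) + df +o_ 0 id.
  apply/eqaddoP => e /H; apply: filterS => h /=.
  by rewrite !fctE /= opprD addrA.
by apply/diff_locallyP; rewrite (diff_unique dfc E).
Qed.

Section holomorphic_Cn.
Variables (R : realType) (n : nat).
Local Notation C := R[i].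
Local Notation V := ('cV[R[i]]_n).
Implicit Types (f g : V -> C) (z u : V).

(** A real-valued substitute for the matrix norm, which takes its values in [R[i]]; the two are
    equivalent by [mx_norm_le_lnorm] and [lnorm_le_mx_norm]. *)
Definition lnorm u : R := \sum_(i < n) cabs (u i ord0).

Lemma lnorm_ge0 u : 0 <= lnorm u.
Proof. by rewrite sumr_ge0// => i _; exact: cabs_ge0. Qed.

Lemma cabs_le_lnorm u i : cabs (u i ord0) <= lnorm u.
Proof. by rewrite /lnorm (bigD1 i)//= lerDl sumr_ge0// => j _; exact: cabs_ge0. Qed.

Lemma lnormZ (c : C) u : lnorm (c *: u) = cabs c * lnorm u.
Proof. by rewrite /lnorm mulr_sumr; apply: eq_bigr => i _; rewrite mxE Normc.normcM. Qed.

Lemma sqnorm_le_lnorm u : sqnorm u <= lnorm u ^+ 2.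
Proof.
rewrite sqnormE [leRHS]expr2 {1}/lnorm mulr_suml; apply: ler_sum => i _.
by rewrite expr2 ler_wpM2l ?cabs_ge0 ?cabs_le_lnorm.
Qed.

Definition dform (L : 'I_n -> C) u : C := \sum_(i < n) L i * u i ord0.

Lemma dformZ L (c : C) u : dform L (c *: u) = c * dform L u.
Proof. by rewrite /dform mulr_sumr; apply: eq_bigr => i _; rewrite mxE mulrCA. Qed.

(** Frechet differentiability with real moduli and an explicit differential; [differentiable_hdiff]
    and [hdiff_differentiable] identify it with [differentiable]. *)
Definition hdiff f z := exists L : 'I_n -> C, forall e : R, 0 < e ->
  exists2 dl : R, 0 < dl & forall u, lnorm u < dl ->
    cabs (f (z + u) - f z - dform L u) <= e * lnorm u.

Lemma mx_norm_le_lnorm u : `|u| <= (lnorm u)%:C.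
Proof.
rewrite /Num.Def.normr /=.
have [->|/mx_norm_neq0[[i j] ->]] := eqVneq (mx_norm u) 0.
  by rewrite ler0c lnorm_ge0.
by rewrite /= ord1 normr_cabs lecR cabs_le_lnorm.
Qed.

Lemma cabs_le_mx_norm u i : (cabs (u i ord0))%:C <= `|u|.
Proof.
rewrite -normr_cabs [leRHS]/Num.Def.normr /= mx_normE -[leLHS]nngE num_le.
exact: (le_bigmax _ (fun i : 'I_n * 'I_1 => `|u i.1 i.2|%:nng) (i, ord0)).
Qed.

Lemma cV_sum_delta u : u = \sum_(i < n) u i ord0 *: delta_mx i ord0.
Proof.
rewrite {1}(matrix_sum_delta u); apply: eq_bigr => i _.
by rewrite big_ord_recl big_ord0 addr0.
Qed.

Lemma posc_real (E : C) : 0 < E -> exists2 r : R, 0 < r & E = r%:C.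
Proof.
case: E => r s; rewrite ltcE /= => /andP[/eqP s0 r0]; exists r => //.
by rewrite s0.
Qed.

Lemma differentiable_hdiff f z : differentiable f z -> hdiff f z.
Proof.
move=> /diff_locallyP[_ /eqaddoP H].
exists (fun i => 'd f z (delta_mx i ord0)) => e e0.
have ec0 : 0 < e%:C :> C by rewrite -(rmorph0 (real_complex R)) ltcR.
have /nbhs_normP[E /= E0 {}H] := H _ ec0.
have [dl dl0 EE] := posc_real E0.
exists dl => // u ud.
have uE : `|0 - u| < E.
  by rewrite sub0r normrN EE; apply: le_lt_trans (mx_norm_le_lnorm u) _; rewrite ltcR.
have {H uE} := H u uE; rewrite /= !opprD !fctE /= addrA normr_cabs [u + z]addrC => H.
have -> : dform (fun i => 'd f z (delta_mx i ord0)) u = 'd f z u.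
  rewrite [in RHS](cV_sum_delta u) linear_sum; apply: eq_bigr => i _.
  by rewrite linearZ /= mulrC.
rewrite -lecR; apply: (le_trans H); rewrite rmorphM /=.
by apply: ler_wpM2l; [exact: ltW|exact: mx_norm_le_lnorm].
Qed.

Lemma lnorm_le_mx_norm u : (lnorm u)%:C <= n%:R * `|u|.
Proof.
apply: (@le_trans _ _ (\sum_(i < n) `|u|)); last by rewrite sumr_const card_ord mulr_natl.
by rewrite /lnorm rmorph_sum /=; apply: ler_sum => i _; exact: cabs_le_mx_norm.
Qed.

Let dform_linear (L : 'I_n -> C) : linear (dform L : V -> C).
Proof.
move=> c x y; rewrite /dform [X in _ = X + _]mulr_sumr -big_split /=.
by apply: eq_bigr => i _; rewrite !mxE; ring.
Qed.

HB.instance Definition _ L :=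
  GRing.isLinear.Build C V C *:%R (dform L) (dform_linear L).

Lemma continuous_dform L : continuous (dform L).
Proof.
have ci i : continuous (fun u : V => L i * u i ord0 : C).
  move=> u; apply: (@continuous_comp _ _ _ (fun u : V => u i ord0) (fun x : C => L i * x)).
    exact: coord_continuous.
  exact: (@mulrl_continuous C).
have H (s : seq 'I_n) : continuous (fun u : V => \sum_(i <- s) L i * u i ord0 : C).
  elim: s => [|i s IH] u.
    rewrite (_ : (fun u : V => _) = fun=> 0); first exact: cst_continuous.
    by apply/funext => w; rewrite big_nil.
  rewrite (_ : (fun u : V => _) = fun u : V => L i * u i ord0 + \sum_(i <- s) L i * u i ord0).
    exact: cvgD (ci i u) (IH u).
  by apply/funext => w; rewrite big_cons.
exact: H.
Qed.

Lemma hdiff_differentiable f z : hdiff f z -> differentiable f z.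
Proof.
move=> [L H].
apply: (differentiable_intro (@continuous_dform L)) => e /posc_real[r r0 ->].
  have n0 : 0 < n.+1%:R :> R by [].
  have [dl dl0 {}H] := H (r / n.+1%:R) (divr_gt0 r0 n0).
  apply/nbhs_normP; exists (dl / n.+1%:R)%:C.
    by rewrite /= -(rmorph0 (real_complex R)) ltcR divr_gt0.
  move=> u; rewrite /= sub0r normrN => ud.
  have l1 : (lnorm u)%:C <= n.+1%:R * `|u|.
    by apply: (le_trans (lnorm_le_mx_norm u)); rewrite ler_wpM2r// ler_nat.
  have {}ud : lnorm u < dl.
    rewrite -ltcR; apply: (le_lt_trans l1); rewrite mulrC -ltr_pdivlMr//.
    by move: ud; rewrite rmorphM /= fmorphV rmorph_nat.
  rewrite normr_cabs [u + z]addrC.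
  apply: (@le_trans _ _ (r / n.+1%:R * lnorm u)%:C); first by rewrite lecR H.
  rewrite rmorphM /= rmorphM /= fmorphV rmorph_nat -mulrA ler_wpM2l//.
    by rewrite -(rmorph0 (real_complex R)) lecR ltW.
  by rewrite mulrC ler_pdivrMr// mulrC.
Qed.

Lemma slice_cder f z u t : hdiff f (z + t *: u) -> cder (fun t => f (z + t *: u)) t.
Proof.
move=> [L H]; exists (dform L u) => e e0.
have c0 : 0 < 1 + lnorm u by rewrite ltr_wpDr// lnorm_ge0.
have [dl dl0 {}H] := H _ (divr_gt0 e0 c0).
exists (dl / (1 + lnorm u)); first by rewrite divr_gt0.
move=> s hs; have l1 : lnorm ((s - t) *: u) <= cabs (s - t) * (1 + lnorm u).
  by rewrite lnormZ ler_wpM2l ?cabs_ge0// lerDr.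
have E : z + s *: u = z + t *: u + (s - t) *: u.
  by rewrite -addrA -scalerDl [t + _]addrC subrK.
have := H ((s - t) *: u); rewrite -E dformZ [_ * dform _ _]mulrC.
move=> /(_ _)/le_trans; apply.
  by apply: (le_lt_trans l1); rewrite -ltr_pdivlMr.
by rewrite mulrAC ler_pdivrMr// -mulrA ler_wpM2l// ltW.
Qed.

Definition hol f := forall z, unit_ball z -> hdiff f z.

(* This is the one-variable Taylor estimate for the slice [t |-> f (z + t u)]. *)
Lemma hol_order2 f z (dl M : R) : 0 < dl -> 0 <= M ->
  (forall u, sqnorm u < dl -> unit_ball (z + u)) ->
  (forall u, sqnorm u < dl -> cabs (f (z + u)) <= M) -> hol f ->
  exists L : 'I_n -> C, forall u, 16 * sqnorm u <= dl ->
    cabs (f (z + u) - f z - dform L u) <= 16 * M * sqnorm u / dl.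
Proof.
move=> dl0 M0 zB fM hf.
have zb : unit_ball z by rewrite -(addr0 z); apply: zB; rewrite sqnorm0.
have [L HL] := hf z zb; exists L => u ud.
have [u0|u0] := eqVneq (sqnorm u) 0.
  have l0 : lnorm u = 0.
    apply: big1 => i _; apply/eqP; rewrite -sqrf_eq0 eq_le exprn_ge0 ?cabs_ge0// andbT.
    by rewrite -u0 cabs_le_sqnorm.
  have [d d0 {}HL] := HL 1 ltr01.
  by have := HL u; rewrite l0 u0 !mulr0 mul0r; apply.
have {}u0 : 0 < sqnorm u by rewrite lt_def u0 sqnorm_ge0.
(* The multiples [t u] stay in the region of squared radius [dl] exactly for [cabs t < rho]. The
   assumption on [u] gives [rho >= 4], so that [taylor_order2] may be used at [t = 1]. *)
pose rho := Num.sqrt (dl / sqnorm u).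
have rho2 : rho ^+ 2 = dl / sqnorm u by rewrite sqr_sqrtr// divr_ge0// ltW.
have rho0 : 0 < rho by rewrite sqrtr_gt0 divr_gt0.
have small t : cabs t < rho -> sqnorm (t *: u) < dl.
  move=> tr; rewrite sqnormZ -ltr_pdivlMr// -rho2.
  by rewrite ltr_pXn2r ?nnegrE ?cabs_ge0// ltW.
pose phi t := f (z + t *: u).
have dphi t : cabs t < rho -> cder phi t.
  by move=> tr; apply: slice_cder; apply: hf; apply: zB; exact: small.
have phiM t : cabs t < rho -> cabs (phi t) <= M by move=> tr; apply: fM; exact: small.
have T2 := taylor_order2 rho0 dphi phiM.
set a1 := taylor_coef phi rho 1 in T2.
have phi0 : phi 0 = f z by rewrite /phi scale0r addr0.
have rho4 : 1 <= rho / 4.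
  rewrite ler_pdivlMr// mul1r -(@ler_pXn2r _ 2)// ?nnegrE ?(ltW rho0)//.
  by rewrite rho2 ler_pdivlMr// -natrX.
(* Two first-order approximations of the same slice are compared at a small real [t], chosen so that
   each error is at most [e t / 4]; together they cannot account for the difference [e t]. *)
have a1E : a1 = dform L u.
  apply/eqP; rewrite -subr_eq0 -[_ == _]negbK -cabs_gt0; apply/negP => e0.
  set e := cabs _ in e0.
  have c0 : 0 < 1 + lnorm u by rewrite ltr_wpDr// lnorm_ge0.
  have [d d0 {}HL] := HL (e / 4 / (1 + lnorm u)) (divr_gt0 (divr_gt0 e0 (@ltr0Sn R 3)) c0).
  pose K := 16 * M / rho ^+ 2.
  have K0 : 0 <= K by rewrite /K !mulr_ge0// invr_ge0 exprn_ge0// ltW.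
  pose t := Num.min (rho / 4) (Num.min (d / (2 * (1 + lnorm u))) (e / (4 * (1 + K)))).
  have t0 : 0 < t.
    by rewrite !lt_min !divr_gt0//= ?mulr_gt0// ltr_wpDr.
  have t1 : t <= rho / 4 by rewrite ge_min lexx.
  have t2 : t <= d / (2 * (1 + lnorm u)) by rewrite !ge_min lexx orbT.
  have t3 : t <= e / (4 * (1 + K)) by rewrite !ge_min lexx !orbT.
  have := T2 t%:C; rewrite cabsE gtr0_norm// => /(_ t1); rewrite phi0 => A.
  have lu : t * lnorm u < d.
    apply: (@le_lt_trans _ _ (t * (1 + lnorm u))); first by rewrite ler_wpM2l ?ltW// ltrDr.
    have c2 : 0 < 2 * (1 + lnorm u) by rewrite mulr_gt0.
    have tl : 0 < t * (1 + lnorm u) by rewrite mulr_gt0.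
    by move: t2; rewrite ler_pdivlMr// mulrCA; move: tl; lra.
  have := HL (t%:C *: u); rewrite lnormZ cabsE gtr0_norm// => /(_ lu); rewrite dformZ => B.
  have D : e * t <= 16 * M * t ^+ 2 / rho ^+ 2 + e / 4 / (1 + lnorm u) * (t * lnorm u).
    have -> : e * t = cabs ((a1 - dform L u) * t%:C).
      by rewrite Normc.normcM cabsE gtr0_norm.
    rewrite (_ : _ * _ = (f (z + t%:C *: u) - f z - t%:C * dform L u) -
      (phi t%:C - f z - a1 * t%:C)); last by rewrite /phi; ring.
    by apply: (le_trans (le_cabsB _ _)); rewrite addrC lerD.
  have E1 : 16 * M * t ^+ 2 / rho ^+ 2 <= e / 4 * t.
    rewrite (_ : _ / _ = K * t * t); last by rewrite /K; ring.
    rewrite ler_wpM2r ?(ltW t0)//; apply: (@le_trans _ _ ((1 + K) * t)).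
      by rewrite ler_wpM2r ?(ltW t0)// lerDr.
    rewrite mulrC -ler_pdivlMr; last by rewrite ltr_wpDr.
    by rewrite -mulrA -invfM.
  have E2 : e / 4 / (1 + lnorm u) * (t * lnorm u) <= e / 4 * t.
    rewrite mulrAC ler_pdivrMr// mulrA ler_wpM2l//; last by rewrite lerDr.
    by rewrite mulr_ge0 ?ltW// divr_gt0.
  by have : 0 < e * t by [rewrite mulr_gt0]; lra.
have := T2 1; rewrite Normc.normc1 => /(_ rho4); rewrite expr1n mulr1 phi0 a1E mulr1.
rewrite {1}/phi scale1r => /le_trans; apply; rewrite rho2 invf_div mulrA//.
Qed.

End holomorphic_Cn.

Section hol_limit.
Variables (R : realType) (n : nat).
Local Notation C := R[i].
Local Notation V := ('cV[R[i]]_n).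

Lemma ccvgB (u u' : nat -> C) (l l' : C) : ccvg u l -> ccvg u' l' ->
  ccvg (fun N => u N - u' N) (l - l').
Proof.
move=> H H'; rewrite -(mulN1r l'); under eq_fun => N do rewrite -(mulN1r (u' N)).
exact: ccvgD (ccvgZ _ H').
Qed.

Lemma ccvg_is_cauchy (u : nat -> C) (l : C) (e : R) : ccvg u l -> 0 < e ->
  exists N0, forall N M, (N0 <= N)%N -> (N0 <= M)%N -> cabs (u N - u M) <= e.
Proof.
move=> H e0; have [N0 HN] := H _ (divr_gt0 e0 (@ltr0Sn R 1)).
exists N0 => N M /HN h1 /HN h2; rewrite (_ : _ - _ = (u N - l) - (u M - l)); last by ring.
by apply: (le_trans (le_cabsB _ _)); rewrite [leRHS](splitr e) lerD.
Qed.

Lemma ccvg_dform (L : nat -> 'I_n -> C) (l : 'I_n -> C) (u : V) :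
  (forall i, ccvg (L^~ i) (l i)) -> ccvg (fun N => dform (L N) u) (dform l u).
Proof.
move=> H; apply: ccvg_sum => i; rewrite mulrC; under eq_fun do rewrite mulrC.
exact: ccvgZ.
Qed.

Lemma dform_delta (L : 'I_n -> C) i (s : C) : dform L (s *: delta_mx i ord0) = s * L i.
Proof.
rewrite dformZ /dform (bigD1 i)//= !mxE !eqxx mulr1 big1 ?addr0// => j ji.
by rewrite mxE (negbTE ji) mulr0.
Qed.

Lemma sqnorm_delta i : sqnorm (delta_mx i ord0 : V) = 1.
Proof.
rewrite sqnormE (bigD1 i)//= mxE !eqxx Normc.normc1 expr1n big1 ?addr0// => j ji.
by rewrite mxE (negbTE ji) Normc.normc0 expr0n.
Qed.

(** By [hol_order2] the error of the linear approximation at [z] is at most [K * sqnorm u] for all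
    [N] at once. Applied to small multiples of the basis vectors, this makes the differentials of
    the [F N] a Cauchy sequence; the estimate then passes to the limit. *)
Lemma hol_limit (F : nat -> V -> C) (f : V -> C) : (forall N, hol (F N)) ->
  (forall r : R, 0 <= r < 1 -> exists M : R, forall N z, sqnorm z <= r -> cabs (F N z) <= M) ->
  (forall z, unit_ball z -> ccvg (F^~ z) (f z)) -> hol f.
Proof.
move=> hF bF cF z zB.
have zr : 0 <= sqnorm z < 1 by rewrite sqnorm_ge0.
have [dl dl0 near] := sqnormD_near n zr.
have r' : 0 <= (1 + sqnorm z) / 2 < 1 by move: zr => /andP[]; lra.
have [M FM] := bF _ r'.
have M0 : 0 <= M.
  have := FM 0%N 0; rewrite sqnorm0 => /(_ (proj1 (andP r'))).
  exact: le_trans (cabs_ge0 _).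
have zu u : sqnorm u < dl -> sqnorm (z + u) <= (1 + sqnorm z) / 2.
  by move=> /ltW; exact: near.
have zuB u : sqnorm u < dl -> unit_ball (z + u).
  by move=> /zu h; apply: le_lt_trans h (proj2 (andP r')).
have HL N : exists L : 'I_n -> C, forall u, 16 * sqnorm u <= dl ->
    cabs (F N (z + u) - F N z - dform L u) <= 16 * M * sqnorm u / dl.
  by apply: hol_order2 => // u /zu; exact: FM.
have {HL}[L HL] := choice HL.
pose K := 1 + 16 * M / dl.
have K0 : 0 < K by rewrite ltr_wpDr// divr_ge0 ?(ltW dl0)// mulr_ge0.
have {}HL N u : 16 * sqnorm u <= dl ->
    cabs (F N (z + u) - F N z - dform (L N) u) <= K * sqnorm u.
  move=> /(HL N)/le_trans; apply.
  by rewrite [leRHS]mulrDl mul1r mulrAC lerDr sqnorm_ge0.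
have cD u : sqnorm u < dl -> ccvg (fun N => F N (z + u) - F N z) (f (z + u) - f z).
  by move=> /zuB h; apply: ccvgB; exact: cF.
have cL i : exists l, ccvg (fun N => L N i) l.
  apply: ccvg_cauchy => e e0.
  (* The step [s] makes both second-order errors [K s^2] at most [e s / 4], and convergence at the
     two points bounds the rest by [e s / 2]. *)
  pose s := Num.min 1 (Num.min (dl / 16) (e / (4 * K))).
  have s0 : 0 < s by rewrite !lt_min ltr01 !divr_gt0//= mulr_gt0.
  have s1 : s <= 1 by rewrite ge_min lexx.
  have s2 : s <= dl / 16 by rewrite !ge_min lexx orbT.
  have s3 : s * K <= e / 4.
    by rewrite -ler_pdivlMr// -mulrA -invfM !ge_min lexx !orbT.
  pose u : V := s%:C *: delta_mx i ord0.
  have uE : sqnorm u = s ^+ 2 by rewrite sqnormZ sqnorm_delta mulr1 cabsE gtr0_norm.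
  have ss : s ^+ 2 <= s by rewrite expr2 ler_piMl// ltW.
  have u1 : 16 * sqnorm u <= dl by rewrite uE; lra.
  have u2 : sqnorm u < dl by rewrite uE; lra.
  have es : 0 < e / 2 * s by rewrite mulr_gt0// divr_gt0.
  have [N0 HN] := ccvg_is_cauchy (cD _ u2) es.
  exists N0 => N N' hN hN'; have := HN _ _ hN hN'.
  have := HL N u u1; have := HL N' u u1; rewrite !dform_delta uE.
  move: (F N (z + u) - _) (F N' (z + u) - _) (L N i) (L N' i) => x y a b hb ha hxy.
  have : cabs (s%:C * (a - b)) <= cabs (x - y) + cabs (y - s%:C * b) + cabs (x - s%:C * a).
    rewrite (_ : s%:C * (a - b) = (x - y) + (y - s%:C * b) - (x - s%:C * a)); last by ring.
    by apply: (le_trans (le_cabsB _ _)); rewrite lerD2r; exact: le_normcD.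
  rewrite Normc.normcM cabsE gtr0_norm// => h.
  have k1 : K * s ^+ 2 <= e / 4 * s by rewrite expr2 mulrA ler_wpM2r// 1?mulrC// ltW.
  by rewrite -(ler_pM2l s0); lra.
have [l cl] := choice cL.
exists l => e e0.
pose d := Num.min 1 (Num.min (dl / 16) (e / K)).
exists d; first by rewrite !lt_min ltr01 !divr_gt0.
move=> u; rewrite /d !lt_min => /and3P[d1 d2 d3].
have lu := lnorm_ge0 u; have su := sqnorm_le_lnorm u.
have ll : lnorm u ^+ 2 <= lnorm u by rewrite expr2 ler_piMl// ltW.
have u1 : 16 * sqnorm u <= dl by lra.
have u2 : sqnorm u < dl by have := sqnorm_ge0 u; lra.
apply: (@le_trans _ _ (K * sqnorm u)).
  apply: (ccvg_le (ccvgB (cD _ u2) (ccvg_dform u cl))) => N; exact: HL.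
apply: (@le_trans _ _ (K * lnorm u ^+ 2)); first by rewrite ler_wpM2l// ltW.
by rewrite expr2 mulrA ler_wpM2r// mulrC -ler_pdivlMr// ltW.
Qed.

End hol_limit.

(** * Averages over roots of unity *)

Section root_averages.
Variable R : realType.
Local Notation C := R[i].

Lemma cis_eq1 (x : R) : 0 < `|x| < 2 * pi -> cis x != 1.
Proof.
move=> hx; apply/eqP => /eqP; rewrite eq_complex /= => /andP[/eqP c1 _].
have H (y : R) : 0 < y < 2 * pi -> cos y <> 1.
  move=> /andP[y0 y1] cy.
  have := @sin_gt0_pi R (y / 2); rewrite divr_gt0// => /(_ _).
  have -> : y / 2 < pi by rewrite ltr_pdivrMr// mulrC.
  move=> /(_ isT) sy.
  have : cos (y / 2 *+ 2) = 1 by rewrite -mulr_natr divfK.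
  rewrite cos_mulr2n cos2sin2 => h; have : sin (y / 2) ^+ 2 = 0.
    by move: h; rewrite -[_ *+ 2]mulr_natr; lra.
  by move/eqP; rewrite sqrf_eq0 gt_eqF.
have [x0|x0] := ltP 0 x.
  by apply: (H x) => //; rewrite -(gtr0_norm x0).
by apply: (H (- x)); rewrite ?cosN// -(ler0_norm x0).
Qed.

Lemma cisX (x : R) (k : nat) : cis x ^+ k = cis (k%:R * x).
Proof.
elim: k => [|k IH]; first by rewrite expr0 mul0r cis0.
by rewrite exprS IH -cisD -natr1 mulrDl mul1r addrC.
Qed.

Lemma cisN (x : R) : conjc (cis x) = cis (- x).
Proof. by rewrite /cis cosN sinN. Qed.

Definition unity N (j : nat) : C := cis (2 * pi * j%:R / N%:R).

Lemma cabs_unity N j : cabs (unity N j) = 1.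
Proof. exact: cabs_cis. Qed.

(** A geometric sum of ratio [z], an [N]-th root of unity, which is not 1 for [k != d] because the
    difference of the exponents is smaller than [N]. *)
Lemma unity_orth N (k d : nat) : (k < N)%N -> (d < N)%N ->
  \sum_(j < N) conjc (unity N j) ^+ d * unity N j ^+ k = if k == d then N%:R else 0.
Proof.
move=> kN dN; have N0 : 0 < N%:R :> R by rewrite ltr0n (leq_ltn_trans _ kN).
pose z : C := cis ((k%:R - d%:R) * (2 * pi / N%:R)).
have E (j : 'I_N) : true -> conjc (unity N j) ^+ d * unity N j ^+ k = z ^+ j.
  move=> _; rewrite cisN !cisX -cisD; congr cis; ring.
rewrite (eq_bigr _ E); have [kd|kd] := eqVneq k d.
  rewrite /z kd subrr mul0r cis0; under eq_bigr do rewrite expr1n.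
  by rewrite sumr_const card_ord.
have z1 : z != 1.
  apply: cis_eq1; rewrite normrM (gtr0_norm (_ : 0 < 2 * pi / N%:R)); last first.
    by rewrite divr_gt0// mulr_gt0// pi_gt0.
  have p0 : 0 < 2 * pi / N%:R :> R by rewrite divr_gt0// mulr_gt0// pi_gt0.
  rewrite mulr_gt0 ?normr_gt0 ?subr_eq0 ?eqr_nat//=.
  rewrite mulrA ltr_pdivrMr// mulrC ltr_pM2l ?mulr_gt0 ?pi_gt0// ltr_norml.
  have : k%:R < N%:R :> R by rewrite ltr_nat.
  have : d%:R < N%:R :> R by rewrite ltr_nat.
  have : 0 <= k%:R :> R by [].
  have : 0 <= d%:R :> R by [].
  by move: (k%:R) (d%:R) (N%:R) => x y t; lra.
have zN : z ^+ N = 1.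
  rewrite /z cisX.
  have -> : N%:R * ((k%:R - d%:R) * (2 * pi / N%:R)) = k%:R * (2 * pi) + - (d%:R * (2 * pi)) :> R.
    by field; rewrite gt_eqF.
  by rewrite cisD -cisN -(cisX _ k) -(cisX _ d) cis2pi !expr1n -(rmorph1 (@real_complex R)) conjc_real mulr1.
have := subrX1 z N; rewrite zN subrr => /esym/eqP; rewrite mulf_eq0 subr_eq0 (negbTE z1).
by move=> /eqP.
Qed.

(** A discrete version of Cauchy's formula for the coefficient of degree [d]. For [N = 0] its value
    is 0. *)
Definition root_avg N (d : nat) (phi : C -> C) : C :=
  N%:R^-1 * \sum_(j < N) conjc (unity N j) ^+ d * phi (unity N j).

Lemma cabs_conj_unityX N j d : cabs (conjc (unity N j) ^+ d) = 1.
Proof. by rewrite cabsX cabsJ cabs_unity expr1n. Qed.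

Lemma cabs_natV N : cabs (N%:R^-1 : C) = N%:R^-1.
Proof. by rewrite -(rmorph_nat (real_complex R)) -fmorphV cabsE ger0_norm// invr_ge0. Qed.

Lemma root_avg_le N d phi (M : R) : 0 <= M -> (forall j, cabs (phi (unity N j)) <= M) ->
  cabs (root_avg N d phi) <= M.
Proof.
move=> M0 H; rewrite /root_avg Normc.normcM cabs_natV.
case: N H => [|N] H; first by rewrite invr0 mul0r.
rewrite mulrC ler_pdivrMr//; apply: (le_trans (le_cabs_sum _ _ _)).
apply: (@le_trans _ _ (\sum_(j < N.+1) M)); last by rewrite sumr_const card_ord mulr_natr.
by apply: ler_sum => j _; rewrite Normc.normcM cabs_conj_unityX mul1r.
Qed.

Lemma eq_root_avg N d (phi psi : C -> C) : (forall t, cabs t = 1 -> phi t = psi t) ->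
  root_avg N d phi = root_avg N d psi.
Proof.
move=> E; rewrite /root_avg; congr (_ * _); apply: eq_bigr => j _.
by rewrite E// cabs_unity.
Qed.

Section analytic.
Variables (phi : C -> C) (rho : R).
Hypothesis rho1 : 1 < rho.
Hypothesis dphi : forall z, cabs z < rho -> cder phi z.

Let a := taylor_coef phi rho.

(** Cauchy's estimate on a circle of radius strictly between 1 and [rho]. The bound has to be
    uniform in [w], since it is used at the [N] roots of unity with an order that is also [N]. *)
Lemma taylor_remainder_circle : exists C0 q : R, [/\ 0 <= q, q < 1 &
  forall w (m : nat), cabs w <= 1 ->
    cabs (phi w - \sum_(k < m) a k * w ^+ k) <= C0 * q ^+ m].
Proof.
have rho0 : 0 < rho by move: rho1; lra.
pose r := (1 + rho) / 2.
have r1 : 1 < r by rewrite /r; move: rho1; lra.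
have rr : r < rho by rewrite /r; move: rho1; lra.
have r0 : 0 < r by lra.
have cgr t : ccont phi (r%:C * cis t).
  by apply/cder_ccont/dphi; rewrite cabs_rcis gtr0_norm.
have [M HM] := circ_bounded cgr.
have aM k := taylor_coef_le dphi k r0 rr HM.
pose q := r^-1.
have q0 : 0 <= q by rewrite invr_ge0 ltW.
have q1 : q < 1 by rewrite invf_lt1.
have M0 : 0 <= M.
  by apply: le_trans (HM 0 _); rewrite ?cabs_ge0// lexx mulr_ge0// pi_ge0.
have step k w : cabs w <= 1 -> cabs (a k * w ^+ k) <= 2 * M * q ^+ k.
  move=> w1; rewrite Normc.normcM cabsX /q exprVn.
  rewrite ler_pdivlMr ?exprn_gt0//; apply: le_trans (aM k); rewrite ler_wpM2r//.
    by rewrite exprn_ge0// ltW.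
  by rewrite ler_piMr ?cabs_ge0// exprn_ile1// cabs_ge0.
pose C0 := 2 * M / (1 - q).
have C00 : 0 <= C0 by rewrite divr_ge0 ?mulr_ge0// subr_ge0 ltW.
have tail K m w : cabs w <= 1 -> cabs (\sum_(m <= k < m + K) a k * w ^+ k) <= C0 * q ^+ m.
  move=> w1; elim: K m => [|K IH] m.
    by rewrite addn0 big_geq// Normc.normc0 mulr_ge0// exprn_ge0.
  rewrite addnS big_ltn ?ltnS ?leq_addr// -addSn; apply: (le_trans (le_normcD _ _)).
  apply: (le_trans (lerD (step m _ w1) (IH m.+1))).
  rewrite exprS mulrA -mulrDl ler_wpM2r ?exprn_ge0//.
  rewrite (_ : 2 * M = C0 * (1 - q)); last by rewrite /C0 divfK// gt_eqF// subr_gt0.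
  by rewrite -mulrDr subrK mulr1.
exists C0, q; split => // w m w1.
have wr : cabs w < rho by apply: le_lt_trans rho1.
apply: (@ccvg_le _ (fun K => \sum_(m <= k < m + K) a k * w ^+ k)); last first.
  by move=> K; exact: tail.
move=> e e0; have [N0 HN] := taylor_cvg dphi wr e0; exists N0 => N hN.
have := HN (m + N)%N (leq_trans hN (leq_addl _ _)).
rewrite -!(big_mkord xpredT (fun k => a k * w ^+ k)).
rewrite (big_cat_nat (n := m)) ?leq_addr//=.
move: (\sum_(0 <= i < m) _) (\sum_(m <= i < _) _) (phi w) => x y z.
by rewrite (_ : x + y - z = y - (z - x)); last ring.
Qed.

(** The average over [N]-th roots of unity extracts the coefficient exactly from polynomials of
    degree below [N], so the error is the average of the Taylor remainder of order [N]. *)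
Lemma root_avg_cvg d w : cabs w <= 1 ->
  ccvg (fun N => root_avg N d (fun t => phi (t * w))) (a d * w ^+ d).
Proof.
move=> w1.
have [C0 [q [q0 q1 H]]] := taylor_remainder_circle.
move=> e e0.
have : geometric C0 q @ \oo --> (0 : R) by apply: cvg_geometric; rewrite ger0_norm.
move/cvgrPdist_le => /(_ e e0)[N0 _ HN]; exists (maxn N0 d.+1) => N.
rewrite geq_max => /andP[/HN]; rewrite /geometric /= sub0r normrN => h dN.
have N0' : N%:R != 0 :> C by rewrite pnatr_eq0 -lt0n (leq_ltn_trans _ dN).
have E : root_avg N d (fun t => phi (t * w)) - a d * w ^+ d =
    root_avg N d (fun t => phi (t * w) - \sum_(k < N) a k * (t * w) ^+ k).
  rewrite /root_avg; under [in RHS]eq_bigr do rewrite mulrBr.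
  rewrite sumrB mulrBr; congr (_ - _).
  under eq_bigr do rewrite mulr_sumr; rewrite exchange_big /=.
  under eq_bigr => k _.
    rewrite (eq_bigr (fun j : 'I_N => (conjc (unity N j) ^+ d * unity N j ^+ k) * (a k * w ^+ k))); last first.
      by move=> j _; rewrite exprMn; ring.
    rewrite -mulr_suml unity_orth//; over.
  rewrite (bigD1 (Ordinal dN))//= eqxx big1 ?addr0; last first.
    move=> k kd; rewrite ifF ?mul0r//; apply/negbTE; apply: contra kd => /eqP kE.
    exact/eqP/val_inj.
  by rewrite [RHS]mulrA mulVf// mul1r.
rewrite E; apply: (le_trans (root_avg_le d _ _)); last exact: le_trans (ler_norm _) h.
  by apply: (le_trans (cabs_ge0 _) (H 0 N _)); rewrite Normc.normc0.
by move=> j; apply: H; rewrite Normc.normcM cabs_unity mul1r.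
Qed.

End analytic.

End root_averages.

(** * Pointwise bounds in the weighted norm *)

Lemma fatou_le d (T : measurableType d) (R : realType) (mu : {measure set T -> \bar R})
    (D : set T) (f : nat -> T -> R) (g : T -> R) (M : \bar R) : measurable D ->
  (forall N, measurable_fun D (f N)) -> (forall N x, D x -> 0 <= f N x) ->
  (forall x, D x -> f^~ x @ \oo --> g x) ->
  (forall N, \int[mu]_(x in D) (f N x)%:E <= M)%E -> (\int[mu]_(x in D) (g x)%:E <= M)%E.
Proof.
move=> mD mf f0 fg fM.
have -> : (\int[mu]_(x in D) (g x)%:E = \int[mu]_(x in D) limn_einf (fun N => (f N x)%:E))%E.
  apply: eq_integral => x; rewrite inE => Dx; apply/esym.
  have /cvg_limn_einf_sup[]// : (fun N => (f N x)%:E) @ \oo --> (g x)%:E.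
  by apply: cvg_EFin; [exact: nearW|exact: fg].
apply: (le_trans (@fatou _ _ _ mu D mD (fun N x => (f N x)%:E) _ _)) => [N|N x Dx|].
- by apply/measurable_EFinP; exact: mf.
- by rewrite lee_fin f0.
rewrite limn_einf_lim; apply: lime_le; first exact: is_cvg_einfs.
apply: nearW => N; apply: le_trans (fM N); apply: ereal_inf_lbound.
by exists N => /=.
Qed.

Lemma measurable_subst d1 d2 d3 (T1 : measurableType d1) (T2 : measurableType d2)
    (T3 : measurableType d3) (D : set T1) (E : set T2) (phi : T1 -> T2) (f : T2 -> T3) :
  measurable E -> (forall x, D x -> E (phi x)) -> measurable_fun E f ->
  measurable_fun D phi -> measurable_fun D (fun x => f (phi x)).
Proof.
move=> mE DE mf mphi; apply: (@measurable_comp _ _ _ _ _ _ E f D phi) => //.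
by move=> _ [x Dx <-]; exact: DE.
Qed.

Section square_mean.
Variable R : realType.
Local Notation C := R[i].

Lemma sqr_sum_le N (x : 'I_N -> R) : (\sum_j x j) ^+ 2 <= N%:R * \sum_j x j ^+ 2.
Proof.
case: N x => [|N] x; first by rewrite !big_ord0 mul0r expr0n.
pose m := (\sum_j x j) / N.+1%:R.
have mE : \sum_j x j = N.+1%:R * m by rewrite mulrC divfK.
have : 0 <= \sum_j (x j - m) ^+ 2 by apply: sumr_ge0 => j _; exact: sqr_ge0.
have -> : \sum_j (x j - m) ^+ 2 = \sum_j x j ^+ 2 - N.+1%:R * m ^+ 2.
  rewrite (eq_bigr (fun j => x j ^+ 2 + (- 2 * m) * x j + m ^+ 2)); last by move=> j _; ring.
  by rewrite !big_split /= -mulr_sumr mE sumr_const card_ord -mulr_natl; ring.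
move=> h; rewrite mE exprMn [N.+1%:R ^+ 2]expr2 -mulrA ler_wpM2l//.
by move: h; lra.
Qed.

Lemma root_avg_sqr_le N d (phi : C -> C) :
  cabs (root_avg N d phi) ^+ 2 <= N%:R^-1 * \sum_(j < N) cabs (phi (unity R N j)) ^+ 2.
Proof.
case: N => [|N]; first by rewrite /root_avg big_ord0 mulr0 Normc.normc0 expr0n big_ord0 mulr0.
rewrite /root_avg Normc.normcM cabs_natV exprMn.
have h : cabs (\sum_(j < N.+1) conjc (unity R N.+1 j) ^+ d * phi (unity R N.+1 j)) ^+ 2 <=
   N.+1%:R * \sum_(j < N.+1) cabs (phi (unity R N.+1 j)) ^+ 2.
  apply: le_trans (sqr_sum_le _); rewrite ler_pXn2r ?nnegrE ?cabs_ge0//; last first.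
    by apply: sumr_ge0 => j _; exact: cabs_ge0.
  apply: (le_trans (le_cabs_sum _ _ _)); apply: ler_sum => j _.
  by rewrite Normc.normcM cabs_conj_unityX mul1r.
rewrite expr2 -mulrA ler_pM2l ?invr_gt0//.
by rewrite mulrC ler_pdivrMr// mulrC.
Qed.

Lemma ccvg_cabs_sqr (u : nat -> C) l : ccvg u l -> (fun N => cabs (u N) ^+ 2) @ \oo --> cabs l ^+ 2.
Proof.
move=> /ccvg_ReIm[h1 h2]; rewrite cabs_sqr.
under eq_fun do rewrite cabs_sqr.
by apply: cvgD; rewrite !expr2; apply: cvgM.
Qed.

End square_mean.

Section weight_bounds.
Variables (R : realType) (n : nat) (lambda : R).
Local Notation V := ('cV[R[i]]_n).

Definition wconst : R := Gamma (n%:R + lambda + 1) / (pi ^+ n * Gamma (lambda + 1)).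

Lemma weightE (z : V) : weight lambda z = wconst * (1 - sqnorm z) `^ lambda.
Proof. by []. Qed.

Lemma wconst_ge0 : 0 <= wconst.
Proof.
have G (x : R) : 0 <= Gamma x.
  by apply: Rintegral_ge0 => t _; rewrite mulr_ge0 ?powR_ge0 ?expR_ge0.
by rewrite /wconst divr_ge0// mulr_ge0// exprn_ge0// pi_ge0.
Qed.

Lemma weight_ge0 (z : V) : 0 <= weight lambda z.
Proof. by rewrite weightE mulr_ge0 ?wconst_ge0 ?powR_ge0. Qed.

Lemma measurable_weight (D : set V) : measurable_fun D (@weight R n lambda).
Proof.
apply: measurable_funTS; apply: measurable_funM; first exact: measurable_cst.
exact: measurable_radial_powR.
Qed.

Lemma weight_lower (r : R) : 0 < wconst -> 0 <= r < 1 -> exists2 m : R, 0 < m &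
  forall z : V, sqnorm z <= r -> m <= weight lambda z.
Proof.
move=> c0 /andP[r0 r1]; have r1' : 0 < 1 - r by rewrite subr_gt0.
(* For negative [lambda] the power is at least 1; for the others it decreases with [sqnorm z] and is
   smallest at [r]. *)
exists (wconst * Num.min 1 ((1 - r) `^ lambda)).
  by rewrite mulr_gt0// lt_min ltr01 powR_gt0.
move=> z zr; rewrite weightE ler_pM2l// ge_min; apply/orP.
have z0 := sqnorm_ge0 z.
have [l0|l0] := leP 0 lambda.
  by right; apply: ge0_ler_powR => //; rewrite ?nnegrE; lra.
left; rewrite -[lambda]opprK powRN invr_ge1; last 2 first.
- by rewrite unitfE gt_eqF// powR_gt0//; lra.
- by rewrite powR_gt0//; lra.
apply: (@le_trans _ _ (1 `^ (- lambda))); last by rewrite powR1.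
by apply: ge0_ler_powR; rewrite ?nnegrE; lra.
Qed.

End weight_bounds.

(** Provides the room beyond the closed unit disc that the averages over roots of unity require of a
    slice. *)
Lemma sqr_dilation_lt (R : realType) (s dl : R) : 0 <= s -> s < dl ->
  exists2 rho : R, 1 < rho & rho ^+ 2 * s < dl.
Proof.
move=> s0 sd; have dl0 : 0 < dl by lra.
pose e := (dl - s) / (4 * dl).
have e0 : 0 < e by rewrite divr_gt0 ?mulr_gt0// subr_gt0.
have ed : e * (4 * dl) = dl - s by rewrite /e divfK// gt_eqF// mulr_gt0.
have e1 : e <= 1.
  by rewrite ler_pdivrMr ?mulr_gt0//; lra.
exists (1 + e); first by lra.
have h1 : e * e * s <= e * s by rewrite ler_wpM2r// ler_piMr// ltW.
have h2 : e * s <= e * dl by rewrite ler_wpM2l// ltW.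
have -> : (1 + e) ^+ 2 * s = s + 2 * (e * s) + e * e * s by ring.
by lra.
Qed.

Section pointwise_bound.
Variables (R : realType) (n : nat) (lambda : R).
Hypothesis c0 : 0 < wconst n lambda.
Local Notation C := R[i].
Local Notation V := ('cV[R[i]]_n).
Local Notation v := (@lebesgue_Cn R n).
Local Notation B := (unit_ball (R := R) (n := n)).

Definition nsq (f : V -> C) : \bar R :=
  (\int[v]_(z in B) (cabs (f z) ^+ 2 * weight lambda z)%:E)%E.

Lemma measurable_nsq f : measurable_fun B f ->
  measurable_fun B (fun z => cabs (f z) ^+ 2 * weight lambda z).
Proof.
by move=> mf; apply: measurable_funM; [exact: measurable_cabs_sqr|exact: measurable_weight].
Qed.

Lemma nsq_ge0 f : (0 <= nsq f)%E.
Proof.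
by apply: integral_ge0 => z _; rewrite lee_fin mulr_ge0 ?exprn_ge0 ?cabs_ge0 ?weight_ge0.
Qed.

(** For each small [u] the value [h z] is the limit of the averages of [h (z + t u)] over roots of
    unity [t]. Squaring, integrating over [u], Fatou's lemma and the invariance of the volume under
    [u |-> t u + z] bound [cabs (h z) ^+ 2] times the volume [V0] by [A / m], where [m] is a lower
    bound of the weight. *)
Lemma hol_pointwise_bound (r : R) : 0 <= r < 1 -> exists2 K : R, 0 <= K &
  forall (h : V -> C) (A : R), hol h -> measurable_fun B h -> (nsq h <= A%:E)%E ->
  forall z, sqnorm z <= r -> cabs (h z) ^+ 2 <= K * A.
Proof.
move=> r01; have [dl dl0 near] := sqnormD_near n r01.
have r' : 0 <= (1 + r) / 2 < 1 by move: r01 => /andP[]; lra.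
have [m m0 wm] := weight_lower c0 r'.
have [V0 V00 VE] : exists2 V0 : R, 0 < V0 & v (cball dl) = V0%:E.
  have h1 := measure_unit_ball_lty R n; have h2 := measure_unit_ball_gt0 R n.
  exists (dl ^+ n * fine (v B)); first by rewrite mulr_gt0 ?exprn_gt0// fine_gt0// h2 h1.
  by rewrite measure_cball// EFinM fineK// ge0_fin_numE.
exists (m * V0)^-1; first by rewrite invr_ge0 mulr_ge0// ltW.
move=> h A hh mh hA z zr.
have mD : measurable (cball dl : set V) by exact: measurable_cball.
have zuB u : sqnorm u < dl -> sqnorm (z + u) <= (1 + r) / 2.
  by move=> /ltW ud; exact: near.
have rB (u : V) : sqnorm u <= (1 + r) / 2 -> B u.
  by move=> ur; apply: le_lt_trans ur (proj2 (andP r')).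
have rot (w : C) u : cabs w = 1 -> sqnorm (w *: u) = sqnorm u.
  by move=> w1; rewrite sqnormZ w1 expr1n mul1r.
have phiS (w : C) : cabs w = 1 -> scales v 1 (fun u => w *: u + z).
  move=> w1; rewrite -(mulr1 1).
  exact: (scales_comp (scales_Cn_rotation n w1) (scales_Cn_translation z)).
have mhw (w : C) : cabs w = 1 -> measurable_fun (cball dl) (fun u => h (z + w *: u)).
  move=> w1; apply: (measurable_subst (E := B)) mh _ => //.
  - exact: measurable_unit_ball.
  - by move=> u ud; apply/rB/zuB; rewrite rot.
  apply: measurable_funTS; under eq_fun do rewrite addrC; exact: (phiS w w1).1.
have bound (w : C) : cabs w = 1 ->
    (\int[v]_(u in cball dl) (cabs (h (z + w *: u)) ^+ 2)%:E <= (m^-1 * A)%:E)%E.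
  (* Extension by 0 allows the change of variables on the whole space, since the small ball is not
     invariant under [u |-> w u + z]. *)
  move=> w1; pose G : V -> \bar R := (fun y => (cabs (h y) ^+ 2 * weight lambda y)%:E) \_ B.
  have mG : measurable_fun setT G.
    apply: (proj1 (measurable_restrictT _ _)); first exact: measurable_unit_ball.
    by apply/measurable_EFinP; exact: measurable_nsq.
  have G0 y : (0 <= G y)%E.
    rewrite /G patchE; case: ifPn => // _.
    by rewrite lee_fin mulr_ge0 ?exprn_ge0 ?cabs_ge0 ?weight_ge0.
  apply: (@le_trans _ _ (\int[v]_(u in cball dl) ((m^-1)%:E * G (w *: u + z)%R))%E).
    apply: ge0_le_integral => //.
    - by move=> u _; rewrite lee_fin exprn_ge0// cabs_ge0.
    - by apply/measurable_EFinP; apply: measurable_cabs_sqr; exact: mhw.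
    - apply: measurable_funTS; apply: measurable_funeM.
      by apply: (measurableT_comp mG); exact: (phiS w w1).1.
    - move=> u ud; have u1 : sqnorm (w *: u + z) <= (1 + r) / 2.
        by rewrite addrC; apply: zuB; rewrite rot.
      rewrite /G patchE mem_set; last exact: rB.
      rewrite -EFinM lee_fin [z + _]addrC mulrC -mulrA ler_peMr ?exprn_ge0 ?cabs_ge0//.
      by rewrite ler_pdivlMr// mul1r; exact: wm.
  apply: (@le_trans _ _ (\int[v]_u ((m^-1)%:E * G (w *: u + z)%R))%E).
    apply: ge0_subset_integral => //.
    - apply: measurable_funeM; apply: (measurableT_comp mG); exact: (phiS w w1).1.
    - by move=> u _; rewrite mule_ge0// lee_fin invr_ge0 ltW.
  rewrite ge0_integralZl//; last 2 first.
  - by apply: (measurableT_comp mG); exact: (phiS w w1).1.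
  - by rewrite lee_fin invr_ge0 ltW.
  rewrite (ge0_integral_scales measurableT (phiS w w1))//.
  rewrite EFinM lee_wpmul2l ?lee_fin ?invr_ge0 ?(ltW m0)//.
  apply: le_trans hA; rewrite le_eqVlt; apply/orP; left; apply/eqP.
  by rewrite /nsq [RHS]integral_mkcond /G.
pose g N (u : V) := cabs (root_avg N 0 (fun t => h (z + t *: u))) ^+ 2.
have key : (\int[v]_(u in cball dl) (cabs (h z) ^+ 2)%:E <= (m^-1 * A)%:E)%E.
  apply: (@fatou_le _ _ _ v _ g) => //.
  - move=> N; apply: measurable_cabs_sqr; apply: cmeasurableM => //.
    apply: cmeasurable_sum => j; apply: cmeasurableM => //.
    exact: mhw (cabs_unity _ _ _).
  - by move=> N u _; rewrite exprn_ge0// cabs_ge0.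
  - move=> u ud; apply: ccvg_cabs_sqr.
    have [rho rho1 rhou] : exists2 rho : R, 1 < rho & rho ^+ 2 * sqnorm u < dl.
      by apply: sqr_dilation_lt => //; exact: sqnorm_ge0.
    have dphi t : cabs t < rho -> cder (fun t => h (z + t *: u)) t.
      move=> tr; apply/slice_cder/hh/rB/zuB; rewrite sqnormZ.
      apply: le_lt_trans rhou; rewrite ler_wpM2r ?sqnorm_ge0//.
      by rewrite lerXn2r// ?nnegrE ?cabs_ge0 ?(ltW tr)//; lra.
    rewrite -[h z](_ : taylor_coef (fun t => h (z + t *: u)) rho 0 = _).
      have := @root_avg_cvg _ _ _ rho1 dphi 0 1.
      rewrite Normc.normc1 mulr1 => /(_ (lexx _)).
      by apply: eq_ccvg => N; apply: eq_root_avg => t _; rewrite mulr1.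
    by rewrite taylor_coef0// ?scale0r ?addr0//; lra.
  - move=> N.
    have mj (j : 'I_N) : measurable_fun (cball dl) (fun u => cabs (h (z + unity R N j *: u)) ^+ 2).
      by apply: measurable_cabs_sqr; exact: mhw (cabs_unity _ _ _).
    apply: (@le_trans _ _ (\int[v]_(u in cball dl)
        ((N%:R^-1)%:E * \sum_(j < N) (cabs (h (z + unity R N j *: u)) ^+ 2)%:E))%E).
      apply: ge0_le_integral => //.
      - by move=> u _; rewrite lee_fin exprn_ge0// cabs_ge0.
      - apply/measurable_EFinP; apply: measurable_cabs_sqr; apply: cmeasurableM => //.
        apply: cmeasurable_sum => j; apply: cmeasurableM => //.
        exact: mhw (cabs_unity _ _ _).
      - apply: measurable_funeM; apply: emeasurable_sum => j.
        by apply/measurable_EFinP.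
      - by move=> u ud; rewrite sumEFin -EFinM lee_fin; exact: root_avg_sqr_le.
    rewrite ge0_integralZl//; last 2 first.
    - by apply: emeasurable_sum => j; apply/measurable_EFinP.
    - by move=> u _; apply: sume_ge0 => j _; rewrite lee_fin exprn_ge0// cabs_ge0.
    rewrite ge0_integral_sum//; last 2 first.
    - by move=> j; apply/measurable_EFinP.
    - by move=> j u _; rewrite lee_fin exprn_ge0// cabs_ge0.
    apply: (@le_trans _ _ ((N%:R^-1)%:E * \sum_(j < N) (m^-1 * A)%:E)%E).
      apply: lee_wpmul2l; first by rewrite lee_fin invr_ge0.
      by apply: lee_sum => j _; exact: bound (cabs_unity _ _ _).
    rewrite sumEFin -EFinM lee_fin sumr_const card_ord -[(_ * A) *+ _]mulr_natl [leLHS]mulrA.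
    have A0 : 0 <= m^-1 * A.
      rewrite mulr_ge0 ?invr_ge0 ?(ltW m0)// -lee_fin; exact: le_trans (nsq_ge0 h) hA.
    case: N {mj} => [|N]; first by rewrite invr0 !mul0r.
    by rewrite mulVf// mul1r.
move: key; rewrite integral_cst// [X in (_ * X <= _)%E]VE -EFinM lee_fin invfM => key.
by rewrite [leRHS]mulrAC ler_pdivlMr.
Qed.

End pointwise_bound.

Lemma cintegrable_dom d (T : measurableType d) (R : realType) (mu : {measure set T -> \bar R})
    (D : set T) (f : T -> R[i]) (g : T -> R) : measurable D -> measurable_fun D f ->
  mu.-integrable D (EFin \o g) -> (forall x, D x -> cabs (f x) <= g x) -> cintegrable mu D f.
Proof.
move=> mD /measurable_Re_Im[m1 m2] gi fg; split; apply: (le_integrable mD _ _ gi).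
- by apply/measurable_EFinP.
- move=> x Dx /=; rewrite lee_fin; apply: le_trans (ler_norm _); apply: le_trans (fg x Dx).
  exact: normr_Re_le.
- by apply/measurable_EFinP.
- move=> x Dx /=; rewrite lee_fin; apply: le_trans (ler_norm _); apply: le_trans (fg x Dx).
  exact: normr_Im_le.
Qed.

(** * The weighted inner product *)

Section weighted_L2.
Variables (R : realType) (n : nat) (lambda : R).
Local Notation C := R[i].
Local Notation V := ('cV[R[i]]_n).
Local Notation v := (@lebesgue_Cn R n).
Local Notation B := (unit_ball (R := R) (n := n)).
Local Notation L2 := (square_integrable (R := R) (n := n) lambda).
Local Notation ip := (@inner_product R n lambda).
Local Notation w := (@weight R n lambda).
Implicit Types (f g h k : V -> C).

Let mB : measurable B. Proof. exact: measurable_unit_ball. Qed.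

Lemma L2P f : L2 f <-> measurable_fun B f /\
  v.-integrable B (EFin \o (fun z => cabs (f z) ^+ 2 * w z)).
Proof.
have E z : `|(cabs (f z) ^+ 2 * w z)%:E|%E = (cabs (f z) ^+ 2 * w z)%:E.
  by rewrite /= ger0_norm// mulr_ge0 ?exprn_ge0 ?cabs_ge0 ?weight_ge0.
split=> -[mf fi]; split => //.
  apply/integrableP; split; first by apply/measurable_EFinP; exact: measurable_nsq.
  by under eq_integral => z _ do rewrite /= -[`|_|%:E]/(`|_%:E|%E) E.
move: fi => /integrableP[_].
by under eq_integral => z _ do rewrite /= -[`|_|%:E]/(`|_%:E|%E) E.
Qed.

Lemma L2_nsq f : L2 f -> nsq lambda f = (fine (nsq lambda f))%:E.
Proof. by move=> [_ fi]; rewrite fineK// ge0_fin_numE ?nsq_ge0. Qed.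

Definition norm2 f : R := fine (nsq lambda f).

Lemma norm2_ge0 f : 0 <= norm2 f.
Proof. exact/fine_ge0/nsq_ge0. Qed.

Definition ipf f g z : C := f z * conjc (g z) * (w z)%:C.

Lemma cabs_ipf f g z : cabs (ipf f g z) = cabs (f z) * cabs (g z) * w z.
Proof. by rewrite /ipf !Normc.normcM cabsJ cabsE ger0_norm// weight_ge0. Qed.

Lemma cabs_ipf_le f g z :
  cabs (ipf f g z) <= cabs (f z) ^+ 2 * w z + cabs (g z) ^+ 2 * w z.
Proof.
rewrite cabs_ipf -mulrDl ler_wpM2r ?weight_ge0//.
move: (cabs_ge0 (f z)) (cabs_ge0 (g z)) => x0 y0.
have := sqr_ge0 (cabs (f z) - cabs (g z)); have := mulr_ge0 x0 y0.
by move: (cabs (f z)) (cabs (g z)) => x y; lra.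
Qed.

Lemma measurable_ipf f g (D : set V) : measurable_fun D f -> measurable_fun D g ->
  measurable_fun D (ipf f g).
Proof.
move=> mf mg; apply: cmeasurableM; last by apply: cmeasurable_real; exact: measurable_weight.
by apply: cmeasurableM => //; exact: cmeasurable_conj.
Qed.

Lemma ip_integrable f g : L2 f -> L2 g -> cintegrable v B (ipf f g).
Proof.
move=> /L2P[mf fi] /L2P[mg gi].
apply: (cintegrable_dom mB _ _ (fun z _ => cabs_ipf_le f g z)); first exact: measurable_ipf.
exact: (eq_integrable mB _ _ _ (integrableD mB fi gi)).
Qed.

Lemma ipE f g : ip f g = cint v B (ipf f g).
Proof.
by congr Complex; apply: eq_Rintegral => z _; rewrite /ipf ?ReM ?ImM /= !mulr0 ?subr0 ?add0r
  ?addr0// [in RHS]mulrC.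
Qed.

Lemma L2D f g : L2 f -> L2 g -> L2 (fun z => f z + g z).
Proof.
move=> /L2P[mf fi] /L2P[mg gi]; apply/L2P; have mfg := cmeasurableD mf mg; split => //.
have := integrableD mB (integrableZl mB 2 fi) (integrableZl mB 2 gi).
apply: le_integrable => //; first by apply/measurable_EFinP; exact: measurable_nsq.
move=> z _ /=; rewrite lee_fin [leLHS]ger0_norm; last first.
  by rewrite mulr_ge0 ?exprn_ge0 ?cabs_ge0 ?weight_ge0.
apply: le_trans (ler_norm _); have := weight_ge0 lambda z.
move: (w z) => W W0; rewrite !mulrA -mulrDl ler_wpM2r// -!mulrA -!expr2.
exact: cabs_sumsq.
Qed.

Lemma L2_bounded f (a : V -> C) (M : R) : measurable_fun B a ->
  (forall z, B z -> cabs (a z) <= M) -> L2 f -> L2 (fun z => a z * f z).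
Proof.
move=> ma aM /L2P[mf fi]; apply/L2P; have maf := cmeasurableM ma mf; split => //.
apply: (le_integrable mB _ _ (integrableZl mB (M ^+ 2) fi)).
  by apply/measurable_EFinP; exact: measurable_nsq.
move=> z /aM az /=; rewrite lee_fin [leLHS]ger0_norm; last first.
  by rewrite mulr_ge0 ?exprn_ge0 ?cabs_ge0 ?weight_ge0.
apply: le_trans (ler_norm _); rewrite [leRHS]mulrA ler_wpM2r ?weight_ge0//.
rewrite Normc.normcM exprMn ler_wpM2r ?exprn_ge0 ?cabs_ge0//.
by rewrite lerXn2r ?nnegrE ?cabs_ge0// (le_trans (cabs_ge0 _) az).
Qed.

Lemma L2Z (c : C) f : L2 f -> L2 (fun z => c * f z).
Proof. by apply: (L2_bounded (M := cabs c)) => //; exact: measurable_cst. Qed.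

Lemma L2B f g : L2 f -> L2 g -> L2 (fun z => f z - g z).
Proof.
move=> Lf /(L2Z (-1)) Lg; have := L2D Lf Lg.
by rewrite (_ : (fun z => f z + -1 * g z) = fun z => f z - g z)//; apply/funext => z; rewrite mulN1r.
Qed.

Lemma ipZl (c : C) f h : L2 f -> L2 h -> ip (fun z => c * f z) h = c * ip f h.
Proof.
move=> Lf Lh; rewrite !ipE -cintZ//; last exact: ip_integrable.
by apply: eq_cint => z _; rewrite /ipf !mulrA.
Qed.

Lemma ipBl f g h : L2 f -> L2 g -> L2 h -> ip (fun z => f z - g z) h = ip f h - ip g h.
Proof.
move=> Lf Lg Lh; rewrite !ipE -cintB//; [|exact: ip_integrable..].
by apply: eq_cint => z _; rewrite /ipf !mulrBl.
Qed.

Lemma conjcM (x y : C) : conjc (x * y) = conjc x * conjc y.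
Proof. by case: x y => [a b] [c d]; congr Complex; rewrite /=; ring. Qed.

Lemma ipJ f g : L2 f -> L2 g -> ip g f = conjc (ip f g).
Proof.
move=> Lf Lg; rewrite !ipE -cintJ//; last exact: ip_integrable.
by apply: eq_cint => z _; rewrite /ipf !conjcM conjcK conjc_real [g z * _]mulrC.
Qed.

Lemma ipZr (c : C) f h : L2 f -> L2 h -> ip f (fun z => c * h z) = conjc c * ip f h.
Proof.
move=> Lf Lh; rewrite ipJ//; last exact: L2Z.
by rewrite ipZl// conjcM -ipJ.
Qed.

Lemma ipBr f g h : L2 f -> L2 g -> L2 h -> ip h (fun z => f z - g z) = ip h f - ip h g.
Proof.
move=> Lf Lg Lh; rewrite (ipJ (L2B Lf Lg) Lh) ipBl// (ipJ Lf Lh) (ipJ Lg Lh).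
by case: (ip f h) (ip g h) => [a b] [c d]; congr Complex; rewrite /=; ring.
Qed.

Lemma ip_norm2 f : ip f f = (norm2 f)%:C.
Proof.
rewrite ipE; congr Complex; last first.
  rewrite -[RHS](_ : \int[v]_(z in B) (0 : R) = 0); last by rewrite Rintegral_cst// mul0r.
  by apply: eq_Rintegral => z _; rewrite /ipf cabs_conj ImM /= mulr0 mul0r addr0.
rewrite /norm2 /nsq /Rintegral; congr fine; apply: eq_integral => z _.
by rewrite /ipf cabs_conj ReM /= mulr0 subr0.
Qed.

Lemma norm2B f k (c : C) : L2 f -> L2 k -> norm2 (fun z => f z - c * k z) =
  norm2 f - 2 * complex.Re (conjc c * ip f k) + cabs c ^+ 2 * norm2 k.
Proof.
move=> Lf Lk; have Lck := L2Z c Lk.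
have := ip_norm2 (fun z => f z - c * k z).
rewrite ipBl ?ipBr ?ipZl ?ipZr//; try exact: L2B.
rewrite (ipJ Lf Lk) !ip_norm2.
move: (ip f k) (norm2 f) (norm2 k) => [x y] a b /(congr1 (@complex.Re R)) /= <-.
rewrite cabs_sqr; case: c {Lck} => p q /=; ring.
Qed.

Lemma parallelogram f g : L2 f -> L2 g ->
  norm2 (fun z => f z - g z) = 2 * norm2 f + 2 * norm2 g - norm2 (fun z => f z + g z).
Proof.
move=> Lf Lg; have h1 := norm2B 1 Lf Lg; have h2 := norm2B (-1) Lf Lg.
have -> : (fun z => f z - g z) = (fun z => f z - 1 * g z) by apply/funext => z; rewrite mul1r.
have -> : (fun z => f z + g z) = (fun z => f z - -1 * g z).
  by apply/funext => z; rewrite mulN1r opprK.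
rewrite h1 h2; case: (ip f g) => x y.
have n1 : cabs (-1 : C) ^+ 2 = 1 by rewrite cabs_sqr /=; ring.
rewrite n1 Normc.normc1 /=; ring.
Qed.

End weighted_L2.

(** * The Bergman projection *)

Section bergman_projection.
Variables (R : realType) (n : nat) (lambda : R).
Hypothesis c0 : 0 < wconst n lambda.
Local Notation C := R[i].
Local Notation V := ('cV[R[i]]_n).
Local Notation v := (@lebesgue_Cn R n).
Local Notation B := (unit_ball (R := R) (n := n)).
Local Notation L2 := (square_integrable (R := R) (n := n) lambda).
Local Notation berg := (bergman_space (R := R) (n := n) lambda).
Local Notation ip := (@inner_product R n lambda).
Local Notation norm2 := (norm2 lambda).
Implicit Types (f g h k : V -> C).

Lemma holE f : holomorphic f <-> hol f.
Proof.
split=> hf z zB; [exact/differentiable_hdiff/hf|exact/hdiff_differentiable/hf].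
Qed.

Lemma bergP f : berg f <-> hol f /\ L2 f.
Proof. by split => -[/holE]. Qed.

Lemma berg_L2 f : berg f -> L2 f.
Proof. by case. Qed.

Lemma holB (c : C) f k : hol f -> hol k -> hol (fun z => f z - c * k z).
Proof.
move=> hf hk z zB; have [L HL] := hf z zB; have [L' HL'] := hk z zB.
exists (fun i => L i - c * L' i) => e e0.
have c1 : 0 < 2 * (1 + cabs c) by rewrite mulr_gt0// ltr_wpDr// cabs_ge0.
have [d1 d10 H1] := HL _ (divr_gt0 e0 (@ltr0Sn R 1)).
have [d2 d20 H2] := HL' _ (divr_gt0 e0 c1).
exists (Num.min d1 d2) => [|u]; first by rewrite lt_min d10.
rewrite lt_min => /andP[/H1 h1 /H2 h2].
have -> : dform (fun i => L i - c * L' i) u = dform L u - c * dform L' u.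
  rewrite /dform mulr_sumr -sumrB; apply: eq_bigr => i _; ring.
rewrite (_ : _ - _ = (f (z + u) - f z - dform L u) - c * (k (z + u) - k z - dform L' u)); last ring.
apply: (le_trans (le_cabsB _ _)); rewrite Normc.normcM.
have lu := lnorm_ge0 u.
have h3 : cabs c * cabs (k (z + u) - k z - dform L' u) <= e / 2 * lnorm u.
  apply: (@le_trans _ _ ((1 + cabs c) * (e / (2 * (1 + cabs c)) * lnorm u))).
    by apply: ler_pM; rewrite ?cabs_ge0// lerDr.
  rewrite le_eqVlt; apply/orP; left; apply/eqP.
  by field; rewrite gt_eqF// ltr_wpDr// cabs_ge0.
by lra.
Qed.

Lemma cmeasurableB d (T : measurableType d) (D : set T) (f g : T -> C) :
  measurable_fun D f -> measurable_fun D g -> measurable_fun D (fun x => f x - g x).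
Proof.
move=> mf mg; have := cmeasurableD mf (cmeasurableM (@measurable_cst _ _ _ _ D (-1 : C)) mg).
by congr measurable_fun; apply/funext => x; rewrite /= mulN1r.
Qed.

Lemma hol0 : hol (fun _ : V => 0 : C).
Proof.
move=> z _; exists (fun=> 0) => e e0; exists 1 => // u _.
rewrite /dform; under eq_bigr do rewrite mul0r.
by rewrite sumr_const mul0rn !subr0 Normc.normc0 mulr_ge0 ?lnorm_ge0 ?ltW.
Qed.

Lemma L2_0 : L2 (fun=> 0).
Proof.
split; first exact: measurable_cst.
under eq_integral do rewrite Normc.normc0 expr0n mul0r.
by rewrite integral0.
Qed.

Lemma berg0 : berg (fun=> 0).
Proof. by apply/bergP; split; [exact: hol0|exact: L2_0]. Qed.

Lemma bergB (c : C) f k : berg f -> berg k -> berg (fun z => f z - c * k z).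
Proof.
move=> /bergP[hf Lf] /bergP[hk Lk]; apply/bergP; split; first exact: holB.
by apply: L2B => //; exact: L2Z.
Qed.

Lemma berg_bound (r : R) : 0 <= r < 1 -> exists2 K : R, 0 <= K &
  forall h, berg h -> forall z, sqnorm z <= r -> cabs (h z) ^+ 2 <= K * norm2 h.
Proof.
move=> /(hol_pointwise_bound c0)[K K0 HK]; exists K => // h /bergP[hh Lh] z zr.
by apply: HK zr => //; [case: Lh|rewrite (L2_nsq Lh)].
Qed.

Lemma norm2_eq0 h : berg h -> norm2 h = 0 -> forall z, B z -> h z = 0.
Proof.
move=> bh h0 z zB; have zr : 0 <= sqnorm z < 1 by rewrite sqnorm_ge0.
have [K K0 HK] := berg_bound zr; have := HK h bh z (lexx _).
rewrite h0 mulr0 => H; apply/eqP; rewrite -[_ == _]negbK -cabs_gt0 -leNgt.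
by rewrite -(@ler_pXn2r _ 2) ?nnegrE ?cabs_ge0// expr0n.
Qed.

Lemma cmeasurable_cvg (F : nat -> V -> C) f : (forall N, measurable_fun B (F N)) ->
  (forall z, B z -> ccvg (F^~ z) (f z)) -> measurable_fun B f.
Proof.
move=> mF Ff; apply: measurable_complex.
  apply: (measurable_fun_cvg (fun N => (measurable_Re_Im (mF N)).1)) => z /Ff.
  by move=> /ccvg_ReIm[].
apply: (measurable_fun_cvg (fun N => (measurable_Re_Im (mF N)).2)) => z /Ff.
by move=> /ccvg_ReIm[].
Qed.

(* The Bergman space is closed: by the pointwise bound, a Cauchy sequence converges locally
   uniformly. *)
Lemma bergman_complete (F : nat -> V -> C) (A : R) (del : nat -> R) :
  (forall N, berg (F N)) -> (forall N, norm2 (F N) <= A) ->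
  (forall e : R, 0 < e -> exists N0, forall N, (N0 <= N)%N -> del N <= e) ->
  (forall N M, norm2 (fun z => F N z - F M z) <= del N + del M) ->
  exists2 f : V -> C, hol f /\ measurable_fun B f & forall z, B z -> ccvg (F^~ z) (f z).
Proof.
move=> bF nF del0 cF.
have cv z : exists l, B z -> ccvg (F^~ z) l.
  have [zB|zB] := pselect (B z); last by exists 0 => /zB.
  have zr : 0 <= sqnorm z < 1 by rewrite sqnorm_ge0.
  have [K K0 HK] := berg_bound zr.
  suff [l Hl] : exists l, ccvg (F^~ z) l by exists l.
  apply: ccvg_cauchy => e e0; have k1 : 0 < 2 * (1 + K) by rewrite mulr_gt0// ltr_wpDr.
  have [N0 HN] := del0 _ (divr_gt0 (exprn_gt0 2 e0) k1).
  exists N0 => N M /HN dN /HN dM.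
  rewrite -(@ler_pXn2r _ 2) ?nnegrE ?cabs_ge0 ?(ltW e0)//.
  have bNM : berg (fun z => F N z - F M z).
    have := bergB 1 (bF N) (bF M); congr berg.
    by apply/funext => y; rewrite mul1r.
  apply: (le_trans (HK _ bNM z (lexx _))).
  apply: (@le_trans _ _ ((1 + K) * (del N + del M))).
    by apply: ler_pM => //; [exact: norm2_ge0|rewrite lerDr].
  rewrite mulrC -ler_pdivlMr; last by rewrite ltr_wpDr.
  have -> : e ^+ 2 / (1 + K) = e ^+ 2 / (2 * (1 + K)) + e ^+ 2 / (2 * (1 + K)).
    by field; rewrite gt_eqF// ltr_wpDr.
  exact: lerD.
have [f Hf] := choice cv; exists f; last exact: Hf.
split; last by apply: cmeasurable_cvg Hf => N; case: (bF N) => _ [].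
apply: (hol_limit _ _ Hf) => [N|r r01]; first by case/bergP: (bF N).
have [K K0 HK] := berg_bound r01; exists (1 + K * A) => N z zr.
have h1 : cabs (F N z) ^+ 2 <= K * A.
  by apply: (le_trans (HK _ (bF N) z zr)); rewrite ler_wpM2l.
have := sqr_ge0 (cabs (F N z) - 1); have := cabs_ge0 (F N z).
by move: (cabs _) h1 => x; nra.
Qed.

Lemma nsq_limit g (F : nat -> V -> C) f (M : R) : measurable_fun B g ->
  (forall N, measurable_fun B (F N)) -> (forall z, B z -> ccvg (F^~ z) (f z)) ->
  (forall N, nsq lambda (fun z => (g z - F N z)%R) <= M%:E)%E ->
  (nsq lambda (fun z => (g z - f z)%R) <= M%:E)%E.
Proof.
move=> mg mF Ff HM.
apply: (@fatou_le _ _ _ v B (fun N z => cabs (g z - F N z) ^+ 2 * weight lambda z)) => //.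
- exact: measurable_unit_ball.
- by move=> N; apply: measurable_nsq; apply: cmeasurableB.
- by move=> N z _; rewrite mulr_ge0 ?exprn_ge0 ?cabs_ge0 ?weight_ge0.
- move=> z zB; apply: cvgM; last exact: cvg_cst.
  by apply: ccvg_cabs_sqr; apply: ccvgB; [exact: ccvg_cst|exact: Ff].
Qed.

(** A minimizing sequence for the distance is Cauchy by the parallelogram law, [bergman_complete]
    gives a pointwise limit, and Fatou's lemma shows that the limit attains the distance. Varying
    the minimizer along [k] yields orthogonality. *)
Lemma projection_exists g : L2 g ->
  exists2 h, berg h & forall k, berg k -> ip (fun z => g z - h z) k = 0.
Proof.
move=> Lg.
pose S := [set x | exists2 h, berg h & x = norm2 (fun z => g z - h z)].
have S0 : has_inf S.
  split; first by exists (norm2 (fun z => g z - 0)); exists (fun=> 0) => //; exact: berg0.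
  by exists 0 => _ [h _ ->]; exact: norm2_ge0.
pose d := inf S.
have dle h : berg h -> d <= norm2 (fun z => g z - h z).
  by move=> bh; apply: ge_inf; [case: S0|exists h].
have seqN (N : nat) : exists h, berg h /\ norm2 (fun z => g z - h z) <= d + N.+1%:R^-1.
  have N0 : 0 < N.+1%:R^-1 :> R by rewrite invr_gt0.
  have [_ [h bh ->] /ltW hd] := inf_adherent N0 S0.
  by exists h.
have [F HF] := choice seqN.
have bF N : berg (F N) := (HF N).1.
have LF N : L2 (F N) := berg_L2 (bF N).
have LgF N : L2 (fun z => g z - F N z) by exact: L2B.
(* From the parallelogram law: twice both squared distances, minus [4 d] for the midpoint, leaves
   these two terms. *)
pose del (N : nat) : R := 2 * N.+1%:R^-1.
have inv0 (e : R) : 0 < e -> exists N0 : nat, forall N, (N0 <= N)%N -> N.+1%:R^-1 <= e.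
  move=> e0; have [N0 _ HN] := near_infty_natSinv_lt (PosNum e0).
  by exists N0 => N hN; exact/ltW/HN.
have delB N M : norm2 (fun z => F N z - F M z) <= del N + del M.
  have E1 : (fun z => F N z - F M z) = (fun z => (g z - F M z) - (g z - F N z)).
    by apply/funext => z; ring.
  rewrite E1 parallelogram//.
  have E2 : (fun z => (g z - F M z) + (g z - F N z)) =
      (fun z => 2 * (g z - 2^-1 * (F N z - -1 * F M z))).
    apply/funext => z; rewrite [RHS]mulrBr mulrA divff// mul1r; ring.
  have bm : berg (fun z => 0 - - 2^-1 * (F N z - -1 * F M z)).
    by apply: bergB; [exact: berg0|exact: bergB].
  have E3 : (fun z => 0 - - 2^-1 * (F N z - -1 * F M z)) = (fun z => 2^-1 * (F N z - -1 * F M z)).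
    by apply/funext => z; ring.
  rewrite E3 in bm; have dm := dle _ bm.
  have Lm : L2 (fun z => g z - 2^-1 * (F N z - -1 * F M z)) by apply: L2B => //; exact: berg_L2.
  have : norm2 (fun z => 2 * (g z - 2^-1 * (F N z - -1 * F M z))) =
      4 * norm2 (fun z => g z - 2^-1 * (F N z - -1 * F M z)).
    have := ip_norm2 lambda (fun z => 2 * (g z - 2^-1 * (F N z - -1 * F M z))).
    rewrite ipZl ?ipZr//; last exact: L2Z.
    rewrite ip_norm2 => /(congr1 (@complex.Re R)) /= <-.
    by move: (norm2 _) => x; ring.
  rewrite E2 => ->; move: (HF N).2 (HF M).2 dm; rewrite /del /=.
  move: (N.+1%:R^-1) (M.+1%:R^-1) (norm2 _) (norm2 _) (norm2 _) => x y a b c.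
  by clear; lra.
have norm2_sub h k : L2 h -> L2 k -> norm2 (fun z => h z - k z) <= 2 * norm2 h + 2 * norm2 k.
  by move=> Lh Lk; rewrite parallelogram// gerBl norm2_ge0.
have normF N : norm2 (F N) <= 2 * norm2 g + 2 * (d + 1).
  have -> : F N = (fun z => g z - (g z - F N z)) by apply/funext => z; ring.
  apply: (le_trans (norm2_sub _ _ Lg (LgF N))); rewrite lerD2l ler_wpM2l//.
  by apply: (le_trans (HF N).2); rewrite lerD2l invf_le1// ler1n.
have del0 (e : R) : 0 < e -> exists N0 : nat, forall N, (N0 <= N)%N -> del N <= e.
  move=> e0; have [N0 HN] := inv0 _ (divr_gt0 e0 (@ltr0Sn R 1)).
  by exists N0 => N /HN; rewrite /del ler_pdivlMr// mulrC.
have [h [hh mh] Fh] := bergman_complete bF normF del0 delB.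
have gh : (nsq lambda (fun z => (g z - h z)%R) <= d%:E)%E.
  apply/lee_addgt0Pr => e /inv0[N0 HN].
  (* The shift by [N0] makes the bound [d + e] hold for every term of the sequence. *)
  rewrite -EFinD; apply: (nsq_limit (F := fun N => F (N0 + N)%N)) => [|N|z /Fh|N].
  - by case: Lg.
  - by case: (LF (N0 + N)%N).
  - move=> H e' /H[N1 HN1]; exists N1 => N hN; apply: HN1; exact: leq_trans hN (leq_addl _ _).
  - rewrite (L2_nsq (LgF _)) lee_fin; apply: (le_trans (HF _).2).
    by rewrite lerD2l HN// leq_addr.
have Lgh : L2 (fun z => g z - h z).
  split; first by apply: cmeasurableB => //; case: Lg.
  exact: le_lt_trans gh (ltry _).
have Lh : L2 h.
  have -> : h = (fun z => g z - (g z - h z)) by apply/funext => z; ring.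
  exact: L2B.
have bh : berg h by apply/bergP.
have ghd : norm2 (fun z => g z - h z) <= d by move: gh; rewrite (L2_nsq Lgh) lee_fin.
exists h => // k bk; have Lk := berg_L2 bk.
set c := ip _ k.
(* Comparison of [h] with [h + eps c k] gives [2 eps |c|^2 <= eps^2 |c|^2 norm2 k]; with this [eps]
   the product [eps * norm2 k] is below 1, which forces [c = 0]. *)
have [eps e0 ek] : exists2 eps : R, 0 < eps & eps * (1 + norm2 k) = 1.
  have k0 : 0 < 1 + norm2 k by rewrite ltr_wpDr// norm2_ge0.
  by exists (1 + norm2 k)^-1; rewrite ?invr_gt0// mulVf// gt_eqF.
have := dle _ (bergB (- (eps%:C * c)) bh bk).
have -> : (fun z => g z - (h z - - (eps%:C * c) * k z)) =
    (fun z => (g z - h z) - (eps%:C * c) * k z) by apply/funext => z; ring.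
rewrite norm2B// -/c Normc.normcM exprMn cabsE real_normK ?num_real//.
rewrite conjcM conjc_real -mulrA [conjc c * c]mulrC cabs_conj -rmorphM /=.
move=> H; have {}H : 2 * (eps * cabs c ^+ 2) <= eps ^+ 2 * cabs c ^+ 2 * norm2 k by lra.
have h1 : eps ^+ 2 * cabs c ^+ 2 * norm2 k = eps * cabs c ^+ 2 * (1 - eps).
  have <- : eps * norm2 k = 1 - eps by move: ek; rewrite mulrDr mulr1; lra.
  by ring.
have cc : 0 <= eps * cabs c ^+ 2 by rewrite mulr_ge0 ?exprn_ge0 ?cabs_ge0 ?ltW.
have cc2 : 0 <= eps * cabs c ^+ 2 * eps by apply: mulr_ge0; rewrite ?(ltW e0).
have {}H : eps * cabs c ^+ 2 <= 0.
  by move: H cc cc2; rewrite h1 mulrBr mulr1; clear; lra.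
apply/eqP; rewrite -[_ == _]negbK -cabs_gt0 -leNgt.
by move: H; rewrite pmulr_rle0// exprn_even_le0//= => /eqP ->.
Qed.

Lemma bergman_projectionP g : L2 g -> berg (bergman_projection lambda g) /\
  forall k, berg k -> ip (bergman_projection lambda g) k = ip g k.
Proof.
move=> Lg; have [h bh Hh] := projection_exists Lg.
pose P : set (V -> C) := [set h | berg h /\ forall k, berg k -> ip (fun z => g z - h z) k = 0].
have [bP HP] : P (bergman_projection lambda g).
  by apply: (@xgetPex _ (fun=> 0) P); exists h.
split => // k bk; apply/esym/eqP; rewrite -subr_eq0 -ipBl//; try exact: berg_L2.
by rewrite HP.
Qed.

End bergman_projection.

(** * Completeness of the monomials *)

Section monomials.
Variables (R : realType) (n : nat).
Local Notation C := R[i].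
Local Notation V := ('cV[R[i]]_n).
Local Notation B := (unit_ball (R := R) (n := n)).
Implicit Types (f g : V -> C) (z : V) (al : 'I_n -> nat) (p q : 'I_n).

Definition mono al z : C := \prod_(i < n) z i ord0 ^+ al i.

Definition phase p (t : C) z : V := upd p (t * z p ord0) z.

Lemma phaseE p t z i : phase p t z i ord0 = if i == p then t * z i ord0 else z i ord0.
Proof. by rewrite updE; case: eqP => [->|]. Qed.

Lemma phase_comp p s t z : phase p s (phase p t z) = phase p (s * t) z.
Proof.
by apply/matrixP => i j; rewrite ord1 !phaseE; case: eqP => // _; rewrite mulrA.
Qed.

Lemma phaseC p q s t z : phase p s (phase q t z) = phase q t (phase p s z).
Proof.
by apply/matrixP => i j; rewrite ord1 !phaseE; do 2 case: eqP => // _; rewrite mulrCA.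
Qed.

Lemma phase1 p z : phase p 1 z = z.
Proof. by apply/matrixP => i j; rewrite ord1 phaseE mul1r; case: eqP. Qed.

Lemma mono_phase al p t z : mono al (phase p t z) = t ^+ al p * mono al z.
Proof.
rewrite /mono (bigD1 p)//= [in RHS](bigD1 p)//= phaseE eqxx exprMn -mulrA.
by congr (_ * (_ * _)); apply: eq_bigr => i /negbTE ip; rewrite phaseE ip.
Qed.

Lemma sqnorm_phase p t z : sqnorm (phase p t z) =
  sqnorm z + (cabs t ^+ 2 - 1) * cabs (z p ord0) ^+ 2.
Proof.
rewrite !sqnormE (bigD1 p)//= [in RHS](bigD1 p)//= phaseE eqxx Normc.normcM exprMn.
rewrite (eq_bigr (fun i => cabs (z i ord0) ^+ 2)); first ring.
by move=> i /negbTE ip; rewrite phaseE ip.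
Qed.

Lemma sqnorm_phase1 p t z : cabs t = 1 -> sqnorm (phase p t z) = sqnorm z.
Proof. by move=> t1; rewrite sqnorm_phase t1 expr1n subrr mul0r addr0. Qed.

Lemma sqnorm_phase_le p t z : cabs t <= 1 -> sqnorm (phase p t z) <= sqnorm z.
Proof.
move=> t1; rewrite sqnorm_phase gerDl mulr_le0_ge0 ?exprn_ge0 ?cabs_ge0//.
by rewrite subr_le0 exprn_ile1// cabs_ge0.
Qed.

Lemma unit_ball_phase p t z : cabs t <= 1 -> B z -> B (phase p t z).
Proof. by move=> t1; apply: le_lt_trans; exact: sqnorm_phase_le. Qed.

Lemma cabs_coord_le1 z i : B z -> cabs (z i ord0) <= 1.
Proof.
move=> zB; rewrite -(@ler_pXn2r _ 2) ?nnegrE ?cabs_ge0// expr1n.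
by apply: (le_trans (cabs_le_sqnorm z i)); exact: ltW.
Qed.

Lemma cabs_mono_le1 al z : B z -> cabs (mono al z) <= 1.
Proof.
move=> zB; rewrite /mono; elim/big_ind: _ => [|x y x1 y1|i _].
- by rewrite Normc.normc1.
- by rewrite Normc.normcM mulr_ile1// cabs_ge0.
- by rewrite cabsX exprn_ile1 ?cabs_ge0 ?cabs_coord_le1.
Qed.

Lemma measurable_mono al (D : set V) : measurable_fun D (mono al).
Proof.
apply: measurable_funTS; apply: cmeasurable_prod => i; apply: cmeasurableX.
exact: measurable_entry.
Qed.

Lemma hdiffM f g z : hdiff f z -> hdiff g z -> hdiff (fun z => f z * g z) z.
Proof.
move=> /hdiff_differentiable hf /hdiff_differentiable hg; apply: differentiable_hdiff.
exact: differentiableM.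
Qed.

Lemma hol_mono al : hol (mono al).
Proof.
move=> z _; rewrite /mono; elim: (index_enum 'I_n) => [|i s IH].
  rewrite [X in hdiff X](_ : _ = fun=> 1); last by apply/funext => y; rewrite big_nil.
  by apply: differentiable_hdiff; exact: differentiable_cst.
rewrite [X in hdiff X](_ : _ = fun y : V => y i ord0 ^+ al i * \prod_(j <- s) y j ord0 ^+ al j).
  apply: hdiffM IH; elim: (al i) => [|k IH].
    rewrite [X in hdiff X](_ : _ = fun=> 1); last by apply/funext => y; rewrite expr0.
    by apply: differentiable_hdiff; exact: differentiable_cst.
  rewrite [X in hdiff X](_ : _ = fun y : V => y i ord0 * y i ord0 ^+ k).
    apply: hdiffM IH; exists (fun j => (j == i)%:R) => e e0; exists 1 => // u _.
    rewrite mxE [z i ord0 + _]addrC addrK /dform (bigD1 i)//= eqxx mul1r big1 ?addr0 ?subrr.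
      by rewrite Normc.normc0 mulr_ge0 ?lnorm_ge0// ltW.
    by move=> j /negbTE ->; rewrite mul0r.
  by apply/funext => y; rewrite exprS.
by apply/funext => y; rewrite big_cons.
Qed.

Lemma hol_phase p t g : cabs t = 1 -> hol g -> hol (fun z => g (phase p t z)).
Proof.
move=> t1 hg z zB; have zB' : B (phase p t z) by apply: unit_ball_phase => //; rewrite t1.
have [L HL] := hg _ zB'; exists (fun i => if i == p then t * L i else L i) => e /HL[d d0 {}HL].
have E u : lnorm (phase p t u) = lnorm u.
  by apply: eq_bigr => i _; rewrite phaseE; case: eqP => // _; rewrite Normc.normcM t1 mul1r.
exists d => // u; rewrite -E => /HL.
have -> : phase p t z + phase p t u = phase p t (z + u).
  apply/matrixP => i j; rewrite ord1 mxE !phaseE mxE.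
  by case: eqP => // _; rewrite mulrDr.
congr (cabs (_ - _) <= _); apply: eq_bigr => i _; rewrite phaseE.
by case: eqP => // _; rewrite mulrCA mulrA.
Qed.

Lemma hol_lincomb (I : Type) (s : seq I) (c : I -> C) (F : I -> V -> C) :
  (forall i, hol (F i)) -> hol (fun z => \sum_(i <- s) c i * F i z).
Proof.
move=> hF; elim: s => [|i s IH].
  rewrite (_ : (fun z => _) = fun=> 0); first exact: hol0.
  by apply/funext => z; rewrite big_nil.
rewrite (_ : (fun z => _) = fun z => \sum_(i <- s) c i * F i z - (- c i) * F i z).
  exact: holB.
by apply/funext => z; rewrite big_cons mulNr opprK addrC.
Qed.

(** A class that contains the Bergman space and is stable under [coord_component]. *)
Definition locally_bounded_hol g := [/\ hol g, measurable_fun B g &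
  forall r : R, 0 <= r < 1 -> exists M : R, forall z, sqnorm z <= r -> cabs (g z) <= M].

(** The whole closed disc is allowed for [t], as [homog_mono] scales by numbers that are not of
    modulus 1. *)
Definition homog p (d : nat) g := forall z t, B z -> cabs t <= 1 ->
  g (phase p t z) = t ^+ d * g z.

Lemma hol_phase_cder g p z : hol g -> B z -> exists2 rho : R, 1 < rho &
  forall t, cabs t < rho -> cder (fun t => g (phase p t z)) t.
Proof.
move=> hg zB; have [rho rho1 rhoz] := sqr_dilation_lt (sqnorm_ge0 z) zB.
exists rho => // t tr.
pose z0 := phase p 0 z; pose u : V := z p ord0 *: delta_mx p ord0.
have E s : phase p s z = z0 + s *: u.
  apply/matrixP => i j; rewrite ord1 phaseE !mxE andbT mul0r.
  by case: eqP => [->|_]; rewrite ?mulr1 ?add0r// !mulr0 addr0.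
rewrite (_ : (fun t => _) = fun t => g (z0 + t *: u)); last by apply/funext => s; rewrite E.
apply: slice_cder; apply: hg; rewrite -E.
rewrite /unit_ball /= sqnorm_phase; have [t1|t1] := leP (cabs t) 1.
  apply: le_lt_trans zB; rewrite gerDl mulr_le0_ge0 ?exprn_ge0 ?cabs_ge0//.
  by rewrite subr_le0 exprn_ile1// cabs_ge0.
apply: le_lt_trans rhoz; apply: (@le_trans _ _ (cabs t ^+ 2 * sqnorm z)); last first.
  by rewrite ler_wpM2r ?sqnorm_ge0// lerXn2r// ?nnegrE ?cabs_ge0 ?(ltW tr)//; lra.
have h1 : 0 <= cabs t ^+ 2 - 1 by rewrite subr_ge0 exprn_ege1// ltW.
have := ler_wpM2l h1 (cabs_le_sqnorm z p); lra.
Qed.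

(** [g'] is the Taylor term of degree [d] in the coordinate [p]. As a limit of averages of rotated
    copies of [g] it inherits local bounds, measurability, holomorphy and the homogeneity in the
    other coordinates. *)
Lemma coord_component p d g : locally_bounded_hol g -> exists g', [/\ locally_bounded_hol g',
  forall z, B z -> ccvg (fun N => root_avg N d (fun t => g (phase p t z))) (g' z),
  homog p d g' & forall q e, q != p -> homog q e g -> homog q e g'].
Proof.
move=> [hg mg bg].
(* The limit is recorded for every [w] in the disc: [w = 1] defines the component, the other values
   give its homogeneity by uniqueness of limits. *)
have cv z : exists l, B z -> forall w, cabs w <= 1 ->
    ccvg (fun N => root_avg N d (fun t => g (phase p (t * w) z))) (l * w ^+ d).
  have [zB|zB] := pselect (B z); last by exists 0 => /zB.
  have [rho rho1 dphi] := hol_phase_cder p hg zB.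
  exists (taylor_coef (fun t => g (phase p t z)) rho d) => _ w w1.
  exact: (root_avg_cvg rho1 dphi d w1).
have [g' Hg'] := choice cv; exists g'.
have c1 z : B z -> ccvg (fun N => root_avg N d (fun t => g (phase p t z))) (g' z).
  move=> zB; have := Hg' z zB 1; rewrite Normc.normc1 expr1n mulr1 => /(_ (lexx _)).
  by apply: eq_ccvg => N; apply: eq_root_avg => t _; rewrite mulr1.
have FM r : 0 <= r < 1 -> exists M : R, forall N z, sqnorm z <= r ->
    cabs (root_avg N d (fun t => g (phase p t z))) <= M.
  move=> r01; have [M HM] := bg r r01; exists M => N z zr.
  apply: root_avg_le => [|j]; last by rewrite HM// sqnorm_phase1// cabs_unity.
  exact: le_trans (cabs_ge0 _) (HM z zr).
have measF N : measurable_fun B (fun z => root_avg N d (fun t => g (phase p t z))).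
  apply: cmeasurableM => //; apply: cmeasurable_sum => j; apply: cmeasurableM => //.
  apply: (measurable_subst (E := B)) mg _; first exact: measurable_unit_ball.
    by move=> z; apply: unit_ball_phase; rewrite cabs_unity.
  by apply: measurable_funTS; exact: (scales_Cn_phase p (cabs_unity R N j)).1.
split => //.
- split.
  + apply: (hol_limit _ FM c1) => N z zB.
    rewrite [X in hdiff X](_ : _ = fun z => \sum_(j < N)
      (N%:R^-1 * conjc (unity R N j) ^+ d) * g (phase p (unity R N j) z)).
      by apply: hol_lincomb zB => j; apply: hol_phase => //; exact: cabs_unity.
    by apply/funext => y; rewrite /root_avg mulr_sumr; apply: eq_bigr => j _; rewrite mulrA.
  + exact: cmeasurable_cvg measF c1.
  + move=> r r01; have [M HM] := FM r r01; exists M => z zr.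
    have zB : B z by apply: le_lt_trans zr (proj2 (andP r01)).
    by apply: (ccvg_le (c1 z zB)) => N; exact: HM.
- move=> z w zB w1; rewrite mulrC; apply: (ccvg_uniq (c1 _ (unit_ball_phase p w1 zB))).
  by have := Hg' z zB w w1; apply: eq_ccvg => N; apply: eq_root_avg => t _; rewrite phase_comp.
- move=> q e qp hq z w zB w1; apply: (ccvg_uniq (c1 _ (unit_ball_phase q w1 zB))).
  apply: eq_ccvg (ccvgZ (w ^+ e) (c1 z zB)) => N.
  rewrite -[RHS](@eq_root_avg R N d (fun t => w ^+ e * g (phase p t z))).
    by rewrite /root_avg mulrCA mulr_sumr; congr (_ * _); apply: eq_bigr => j _; rewrite mulrCA.
  by move=> t t1; rewrite (phaseC p q) hq//; apply: unit_ball_phase => //; rewrite t1.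
Qed.

(** The averages converge to the Taylor coefficients of [t |-> g (phase p t z)], which therefore
    vanish; its value at [t = 1] is [g z]. *)
Lemma coord_component_eq0 p g : locally_bounded_hol g ->
  (forall d z, B z -> ccvg (fun N => root_avg N d (fun t => g (phase p t z))) 0) ->
  forall z, B z -> g z = 0.
Proof.
move=> [hg _ _] H z zB; have [rho rho1 dphi] := hol_phase_cder p hg zB.
have w1 : cabs (1 : C) < rho by rewrite Normc.normc1.
have := taylor_cvg dphi w1; rewrite phase1.
have E (d : nat) : taylor_coef (fun t => g (phase p t z)) rho d = 0.
  have := @root_avg_cvg _ _ _ rho1 dphi d 1.
  rewrite Normc.normc1 expr1n mulr1 => /(_ (lexx _)).
  move=> h; apply: ccvg_uniq (H d z zB); apply: eq_ccvg h => N.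
  by apply: eq_root_avg => t _; rewrite mulr1.
move=> h; apply: (ccvg_uniq h); apply: eq_ccvg (ccvg_cst 0) => K.
by rewrite big1// => k _; rewrite E mul0r.
Qed.

End monomials.

Lemma Rintegral_cvg d (T : measurableType d) (R : realType) (mu : {measure set T -> \bar R})
    (D : set T) (F : nat -> T -> R) (f G : T -> R) : measurable D ->
  (forall N, measurable_fun D (F N)) -> (forall x, D x -> F^~ x @ \oo --> f x) ->
  mu.-integrable D (EFin \o G) -> (forall N x, D x -> `|F N x| <= G x) ->
  (fun N => \int[mu]_(x in D) F N x) @ \oo --> \int[mu]_(x in D) f x.
Proof.
move=> mD mF Ff iG FG.
have mf : measurable_fun D f by exact: measurable_fun_cvg mF Ff.
have m1 N : measurable_fun D (fun x => (F N x)%:E) by apply/measurable_EFinP.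
have m2 : measurable_fun D (EFin \o f) by apply/measurable_EFinP.
have a1 : {ae mu, forall x, D x -> (fun N => (F N x)%:E) @ \oo --> (EFin \o f) x}.
  by apply: aeW => x Dx; apply: cvg_EFin; [exact: nearW|exact: Ff].
have a2 : {ae mu, forall x N, D x -> (`|(F N x)%:E| <= (EFin \o G) x)%E}.
  by apply: aeW => x N Dx /=; rewrite lee_fin FG.
have [fi _ H] := dominated_convergence mD m1 m2 a1 iG a2.
apply: (@fine_cvg _ _ _ _ (fun N => \int[mu]_(x in D) (F N x)%:E)%E).
by rewrite /Rintegral fineK//; exact: (integrable_fin_num mD fi).
Qed.

Lemma cint_ccvg d (T : measurableType d) (R : realType) (mu : {measure set T -> \bar R})
    (D : set T) (F : nat -> T -> R[i]) (f : T -> R[i]) (G : T -> R) : measurable D ->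
  (forall N, measurable_fun D (F N)) -> (forall x, D x -> ccvg (F^~ x) (f x)) ->
  mu.-integrable D (EFin \o G) -> (forall N x, D x -> cabs (F N x) <= G x) ->
  ccvg (fun N => cint mu D (F N)) (cint mu D f).
Proof.
move=> mD mF Ff iG FG; apply/ccvg_ReIm; split => /=.
  apply: (Rintegral_cvg mD _ _ iG) => [N|x /Ff/ccvg_ReIm[]//|N x Dx].
    exact: (measurable_Re_Im (mF N)).1.
  exact: le_trans (normr_Re_le _) (FG N x Dx).
apply: (Rintegral_cvg mD _ _ iG) => [N|x /Ff/ccvg_ReIm[]//|N x Dx].
  exact: (measurable_Re_Im (mF N)).2.
exact: le_trans (normr_Im_le _) (FG N x Dx).
Qed.

(** * Inner products with monomials *)

Section truncation.
Variables (R : realType) (n : nat) (lambda : R).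
Hypothesis lambda_gtN1 : -1 < lambda.
Local Notation C := R[i].
Local Notation V := ('cV[R[i]]_n).
Local Notation v := (@lebesgue_Cn R n).
Local Notation B := (unit_ball (R := R) (n := n)).
Local Notation L2 := (square_integrable (R := R) (n := n) lambda).
Local Notation berg := (bergman_space (R := R) (n := n) lambda).
Local Notation ip := (@inner_product R n lambda).
Local Notation w := (@weight R n lambda).
Implicit Types (f g h k : V -> C) (r : R).

Let mB : measurable B. Proof. exact: measurable_unit_ball. Qed.

Lemma L2_1 : L2 (fun=> 1).
Proof.
split; first exact: measurable_cst.
under eq_integral => z _ do rewrite Normc.normc1 expr1n mul1r weightE EFinM.
rewrite ge0_integralZl//.
- rewrite lte_mul_pinfty ?lee_fin ?wconst_ge0//; exact: radial_powR_lty.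
- by apply/measurable_EFinP; apply: measurable_funTS; exact: measurable_radial_powR.
- by move=> z _; rewrite lee_fin powR_ge0.
- by rewrite lee_fin wconst_ge0.
Qed.

Lemma L2_bound f (M : R) : measurable_fun B f -> (forall z, B z -> cabs (f z) <= M) -> L2 f.
Proof.
move=> mf fM; have := L2_bounded mf fM L2_1.
by congr L2; apply/funext => z; rewrite mulr1.
Qed.

Lemma L2_mono al : L2 (mono al).
Proof.
by apply: (L2_bound (M := 1)); [exact: measurable_mono|exact: cabs_mono_le1].
Qed.

Lemma berg_mono al : berg (mono al).
Proof. by apply/bergP; split; [exact: hol_mono|exact: L2_mono]. Qed.

Lemma eq_ip f f' k k' : (forall z, B z -> f z = f' z) -> (forall z, B z -> k z = k' z) ->
  ip f k = ip f' k'.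
Proof.
move=> ff kk; rewrite !ipE; apply: eq_cint => z; rewrite inE => zB.
by rewrite /ipf ff// kk.
Qed.

Lemma ip_scales (phi : V -> V) f k : scales v 1 phi -> (forall z, sqnorm (phi z) = sqnorm z) ->
  L2 f -> L2 k -> ip (fun z => f (phi z)) (fun z => k (phi z)) = ip f k.
Proof.
move=> sphi phiE Lf Lk; rewrite !ipE.
have phiB : phi @^-1` B = B by apply/seteqP; split => z; rewrite /unit_ball /= phiE.
rewrite -(cint_scales mB sphi phiB (ip_integrable Lf Lk)).
by apply: eq_cint => z _; rewrite /ipf /weight phiE.
Qed.

Lemma L2_scales (phi : V -> V) f : scales v 1 phi -> (forall z, sqnorm (phi z) = sqnorm z) ->
  L2 f -> L2 (fun z => f (phi z)).
Proof.
move=> sphi phiE [mf fi].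
have phiB : phi @^-1` B = B by apply/seteqP; split => z; rewrite /unit_ball /= phiE.
split; first exact: (measurable_fun_scales mB sphi phiB mf).
apply: le_lt_trans fi; rewrite -[leRHS](ge0_integral_scales mB sphi phiB).
- rewrite le_eqVlt; apply/orP; left; apply/eqP.
  by apply: eq_integral => z _; rewrite /weight phiE.
- by apply/measurable_EFinP; exact: measurable_nsq.
- by move=> z _; rewrite lee_fin mulr_ge0 ?exprn_ge0 ?cabs_ge0 ?weight_ge0.
Qed.

(* Components of [g] are only known to be bounded on smaller balls, so coefficients are first
   computed there. *)
Definition trunc r f z : C := if sqnorm z < r then f z else 0.

Lemma measurable_trunc r f : measurable_fun B f -> measurable_fun B (trunc r f).
Proof.
move=> mf; apply: measurable_fun_if => //.
  by apply: measurable_fun_ltr; [apply: measurable_funTS; exact: measurable_sqnorm|exact: measurable_cst].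
exact: measurable_funS mf.
Qed.

Lemma cabs_trunc_le r f z : cabs (trunc r f z) <= cabs (f z).
Proof. by rewrite /trunc; case: ifP => // _; rewrite Normc.normc0 cabs_ge0. Qed.

Lemma L2_trunc_lb r g : r < 1 -> locally_bounded_hol g -> L2 (trunc r g).
Proof.
move=> r1 [_ mg bg]; have [r0|r0] := ltP r 0.
  have -> : trunc r g = fun=> 0.
    by apply/funext => z; rewrite /trunc ltNge (le_trans (ltW r0)) ?sqnorm_ge0.
  exact: L2_0.
have [M HM] := bg r (introT andP (conj r0 r1)).
apply: (L2_bound (M := Num.max 0 M)); first exact: measurable_trunc.
move=> z _; rewrite /trunc le_max; case: ifP => [/ltW/HM ->|_]; first by rewrite orbT.
by rewrite Normc.normc0 lexx.
Qed.

Definition radius (N : nat) : R := 1 - N.+1%:R^-1.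

Lemma radius_lt1 N : radius N < 1.
Proof. by rewrite gtrBl invr_gt0. Qed.

Lemma ip_trunc_cvg f k : L2 f -> L2 k -> ccvg (fun N => ip (trunc (radius N) f) k) (ip f k).
Proof.
move=> Lf Lk; rewrite ipE; under eq_fun do rewrite ipE.
have /L2P[mf fi] := Lf; have /L2P[mk ki] := Lk.
apply: (cint_ccvg mB _ _ (G := fun z => cabs (f z) ^+ 2 * w z + cabs (k z) ^+ 2 * w z)).
- by move=> N; apply: measurable_ipf => //; exact: measurable_trunc.
- move=> z zB e e0; have d0 : 0 < 1 - sqnorm z by rewrite subr_gt0.
  have [N0 _ HN] := near_infty_natSinv_lt (PosNum d0); exists N0 => N /HN /= hN.
  have zr : sqnorm z < radius N by rewrite /radius ltrBrDr addrC -ltrBrDr.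
  by rewrite /ipf /trunc zr subrr Normc.normc0 ltW.
- exact: (eq_integrable mB _ _ _ (integrableD mB fi ki)).
- move=> N z _; apply: (le_trans (cabs_ipf_le _ _ _ _)); rewrite lerD2r.
  by rewrite ler_wpM2r ?weight_ge0// lerXn2r ?nnegrE ?cabs_ge0// cabs_trunc_le.
Qed.

Lemma phase_scales p (t : C) : cabs t = 1 -> scales v 1 (phase p t).
Proof. exact: scales_Cn_phase. Qed.

Lemma ip_trunc_phase r g p (t : C) al : r < 1 -> locally_bounded_hol g -> cabs t = 1 ->
  conjc t ^+ al p * ip (trunc r (fun z => g (phase p t z))) (mono al) = ip (trunc r g) (mono al).
Proof.
move=> r1 lg t1; have Lg := L2_trunc_lb r1 lg.
rewrite -(ip_scales (phase_scales p t1) _ Lg (L2_mono al)); last first.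
  by move=> z; rewrite sqnorm_phase1.
have -> : (fun z => mono al (phase p t z)) = fun z => t ^+ al p * mono al z.
  by apply/funext => z; rewrite mono_phase.
have L : L2 (fun z => trunc r g (phase p t z)).
  by apply: (L2_scales (phase_scales p t1)) => // z; rewrite sqnorm_phase1.
rewrite ipZr//; last exact: L2_mono.
congr (_ * ip _ _); last by apply/funext => z; rewrite /trunc sqnorm_phase1.
by rewrite rmorphXn.
Qed.

Lemma ip_lincomb (I : Type) (s : seq I) (c : I -> C) (F : I -> V -> C) k :
  (forall i, L2 (F i)) -> L2 k ->
  ip (fun z => \sum_(i <- s) c i * F i z) k = \sum_(i <- s) c i * ip (F i) k.
Proof.
move=> LF Lk; rewrite ipE (eq_bigr (fun i => cint v B (fun z => c i * ipf lambda (F i) k z))).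
  rewrite -cint_sum//; last by move=> i _; apply: cintegrableZ => //; exact: ip_integrable.
  apply: eq_cint => z _; rewrite /ipf !mulr_suml; apply: eq_bigr => i _.
  by rewrite !mulrA.
by move=> i _; rewrite ipE cintZ//; exact: ip_integrable.
Qed.

(* By rotation invariance, every rotated copy of [g] in the average has the same coefficient. *)
Lemma ip_component r g g' p d al : 0 <= r < 1 -> al p = d ->
  locally_bounded_hol g ->
  (forall z, B z -> ccvg (fun N => root_avg N d (fun t => g (phase p t z))) (g' z)) ->
  ip (trunc r g') (mono al) = ip (trunc r g) (mono al).
Proof.
move=> /andP[r0 r1] ald lg Hg'.
pose F N z := root_avg N d (fun t => g (phase p t z)).
have Lg (t : C) : cabs t = 1 -> L2 (trunc r (fun z => g (phase p t z))).
  move=> t1; have := L2_scales (phase_scales p t1) _ (L2_trunc_lb r1 lg).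
  move=> /(_ (fun z => sqnorm_phase1 p z t1)); congr L2; apply/funext => z.
  by rewrite /trunc sqnorm_phase1.
have FE N : trunc r (F N) = fun z => \sum_(j < N) (N%:R^-1 * conjc (unity R N j) ^+ d) *
    trunc r (fun z => g (phase p (unity R N j) z)) z.
  apply/funext => z; rewrite /trunc; case: ifP => _.
    by rewrite /F /root_avg mulr_sumr; apply: eq_bigr => j _; rewrite mulrA.
  by rewrite big1// => j _; rewrite mulr0.
(* The average over 0 points is 0, hence the shift to [N.+1]. *)
have ipF N : ip (trunc r (F N.+1)) (mono al) = ip (trunc r g) (mono al).
  rewrite FE ip_lincomb; [|by move=> j; apply: Lg; exact: cabs_unity|exact: L2_mono].
  rewrite (eq_bigr (fun=> N.+1%:R^-1 * ip (trunc r g) (mono al))); last first.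
    move=> j _; rewrite -mulrA; congr (_ * _).
    by rewrite -(ip_trunc_phase p al r1 lg (cabs_unity R N.+1 j)) ald.
  by rewrite sumr_const card_ord -[(_ * _) *+ _]mulr_natl mulrA divff ?mul1r// pnatr_eq0.
have [M HM] : exists M : R, forall z, sqnorm z <= r -> cabs (g z) <= M.
  by case: lg => _ _; apply; rewrite r0.
have M0 : 0 <= M by apply: le_trans (cabs_ge0 _) (HM 0 _); rewrite sqnorm0.
have FM N z : cabs (trunc r (F N) z) <= M.
  rewrite /trunc; case: ifP => [/ltW zr|_]; last by rewrite Normc.normc0.
  by apply: root_avg_le => // j; apply: HM; rewrite sqnorm_phase1// cabs_unity.
have mF N : measurable_fun B (trunc r (F N)).
  rewrite FE; apply: cmeasurable_sum => j; apply: cmeasurableM => //.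
  exact: (Lg _ (cabs_unity R N j)).1.
have /L2P[_ wi] := L2_1.
have : ccvg (fun N => ip (trunc r (F N)) (mono al)) (ip (trunc r g') (mono al)).
  rewrite ipE; under eq_fun do rewrite ipE.
  apply: (cint_ccvg mB _ _ (G := fun z => M * (cabs (1 : C) ^+ 2 * w z))).
  - by move=> N; apply: measurable_ipf => //; exact: measurable_mono.
  - move=> z zB; rewrite /ipf /trunc; case: ifP => _; last first.
      by rewrite !mul0r; exact: ccvg_cst.
    rewrite -mulrA mulrC; under eq_fun do rewrite -mulrA mulrC.
    exact: ccvgZ (Hg' z zB).
  - exact: (eq_integrable mB _ _ _ (integrableZl mB M wi)).
  - move=> N z zB; rewrite cabs_ipf Normc.normc1 expr1n mul1r ler_wpM2r ?weight_ge0//.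
    rewrite -[leRHS]mulr1; apply: ler_pM; rewrite ?cabs_ge0//.
    exact: cabs_mono_le1.
move=> H; apply/esym; apply: (ccvg_uniq (ccvg_cst _)) => e /H[N0 HN].
by exists N0 => N hN; have := HN N.+1 (leqW hN); rewrite ipF.
Qed.

End truncation.

Section completeness.
Variables (R : realType) (n : nat) (lambda : R).
Hypothesis lambda_gtN1 : -1 < lambda.
Hypothesis c0 : 0 < wconst n lambda.
Local Notation C := R[i].
Local Notation V := ('cV[R[i]]_n).
Local Notation B := (unit_ball (R := R) (n := n)).
Local Notation L2 := (square_integrable (R := R) (n := n) lambda).
Local Notation berg := (bergman_space (R := R) (n := n) lambda).
Local Notation ip := (@inner_product R n lambda).
Local Notation norm2 := (norm2 lambda).
Implicit Types (f g h k : V -> C) (al : 'I_n -> nat).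

Let eps : R := n.+1%:R^-1.

Let eps_gt0 : 0 < eps. Proof. by rewrite invr_gt0. Qed.

Let eps_le1 : eps <= 1. Proof. by rewrite invf_le1// ler1n. Qed.

(** A point of the ball with no zero coordinate: monomials do not vanish there, so it detects their
    norms and the coefficient of a homogeneous function. *)
Let epsv : V := const_mx eps%:C.

Let epsv_ball : B epsv.
Proof.
rewrite /unit_ball /= sqnormE.
under eq_bigr do rewrite mxE cabsE gtr0_norm//.
rewrite sumr_const card_ord -[_ *+ n]mulr_natl.
have -> : n%:R * eps ^+ 2 = (n%:R * eps) * eps by ring.
apply: (@le_lt_trans _ _ (n%:R * eps)).
  by rewrite ler_piMr// mulr_ge0// ltW.
by rewrite /eps ltr_pdivrMr// mul1r ltr_nat.
Qed.

Let mono_epsv al : mono al epsv = eps%:C ^+ (\sum_(i < n) al i)%N.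
Proof. by rewrite expr_sum; apply: eq_bigr => i _; rewrite mxE. Qed.

Let mono_epsv_neq0 al : mono al epsv != 0.
Proof. by rewrite mono_epsv expf_neq0// -cabs_gt0 cabsE gtr0_norm. Qed.

Lemma norm2_mono_neq0 al : norm2 (mono al) != 0.
Proof.
apply/eqP => h; have /eqP := norm2_eq0 c0 (berg_mono lambda_gtN1 al) h epsv_ball.
by rewrite (negbTE (mono_epsv_neq0 al)).
Qed.

Lemma homog_multi g al : (forall i, homog i (al i) g) -> forall (t : 'I_n -> C) z,
  (forall i, cabs (t i) <= 1) -> B z ->
  g (\col_i (t i * z i ord0)) = (\prod_(i < n) t i ^+ al i) * g z.
Proof.
move=> hg t z t1 zB.
pose T (s : seq 'I_n) : V := \col_i (if i \in s then t i * z i ord0 else z i ord0).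
have H s : uniq s -> B (T s) /\ g (T s) = (\prod_(i <- s) t i ^+ al i) * g z.
  elim: s => [|p s IH] /=.
    have -> : T [::] = z by apply/matrixP => i j; rewrite ord1 mxE.
    by rewrite big_nil mul1r.
  move=> /andP[ps /IH[Ts gTs]].
  have -> : T (p :: s) = phase p (t p) (T s).
    apply/matrixP => i j; rewrite ord1 phaseE !mxE in_cons.
    by case: eqP => [->|_] //=; rewrite (negbTE ps).
  by rewrite hg// gTs big_cons mulrA; split => //; exact: unit_ball_phase.
have [_] := H _ (enum_uniq 'I_n); rewrite big_enum /= => <-; congr g.
by apply/matrixP => i j; rewrite !mxE mem_enum.
Qed.

(** The vector with coordinates [eps * z_i] arises from [z] by scaling with [eps], and from [epsv]
    by scaling with the [z_i]. Evaluating [g] there in both ways relates [g z] to [g epsv]. *)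
Lemma homog_mono g al : (forall i, homog i (al i) g) ->
  exists c : C, forall z, B z -> g z = c * mono al z.
Proof.
move=> hg; exists (g epsv / mono al epsv) => z zB.
have e1 (i : 'I_n) : cabs (eps%:C : C) <= 1 by rewrite cabsE gtr0_norm.
have h1 := homog_multi hg e1 zB.
have h2 := homog_multi hg (fun i => cabs_coord_le1 i zB) epsv_ball.
have E : \col_i (eps%:C * z i ord0) = \col_i (z i ord0 * epsv i ord0) :> V.
  by apply/matrixP => i j; rewrite !mxE mulrC.
have P : \prod_(i < n) eps%:C ^+ al i = mono al epsv.
  by rewrite /mono; apply: eq_bigr => i _; rewrite mxE.
move: h1; rewrite E h2 P => h1.
apply: (mulfI (mono_epsv_neq0 al)); rewrite -h1 -/(mono al z).
by field; exact: mono_epsv_neq0.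
Qed.

Let upda al p d : 'I_n -> nat := fun i => if i == p then d else al i.

Let radius01 N : 0 <= radius R N < 1.
Proof. by rewrite radius_lt1 subr_ge0 invf_le1// ler1n. Qed.

Lemma components_eq0 (s : seq 'I_n) g al : uniq s -> locally_bounded_hol g ->
  (forall q, q \notin s -> homog q (al q) g) ->
  (forall be, (forall q, q \notin s -> be q = al q) ->
     ccvg (fun N => ip (trunc (radius R N) g) (mono be)) 0) ->
  forall z, B z -> g z = 0.
Proof.
elim: s g al => [|p s IH] g al /=.
  move=> _ lg hg Hg; have [c Hc] := homog_mono (fun q => hg q isT).
  have L0 := L2_mono lambda_gtN1 al.
  have Lcm : L2 (fun z => c * mono al z) by exact: L2Z.
  have H1 : ccvg (fun N => ip (trunc (radius R N) g) (mono al)) (ip (fun z => c * mono al z) (mono al)).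
    apply: eq_ccvg (ip_trunc_cvg Lcm L0) => N; apply: eq_ip => // z zB.
    by rewrite /trunc Hc.
  have := ccvg_uniq H1 (Hg al (fun _ _ => erefl)).
  rewrite ipZl// ip_norm2 => /eqP; rewrite mulf_eq0.
  have -> : ((norm2 (mono al))%:C == 0 :> C) = false.
    by apply/negbTE; rewrite eq_complex /= eqxx andbT norm2_mono_neq0.
  by rewrite orbF => /eqP cE z /Hc ->; rewrite cE mul0r.
move=> /andP[ps us] lg hg Hg; apply: (coord_component_eq0 (p := p)) => // d.
have [g' [lg' cg' hp' hq']] := coord_component p d lg.
suff g'0 z : B z -> g' z = 0 by move=> z zB; rewrite -(g'0 z zB); exact: cg'.
apply: (IH g' (upda al p d)) => // [q qs|be Hbe].
  rewrite /upda; case: eqP => [->//|/eqP qp].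
  by apply: hq' => //; apply: hg; rewrite in_cons negb_or qp.
have bep : be p = d by rewrite Hbe// /upda eqxx.
apply: eq_ccvg (Hg be _) => [N|q].
  by rewrite (ip_component lambda_gtN1 (radius01 N) bep lg cg').
rewrite in_cons negb_or => /andP[qp qs]; rewrite Hbe// /upda.
by rewrite (negbTE qp).
Qed.

Lemma bergman_locally_bounded f : berg f -> locally_bounded_hol f.
Proof.
move=> bf; have /bergP[hf [mf _]] := bf; split => // r r01.
have [K K0 HK] := berg_bound c0 r01; exists (1 + K * norm2 f) => z zr.
have := HK f bf z zr; have := sqr_ge0 (cabs (f z) - 1); have := cabs_ge0 (f z).
by move: (cabs _) (K * _) => x y; nra.
Qed.

Theorem mono_complete f : berg f -> (forall al, ip f (mono al) = 0) ->
  forall z, B z -> f z = 0.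
Proof.
move=> bf H; apply: (@components_eq0 (enum 'I_n) f (fun=> 0%N)).
- exact: enum_uniq.
- exact: bergman_locally_bounded.
- by move=> q; rewrite mem_enum.
- move=> be _; rewrite -(H be).
  by apply: ip_trunc_cvg; [exact: berg_L2|exact: L2_mono].
Qed.

End completeness.

(** * Matrix coefficients of invariant symbols *)

Section invariant_forms.
Variables (R : realType) (n : nat) (lambda : R).
Hypothesis lambda_gtN1 : -1 < lambda.
Local Notation C := R[i].
Local Notation V := ('cV[R[i]]_n).
Local Notation v := (@lebesgue_Cn R n).
Local Notation B := (unit_ball (R := R) (n := n)).
Local Notation L2 := (square_integrable (R := R) (n := n) lambda).
Local Notation ip := (@inner_product R n lambda).
Implicit Types (a f g h k : V -> C) (al be : 'I_n -> nat).

Let mB : measurable B. Proof. exact: measurable_unit_ball. Qed.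

Lemma ip_ae f f' k : measurable_fun B f -> measurable_fun B f' -> measurable_fun B k ->
  {ae v, forall z, B z -> f z = f' z} -> ip f k = ip f' k.
Proof.
move=> mf mf' mk ff'; rewrite !ipE.
have m1 := measurable_Re_Im (measurable_ipf lambda mf mk).
have m2 := measurable_Re_Im (measurable_ipf lambda mf' mk).
congr Complex; congr fine; apply: ae_eq_integral => //.
- by apply/measurable_EFinP; exact: m1.1.
- by apply/measurable_EFinP; exact: m2.1.
- by apply: filterS ff' => z H zB; rewrite /ipf H.
- by apply/measurable_EFinP; exact: m1.2.
- by apply/measurable_EFinP; exact: m2.2.
- by apply: filterS ff' => z H zB; rewrite /ipf H.
Qed.

Lemma nsq_ae f f' : measurable_fun B f -> measurable_fun B f' ->
  {ae v, forall z, B z -> f z = f' z} -> nsq lambda f = nsq lambda f'.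
Proof.
move=> mf mf' ff'; apply: ae_eq_integral => //.
- by apply/measurable_EFinP; exact: measurable_nsq.
- by apply/measurable_EFinP; exact: measurable_nsq.
- by apply: filterS ff' => z H zB; rewrite H.
Qed.

(** Here the bound holds everywhere on the ball; [bounded_representative] leads back to it from
    [Linfty_ball]. *)
Definition bounded_symbol a := measurable_fun B a /\
  exists M : R, forall z, B z -> cabs (a z) <= M.

Lemma bounded_symbol1 : bounded_symbol (fun=> 1).
Proof. by split; [exact: measurable_cst|exists 1 => z _; rewrite Normc.normc1]. Qed.

Lemma bounded_symbolJ a : bounded_symbol a -> bounded_symbol (fun z => conjc (a z)).
Proof.
by move=> [ma [M aM]]; split; [exact: cmeasurable_conj|exists M => z /aM; rewrite cabsJ].
Qed.

Lemma L2_symbol a f : bounded_symbol a -> L2 f -> L2 (fun z => a z * f z).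
Proof. by move=> [ma [M aM]]; exact: L2_bounded aM. Qed.

Definition form a f k : C := ip (fun z => a z * f z) k.

Definition ae_inv a (phi : V -> V) := {ae v, forall z, B z -> a (phi z) = a z}.

Lemma form_inv a f k (phi : V -> V) : bounded_symbol a -> ae_inv a phi ->
  scales v 1 phi -> (forall z, sqnorm (phi z) = sqnorm z) -> L2 f -> L2 k ->
  form a (fun z => f (phi z)) (fun z => k (phi z)) = form a f k.
Proof.
move=> ba ai sphi phiE Lf Lk.
rewrite [RHS]/form -(ip_scales sphi phiE (L2_symbol ba Lf) Lk).
have phiB : phi @^-1` B = B by apply/seteqP; split => z; rewrite /unit_ball /= phiE.
have mf' : measurable_fun B (fun z => f (phi z)) := measurable_fun_scales mB sphi phiB Lf.1.
apply: ip_ae.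
- by apply: cmeasurableM => //; exact: ba.1.
- by apply: cmeasurableM => //; exact: (measurable_fun_scales mB sphi phiB ba.1).
- exact: (measurable_fun_scales mB sphi phiB Lk.1).
- by apply: filterS ai => z H zB; rewrite H.
Qed.

Lemma L2_lincomb (J : Type) (s : seq J) (c : J -> C) (F : J -> V -> C) :
  (forall i, L2 (F i)) -> L2 (fun z => \sum_(i <- s) c i * F i z).
Proof.
move=> LF; elim: s => [|i s IH].
  by under eq_fun do rewrite big_nil; exact: L2_0.
by under eq_fun do rewrite big_cons; apply: L2D => //; exact: L2Z.
Qed.

Lemma form_lincomb a (I J : Type) (s : seq I) (s' : seq J) (c : I -> C) (d : J -> C)
    (F : I -> V -> C) (G : J -> V -> C) : bounded_symbol a ->
  (forall i, L2 (F i)) -> (forall j, L2 (G j)) ->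
  form a (fun z => \sum_(i <- s) c i * F i z) (fun z => \sum_(j <- s') d j * G j z) =
  \sum_(i <- s) \sum_(j <- s') c i * conjc (d j) * form a (F i) (G j).
Proof.
move=> ba LF LG.
have ipr f : L2 f -> ip f (fun z => \sum_(j <- s') d j * G j z) =
    \sum_(j <- s') conjc (d j) * ip f (G j).
  move=> Lf; rewrite ipJ//; last exact: L2_lincomb.
  rewrite ip_lincomb// rmorph_sum /=; apply: eq_bigr => j _.
  by rewrite -[LHS]/(conjc (d j * ip (G j) f)) conjcM -ipJ.
rewrite /form.
have -> : (fun z => a z * \sum_(i <- s) c i * F i z) =
    (fun z => \sum_(i <- s) c i * (a z * F i z)).
  by apply/funext => z; rewrite mulr_sumr; apply: eq_bigr => i _; rewrite mulrCA.
rewrite (ip_lincomb s c (fun i => L2_symbol ba (LF i)) (L2_lincomb s' d LG)).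
apply: eq_bigr => i _; rewrite ipr; last exact: L2_symbol.
by rewrite mulr_sumr; apply: eq_bigr => j _; rewrite mulrA.
Qed.

Definition diagv (t : 'I_n -> C) (z : V) : V := \col_i (t i * z i ord0).

Lemma scales_diagv (t : 'I_n -> C) : (forall i, cabs (t i) = 1) -> scales v 1 (diagv t).
Proof.
move=> t1.
pose T (s : seq 'I_n) (z : V) : V := \col_i (if i \in s then t i * z i ord0 else z i ord0).
have H s : uniq s -> scales v 1 (T s).
  elim: s => [|p s IH] /=.
    by move=> _; apply: eq_scales (scales_id v) => z; apply/matrixP => i j; rewrite ord1 mxE.
  move=> /andP[ps us]; rewrite -(mulr1 1).
  apply: eq_scales (scales_comp (IH us) (phase_scales p (t1 p))) => z.
  apply/matrixP => i j; rewrite ord1 phaseE !mxE in_cons.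
  by case: eqP => [->|_] //=; rewrite (negbTE ps).
apply: eq_scales (H _ (enum_uniq 'I_n)) => z.
by apply/matrixP => i j; rewrite !mxE mem_enum.
Qed.

Lemma sqnorm_diagv (t : 'I_n -> C) z : (forall i, cabs (t i) = 1) ->
  sqnorm (diagv t z) = sqnorm z.
Proof.
move=> t1; rewrite !sqnormE; apply: eq_bigr => i _.
by rewrite mxE Normc.normcM t1 mul1r.
Qed.

Lemma mono_diagv al t z : mono al (diagv t z) = (\prod_(i < n) t i ^+ al i) * mono al z.
Proof.
by rewrite /mono -big_split /=; apply: eq_bigr => i _; rewrite mxE exprMn.
Qed.

Lemma form_diagv a t be al : bounded_symbol a -> (forall i, cabs (t i) = 1) ->
  ae_inv a (diagv t) ->
  (\prod_(i < n) (t i ^+ be i * conjc (t i) ^+ al i)) * form a (mono be) (mono al) =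
  form a (mono be) (mono al).
Proof.
move=> ba t1 ai; have Lb := L2_mono lambda_gtN1 be; have La := L2_mono lambda_gtN1 al.
have := form_inv ba ai (scales_diagv t1) (fun z => sqnorm_diagv z t1) Lb La.
move=> E; rewrite -[RHS]E big_split /= -mulrA /form.
have -> : (fun z => a z * mono be (diagv t z)) =
    (fun z => (\prod_(i < n) t i ^+ be i) * (a z * mono be z)).
  by apply/funext => z; rewrite mono_diagv mulrCA.
have -> : (fun z => mono al (diagv t z)) = (fun z => (\prod_(i < n) t i ^+ al i) * mono al z).
  by apply/funext => z; rewrite mono_diagv.
have Lab := L2_symbol ba Lb; rewrite ipZl ?ipZr//; last exact: L2Z.
congr (_ * _); rewrite rmorph_prod mulrC [RHS]mulrC; congr (_ * _).
by apply: eq_bigr => i _; rewrite rmorphXn.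
Qed.

Lemma unit_separates (b c : nat) : b != c -> exists2 t : C, cabs t = 1 &
  t ^+ b * conjc t ^+ c != 1.
Proof.
move=> bc; have d0 : b%:R - c%:R != 0 :> R by rewrite subr_eq0 eqr_nat.
(* With this angle the product is [cis 1], and 1 lies strictly between 0 and [2 pi]. *)
exists (cis (b%:R - c%:R)^-1); first exact: cabs_cis.
rewrite cisN !cisX -cisD.
have -> : b%:R / (b%:R - c%:R) + c%:R * - (b%:R - c%:R)^-1 = 1 :> R.
  by rewrite mulrN -mulrBl divff.
apply: cis_eq1; rewrite normr1 ltr01 /=.
by have := pi_ge2 R; lra.
Qed.

Definition block_phase (J : pred 'I_n) (t : C) := diagv (fun i => if J i then t else 1).

(** The phase multiplies the form by [t^b] times the conjugate of [t^c], where [b] and [c] are the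
    two weights on [J]; some [t] makes this factor different from 1. *)
Lemma form_phase_orth a (J : pred 'I_n) be al : bounded_symbol a ->
  (forall t : C, cabs t = 1 -> ae_inv a (block_phase J t)) ->
  (\sum_(i < n | J i) be i != \sum_(i < n | J i) al i)%N ->
  form a (mono be) (mono al) = 0.
Proof.
move=> ba ai /unit_separates[t t1 ht].
have u1 i : cabs (if J i then t else 1) = 1 by case: ifP => // _; rewrite Normc.normc1.
have := form_diagv be al ba u1 (ai t t1).
have -> : \prod_(i < n) ((if J i then t else 1) ^+ be i * conjc (if J i then t else 1) ^+ al i) =
    t ^+ (\sum_(i < n | J i) be i)%N * conjc t ^+ (\sum_(i < n | J i) al i)%N.
  rewrite !expr_sum -big_split /= [RHS]big_mkcond /=; apply: eq_bigr => i _.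
  by case: ifP => // _; rewrite -(rmorph1 (real_complex R)) conjc_real rmorph1 !expr1n mulr1.
move/eqP; rewrite -subr_eq0 -{2}[form a _ _]mul1r -mulrBl mulf_eq0 subr_eq0 (negbTE ht).
by move=> /eqP.
Qed.

Definition at_p (T : Type) (p q : 'I_n) (x y : T) (e : 'I_n -> T) : 'I_n -> T :=
  fun i => if i == p then x else if i == q then y else e i.

Lemma mono_at al p q (x y : nat) (z : V) : p != q -> mono (at_p p q x y al) z =
  z p ord0 ^+ x * z q ord0 ^+ y * \prod_(i < n | (i != p) && (i != q)) z i ord0 ^+ al i.
Proof.
move=> pq; rewrite /mono (bigD1 p)//= (bigD1 q)/=; last by rewrite eq_sym.
rewrite /at_p eqxx [q == p]eq_sym (negbTE pq) eqxx mulrA; congr (_ * _).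
by apply: eq_bigr => i /andP[/negbTE -> /negbTE ->].
Qed.

Lemma sqnorm_plane_rot p q (c s : R) (z : V) : p != q -> c ^+ 2 + s ^+ 2 = 1 ->
  sqnorm (plane_rot p q c s z) = sqnorm z.
Proof.
move=> pq cs; have qp : q != p by rewrite eq_sym.
rewrite !sqnormE (bigD1 p)//= (bigD1 q)//= [in RHS](bigD1 p)//= [in RHS](bigD1 q)//=.
rewrite !addrA !mxE !eqxx (negbTE qp); congr (_ + _); last first.
  by apply: eq_bigr => i /andP[/negbTE ip /negbTE iq]; rewrite mxE ip iq.
rewrite !cabs_sqr; move: (z p ord0) (z q ord0) => [x y] [x' y'] /=.
rewrite -[RHS]mul1r -cs; ring.
Qed.

Lemma mono_plane_rot al p q N (c s : R) (z : V) : p != q ->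
  mono (at_p p q N 0 al) (plane_rot p q c s z) =
  \sum_(k < N.+1) ('C(N, k)%:R * c ^+ (N - k) * (- s) ^+ k)%:C * mono (at_p p q (N - k)%N k al) z.
Proof.
move=> pq; rewrite mono_at// expr0 mulr1 !mxE eqxx.
rewrite (eq_bigr (fun i => z i ord0 ^+ al i)); last first.
  by move=> i /andP[/negbTE ip /negbTE iq]; rewrite mxE ip iq.
rewrite -mulNr exprDn mulr_suml; apply: eq_bigr => k _; rewrite mono_at//.
rewrite !rmorphM !rmorphXn rmorph_nat rmorphN /= -[_ *+ 'C(N, k)]mulr_natl !exprMn.
by move: (\prod_(_ < n | _) _) => P; ring.
Qed.

(** * Plane rotations and binomial coefficients *)

Section rotation.
Variables (a : V -> C) (p q : 'I_n) (be al : 'I_n -> nat) (N : nat).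
Hypothesis ba : bounded_symbol a.
Hypothesis pq : p != q.
Hypothesis arot : forall c s : R, c ^+ 2 + s ^+ 2 = 1 -> s != 0 ->
  ae_inv a (plane_rot p q c s).
Hypothesis aphase : forall t : C, cabs t = 1 -> ae_inv a (block_phase (pred1 p) t).

Let G (k l : nat) := form a (mono (at_p p q (N - k)%N k be)) (mono (at_p p q (N - l)%N l al)).

Let G_orth (k l : nat) : (k <= N)%N -> (l <= N)%N -> k != l -> G k l = 0.
Proof.
move=> kN lN kl; apply: (form_phase_orth ba aphase).
rewrite !big_pred1_eq /at_p eqxx; apply/eqP => h; move/eqP: kl; apply; lia.
Qed.

(** Both arguments contain [z_p^N], and each is expanded by the binomial theorem. The phases kill
    the cross terms, so the binomial coefficients and the signs occur squared. *)
Let rot_sum0 (c s : R) : c ^+ 2 + s ^+ 2 = 1 -> s != 0 ->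
  \sum_(k < N.+1) ('C(N, k)%:R ^+ 2 * (c ^+ 2) ^+ (N - k) * (s ^+ 2) ^+ k)%:C * G k k = G 0 0.
Proof.
move=> cs s0.
have Lm x y e : L2 (mono (at_p p q x y e)) by exact: L2_mono.
have := form_inv ba (arot cs s0) (scales_Cn_plane_rot pq cs s0)
  (fun z => sqnorm_plane_rot z pq cs) (Lm N 0 be) (Lm N 0 al).
under eq_fun do rewrite mono_plane_rot//; under [X in form _ _ X]eq_fun do rewrite mono_plane_rot//.
rewrite form_lincomb// /G !subn0 => <-.
apply: eq_bigr => k _; rewrite (bigD1 k)//= big1 ?addr0; last first.
  move=> l lk; rewrite [form _ _ _]G_orth ?mulr0//; first by rewrite -ltnS.
    by rewrite -ltnS.
  by rewrite eq_sym.
rewrite oppr0; congr (_ * _); rewrite -[RHS](rmorphM (real_complex R)) /=; congr (_%:C).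
have -> : s ^+ 2 ^+ k = (- s) ^+ k ^+ 2 by rewrite [RHS]exprAC sqrrN.
by rewrite (exprAC c) -!exprMn expr2.
Qed.

(** [x] is the squared tangent of the angle: [c^2 = 1 / (1 + x)] and [s^2 = x / (1 + x)]. Integer
    values suffice to outnumber the degree of a polynomial. *)
Let rot_sum (x : nat) : (0 < x)%N ->
  \sum_(k < N.+1) 'C(N, k)%:R ^+ 2 * x%:R ^+ k * G k k = (1 + x%:R) ^+ N * G 0 0.
Proof.
move=> x0; pose y : R := 1 + x%:R.
have y0 : 0 < y by rewrite /y ltr_wpDr.
have sx0 : 0 < x%:R / y :> R by rewrite divr_gt0// ltr0n.
have h1 : Num.sqrt y^-1 ^+ 2 = y^-1 by rewrite sqr_sqrtr// invr_ge0 ltW.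
have h2 : Num.sqrt (x%:R / y) ^+ 2 = x%:R / y by rewrite sqr_sqrtr// ltW.
have := @rot_sum0 (Num.sqrt y^-1) (Num.sqrt (x%:R / y)).
rewrite h1 h2 => <-; last 2 first.
- by rewrite -[X in X + _]mul1r -mulrDl divff// gt_eqF.
- by rewrite gt_eqF// sqrtr_gt0.
have yE : 1 + x%:R = y%:C :> C by rewrite /y rmorphD rmorph1 rmorph_nat.
rewrite yE mulr_sumr; apply: eq_bigr => k _; rewrite mulrA; congr (_ * _).
rewrite -(rmorphXn (real_complex R)) -[RHS](rmorphM (real_complex R)).
rewrite -!(rmorph_nat (real_complex R)) -!(rmorphXn (real_complex R)) -[LHS](rmorphM (real_complex R)).
congr (_%:C).
have kN : (k <= N)%N by rewrite -ltnS.
have -> : y ^+ N = y ^+ (N - k) * y ^+ k by rewrite -exprD subnK.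
rewrite expr_div_n !exprVn.
by field; rewrite !expf_neq0// gt_eqF.
Qed.

(* Invariance of the form on [z_p ^+ N] under rotations is a polynomial identity in the square
   of the tangent of the angle; this compares its coefficients. *)
Lemma rot_coef (k : nat) : (k <= N)%N -> 'C(N, k)%:R * G k k = G 0 0.
Proof.
move=> kN.
pose P : {poly C} := \poly_(k < N.+1) ('C(N, k)%:R ^+ 2 * G k k - 'C(N, k)%:R * G 0 0).
have P0 : P = 0.
  (* The roots [1, ..., N + 1] exceed the degree, which is at most [N]; 0 is left out since it
     corresponds to [s = 0]. *)
  apply: (@roots_geq_poly_eq0 _ _ [seq i.+1%:R | i <- iota 0 N.+1]).
  - apply/allP => _ /mapP[i _ ->]; rewrite rootE horner_poly.
    under eq_bigr do rewrite mulrBl mulrAC [X in _ - X]mulrAC.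
    rewrite sumrB rot_sum// -mulr_suml exprDn subr_eq0; apply/eqP; congr (_ * _).
    by apply: eq_bigr => l _; rewrite expr1n mul1r mulr_natl.
  - by rewrite map_inj_uniq ?iota_uniq// => i j /eqP; rewrite eqr_nat => /eqP; lia.
  - by rewrite size_map size_iota size_poly.
have := coef_poly N.+1 (fun k : nat => 'C(N, k)%:R ^+ 2 * G k k - 'C(N, k)%:R * G 0 0) k.
rewrite -/P P0 coef0 ltnS kN => /esym/eqP; rewrite subr_eq0 expr2 -mulrA => /eqP.
by apply: mulfI; rewrite pnatr_eq0 -lt0n bin_gt0.
Qed.

End rotation.

End invariant_forms.

(** * Commutation *)

Section commutation.
Variables (R : realType) (n : nat) (lambda : R).
Hypothesis lambda_gtN1 : -1 < lambda.
Hypothesis c0 : 0 < wconst n lambda.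
Local Notation C := R[i].
Local Notation V := ('cV[R[i]]_n).
Local Notation B := (unit_ball (R := R) (n := n)).
Local Notation L2 := (square_integrable (R := R) (n := n) lambda).
Local Notation berg := (bergman_space (R := R) (n := n) lambda).
Local Notation ip := (@inner_product R n lambda).
Local Notation norm2 := (norm2 lambda).
Local Notation form := (form lambda).
Implicit Types (a b f g h k : V -> C) (al be ga : 'I_n -> nat).

Variables (I : eqType) (blk : 'I_n -> I).

(** The three families of elements of U(k, j, T) that the argument uses: phases of single
    coordinates off the block [j], a common phase on it, and real rotations in a coordinate plane
    inside another block. *)
Record block_invariant (j : I) a : Prop := BlockInvariant {
  block_invariant_phase : forall p (t : C), blk p != j -> cabs t = 1 ->
    ae_inv a (block_phase (pred1 p) t);
  block_invariant_circle : forall t : C, cabs t = 1 ->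
    ae_inv a (block_phase (fun i => blk i == j) t);
  block_invariant_rot : forall p q (c s : R), p != q -> blk p = blk q -> blk p != j ->
    c ^+ 2 + s ^+ 2 = 1 -> s != 0 -> ae_inv a (plane_rot p q c s)
}.

Definition wt (j : I) al : nat := \sum_(i < n | blk i == j) al i.

Lemma form_support j a be al : bounded_symbol a -> block_invariant j a ->
  form a (mono be) (mono al) != 0 ->
  (forall p, blk p != j -> be p = al p) /\ wt j be = wt j al.
Proof.
move=> ba [ph ci _] nz; split => [p pj|]; apply/eqP; apply: contraNT nz => h; apply/eqP.
  apply: (form_phase_orth lambda_gtN1 ba (fun t => ph p t pj)).
  by rewrite !big_pred1_eq.
exact: (form_phase_orth lambda_gtN1 ba ci).
Qed.

Lemma form1 f k : form (fun=> 1) f k = ip f k.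
Proof. by apply: eq_ip => // z _; rewrite mul1r. Qed.

Lemma ip_mono_orth be al p : be p != al p -> ip (mono be) (mono al) = 0.
Proof.
move=> h; have := @form_phase_orth _ _ _ lambda_gtN1 (fun=> 1) (pred1 p) be al
  (@bounded_symbol1 R n).
rewrite !big_pred1_eq => /(_ _ h) H; rewrite -H => [|t _]; last exact: aeW.
by rewrite form1.
Qed.

(** With this normalization the pairings of [a h] with monomials are combinations of those of [h],
    see [form_expansion]. *)
Definition coef a be al : C := form a (mono be) (mono al) / (norm2 (mono be))%:C.

Let norm2C_neq0 al : (norm2 (mono al))%:C != 0 :> C.
Proof. by rewrite eq_complex /= eqxx andbT norm2_mono_neq0. Qed.

Lemma coef_neq0 a be al : coef a be al != 0 -> form a (mono be) (mono al) != 0.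
Proof. by apply: contraNneq => h; rewrite /coef h mul0r. Qed.

Let move_to p q al := at_p p q (al p + al q)%N 0%N al.

(** [rot_coef] is applied twice: to [a], and to the symbol 1 with [be] on both sides, which yields
    the norm in the denominator. The same binomial coefficient ['C(N, al q)] appears in both and
    cancels. *)
Lemma coef_move j a p q be al : bounded_symbol a -> block_invariant j a ->
  p != q -> blk p = blk q -> blk p != j -> be p = al p -> be q = al q ->
  coef a be al = coef a (move_to p q be) (move_to p q al).
Proof.
move=> ba [ph _ ro] pq bpq pj bp bq; pose N := (al p + al q)%N.
have qN : (al q <= N)%N by exact: leq_addl.
have E e : e p = al p -> e q = al q -> at_p p q (N - al q)%N (al q) e = e.
  move=> ep eq; apply/funext => i; rewrite /at_p /N addnK.
  by do 2 case: eqP => [->//|_].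
have E0 e : e p = al p -> e q = al q -> at_p p q (N - 0)%N 0%N e = move_to p q e.
  by move=> ep eq; rewrite subn0 /move_to ep eq.
have key a' : bounded_symbol a' ->
    (forall c s : R, c ^+ 2 + s ^+ 2 = 1 -> s != 0 -> ae_inv a' (plane_rot p q c s)) ->
    (forall t : C, cabs t = 1 -> ae_inv a' (block_phase (pred1 p) t)) ->
    forall e e', e p = al p -> e q = al q -> e' p = al p -> e' q = al q ->
    'C(N, al q)%:R * form a' (mono e) (mono e') =
    form a' (mono (move_to p q e)) (mono (move_to p q e')).
  move=> ba' ro' ph' e e' ep eq ep' eq'.
  have := rot_coef lambda_gtN1 e e' ba' pq ro' ph' qN.
  by rewrite !E// !E0.
have h1 := key a ba (fun c s cs s0 => ro p q c s pq bpq pj cs s0) (fun t t1 => ph p t pj t1)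
  be al bp bq erefl erefl.
have := key (fun=> 1) (@bounded_symbol1 R n) (fun c s _ _ => aeW _ (fun z _ => erefl))
  (fun t _ => aeW _ (fun z _ => erefl)) be be bp bq bp bq.
rewrite !form1 !ip_norm2 => h2; rewrite /coef -h1 -h2 -mulf_div divff ?mul1r//.
by rewrite pnatr_eq0 -lt0n bin_gt0.
Qed.

Let gather p (s : seq 'I_n) al : 'I_n -> nat := fun i =>
  if i == p then (al p + \sum_(q <- s) al q)%N else if i \in s then 0%N else al i.

Let gather_nil p al : gather p [::] al = al.
Proof.
by apply/funext => i; rewrite /gather big_nil addn0 in_nil; case: eqP => [->|].
Qed.

Let gather_cons p q s al : q != p -> q \notin s ->
  gather p (q :: s) al = move_to p q (gather p s al).
Proof.
move=> qp qs; apply/funext => i; rewrite /gather /move_to /at_p eqxx (negbTE qp) (negbTE qs).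
have [_|_] := eqVneq i p; first by rewrite big_cons addnCA addnC.
by rewrite in_cons; case: eqVneq.
Qed.

Lemma coef_gather j a p (s : seq 'I_n) be al : bounded_symbol a -> block_invariant j a ->
  blk p != j -> uniq s -> (forall q, q \in s -> blk q = blk p /\ q != p) ->
  (forall q, blk q = blk p -> be q = al q) ->
  coef a be al = coef a (gather p s be) (gather p s al).
Proof.
move=> ba ia pj us sb bal.
elim: s us sb => [|q s IH]; first by rewrite !gather_nil.
rewrite cons_uniq => /andP[qs us] sb.
have [bq qp] := sb q (mem_head _ _); have pq : p != q by rewrite eq_sym.
have sb' q' : q' \in s -> blk q' = blk p /\ q' != p by move=> q's; apply: sb; rewrite in_cons q's orbT.
rewrite (IH us sb') !gather_cons//; apply: (coef_move ba ia pq (esym bq) pj).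
  rewrite /gather eqxx bal//; congr (_ + _)%N; apply: eq_big_seq => q' /sb'[bq' _].
  exact: bal.
by rewrite /gather (negbTE qp) (negbTE qs) bal.
Qed.

(* The common part of the indices on a block where [a] is unitarily invariant can be gathered
   on a single coordinate, so that only its weight matters. *)
Lemma coef_block j a i0 be al be' al' : bounded_symbol a -> block_invariant j a -> i0 != j ->
  (forall i, blk i != i0 -> be i = be' i) -> (forall i, blk i != i0 -> al i = al' i) ->
  (forall i, blk i = i0 -> be i = al i) -> (forall i, blk i = i0 -> be' i = al' i) ->
  wt i0 be = wt i0 be' -> coef a be al = coef a be' al'.
Proof.
move=> ba ia i0j bb aa bal bal' ww.
have [p /eqP pb|none] := pickP (fun p => blk p == i0); last first.
  have -> : be = be' by apply/funext => i; apply: bb; rewrite none.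
  by have -> : al = al' by apply/funext => i; apply: aa; rewrite none.
pose s := [seq q <- enum 'I_n | (blk q == i0) && (q != p)].
have us : uniq s by rewrite filter_uniq// enum_uniq.
have sb q : q \in s -> blk q = blk p /\ q != p.
  by rewrite mem_filter pb => /andP[/andP[/eqP -> ->]].
have pj : blk p != j by rewrite pb.
have sum e : (e p + \sum_(q <- s) e q)%N = wt i0 e.
  rewrite /wt (bigD1 p)/= ?pb//; congr (_ + _)%N.
  by rewrite big_filter big_enum_cond.
rewrite (coef_gather ba ia pj us sb) 1?[RHS](coef_gather ba ia pj us sb); last 2 first.
- by move=> q; rewrite pb; exact: bal'.
- by move=> q; rewrite pb; exact: bal.
have sal : wt i0 al = wt i0 al'.
  transitivity (wt i0 be); first by apply: eq_bigr => i /eqP /bal.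
  by rewrite ww; apply: eq_bigr => i /eqP /bal'.
have eqg e e' : (forall i, blk i != i0 -> e i = e' i) -> wt i0 e = wt i0 e' ->
    gather p s e = gather p s e'.
  move=> ee we; apply/funext => i; rewrite /gather !sum we.
  have [//|ip] := eqVneq i p; rewrite mem_filter mem_enum andbT ip andbT.
  by have [//|/ee] := eqVneq (blk i) i0.
by rewrite (eqg be be')// (eqg al al').
Qed.

Lemma ip_symbolJ a f k : ip (fun z => conjc (a z) * f z) k = ip f (fun z => a z * k z).
Proof.
by rewrite !ipE; apply: eq_cint => z _; rewrite /ipf conjcM; ring.
Qed.

(** Indices with entries below [D] form a finite type, over which the expansions can be summed. *)
Definition idx D (be : {ffun 'I_n -> 'I_D}) : 'I_n -> nat := fun i => be i.

Lemma idx_surj D al : (forall i, (al i < D)%N) -> exists be : {ffun 'I_n -> 'I_D}, idx be = al.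
Proof.
move=> alD; exists [ffun i => Ordinal (alD i)].
by apply/funext => i; rewrite /idx ffunE.
Qed.

Lemma idx_neq D (be be' : {ffun 'I_n -> 'I_D}) : be != be' -> exists p, idx be p != idx be' p.
Proof.
move=> bb; have [p hp|h] := pickP (fun p => idx be p != idx be' p); first by exists p.
case/eqP: bb; apply/ffunP => i; apply/val_inj.
by have /negbFE/eqP := h i.
Qed.

(** The total degree is the weight on the block [j] plus the entries off it, and [form_support]
    preserves both. One [D] therefore serves for both factors of a composite. *)
Lemma form_lt j a be al D : bounded_symbol a -> block_invariant j a ->
  (\sum_i al i < D)%N -> form a (mono be) (mono al) != 0 ->
  (forall i, be i < D)%N /\ (\sum_i be i < D)%N.
Proof.
move=> ba ia alD /(form_support ba ia)[off tot].
have sE e : (\sum_i e i = wt j e + \sum_(i < n | blk i != j) e i)%N.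
  by rewrite (bigID (fun i => blk i == j)).
have bD : (\sum_i be i < D)%N.
  by rewrite sE tot (eq_bigr al)// -sE.
by split => // i; apply: leq_ltn_trans bD; rewrite (bigD1 i)//= leq_addr.
Qed.

(** The pairing is moved to the adjoint: the projection [g] of the conjugate of [a] times [z^al]
    pairs to 0 with all monomials outside a finite set, hence equals the polynomial [S] by
    [mono_complete]. No convergence of a monomial expansion of [h] enters. *)
Lemma form_expansion j a h al (D : nat) : bounded_symbol a -> block_invariant j a ->
  berg h -> (\sum_i al i < D)%N -> form a h (mono al) =
  \sum_(be : {ffun 'I_n -> 'I_D}) coef a (idx be) al * ip h (mono (idx be)).
Proof.
move=> ba ia bh alD; have La := L2_mono lambda_gtN1 al; have Lh := berg_L2 bh.
have bJ := bounded_symbolJ ba.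
pose g := bergman_projection lambda (fun z => conjc (a z) * mono al z).
have Lg : L2 (fun z => conjc (a z) * mono al z) by exact: L2_symbol.
have [bg Hg] := bergman_projectionP c0 Lg.
pose S z := \sum_(be : {ffun 'I_n -> 'I_D}) conjc (coef a (idx be) al) * mono (idx be) z.
have Lm e : L2 (mono e) := L2_mono lambda_gtN1 e.
have LS : L2 S by apply: L2_lincomb => be; exact: Lm.
have bS : berg S.
  by apply/bergP; split => //; apply: hol_lincomb => be; exact: hol_mono.
have gS : forall z, B z -> g z - 1 * S z = 0.
  apply: (mono_complete lambda_gtN1 c0 (bergB 1 bg bS)) => ga.
  rewrite ipBl; [|exact: berg_L2|exact: L2Z|exact: Lm].
  rewrite ipZl// mul1r Hg; last exact: berg_mono.
  have -> : ip (fun z => conjc (a z) * mono al z) (mono ga) = conjc (form a (mono ga) (mono al)).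
    by rewrite ip_symbolJ -ipJ//; exact: L2_symbol.
  rewrite /S ip_lincomb//; apply/eqP; rewrite subr_eq0; apply/eqP.
  have [nz|z0] := eqVneq (form a (mono ga) (mono al)) 0.
    rewrite nz conjc0 big1// => be _.
    have [->|/eqP ne] := pselect (idx be = ga); first by rewrite /coef nz mul0r conjc0 mul0r.
    have [p hp|h0] := pickP (fun p => idx be p != ga p).
      by rewrite (ip_mono_orth hp) mulr0.
    by case/eqP: ne; apply/funext => i; have /negbFE/eqP := h0 i.
  have [be0 be0E] := idx_surj (form_lt ba ia alD z0).1.
  rewrite [RHS](bigD1 be0)// [X in _ = _ + X]big1 ?addr0 => [|be /andP[_ /idx_neq[p hp]]]; last first.
    by rewrite -be0E (ip_mono_orth hp) mulr0.
  rewrite be0E ip_norm2 -(conjc_real (norm2 (mono ga))) -conjcM.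
  by congr conjc; rewrite /coef divfK.
transitivity (ip h g).
  rewrite (ipJ (berg_L2 bg) Lh) Hg// -ipJ//.
  by rewrite ipJ// ip_symbolJ /form -ipJ//; exact: L2_symbol.
have -> : ip h g = ip h S.
  by apply: eq_ip => // z /gS/eqP; rewrite mul1r subr_eq0 => /eqP.
rewrite ipJ// ip_lincomb// rmorph_sum; apply: eq_bigr => be _.
by rewrite rmorphM; congr (_ * _); [exact: conjcK|rewrite [RHS]ipJ].
Qed.

Let splice j ga al : 'I_n -> nat := fun i => if blk i == j then ga i else al i.

(* Only the index equal to [ga] on the block [j1] and to [al] elsewhere contributes. *)
Lemma composite_coef j1 j2 a b al ga D : j1 != j2 -> bounded_symbol a -> bounded_symbol b ->
  block_invariant j1 a -> block_invariant j2 b ->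
  (forall i, al i < D)%N -> (forall i, ga i < D)%N ->
  \sum_(be : {ffun 'I_n -> 'I_D}) coef a (idx be) al * coef b ga (idx be) =
  coef a (splice j1 ga al) al * coef b ga (splice j1 ga al).
Proof.
move=> j12 ba bb ia ib alD gaD.
have [be0 be0E] : exists be : {ffun 'I_n -> 'I_D}, idx be = splice j1 ga al.
  by apply: idx_surj => i; rewrite /splice; case: ifP.
rewrite [LHS](bigD1 be0)// [X in _ + X = _]big1 ?addr0 ?be0E// => be /andP[_ bene].
apply/eqP; rewrite mulf_eq0; apply/contraT; rewrite negb_or => /andP[].
move=> /coef_neq0/(form_support ba ia)[oa _] /coef_neq0/(form_support bb ib)[ob _].
have [p] := idx_neq bene; rewrite be0E /splice; have [pj|pj] := eqVneq (blk p) j1.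
  by rewrite ob ?eqxx// pj; exact: j12.
by rewrite oa ?eqxx.
Qed.

(** What a nonzero composite entry imposes on its outer indices. The condition is symmetric in the
    two blocks, so both orders vanish together when it fails. *)
Let compatible j1 j2 al ga := [/\ forall i, blk i != j1 -> blk i != j2 -> ga i = al i,
  wt j1 ga = wt j1 al & wt j2 ga = wt j2 al].

Let eq_wt j e e' : (forall i, blk i = j -> e i = e' i) -> wt j e = wt j e'.
Proof. by move=> E; apply: eq_bigr => i /eqP /E. Qed.

Let composite_support j1 j2 a b al ga : j1 != j2 -> bounded_symbol a -> bounded_symbol b ->
  block_invariant j1 a -> block_invariant j2 b ->
  coef a (splice j1 ga al) al * coef b ga (splice j1 ga al) != 0 -> compatible j1 j2 al ga.
Proof.
move=> j12 ba bb ia ib; rewrite mulf_eq0 negb_or => /andP[].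
move=> /coef_neq0/(form_support ba ia)[_ ta] /coef_neq0/(form_support bb ib)[ob tb].
split => [i i1 i2||].
- by rewrite ob// /splice (negbTE i1).
- by rewrite -ta; apply: eq_wt => i ij; rewrite /splice ij eqxx.
- by rewrite tb; apply: eq_wt => i ij; rewrite /splice ij eq_sym (negbTE j12).
Qed.

(** Between the two orders the factor of [b] changes only on the block [j1]: there its two indices
    are both [ga] in one order and both [al] in the other, with equal weights, so [coef_block]
    applies. The factor of [a] changes in the same way on [j2]. *)
Lemma composite_coefC j1 j2 a b al ga : j1 != j2 -> bounded_symbol a -> bounded_symbol b ->
  block_invariant j1 a -> block_invariant j2 b ->
  coef a (splice j1 ga al) al * coef b ga (splice j1 ga al) =
  coef b (splice j2 ga al) al * coef a ga (splice j2 ga al).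
Proof.
move=> j12 ba bb ia ib; have j21 : j2 != j1 by rewrite eq_sym.
have [[off t1 t2]|nc] := pselect (compatible j1 j2 al ga); last first.
  have nc' : ~ compatible j2 j1 al ga by move=> [h1 h2 h3]; apply: nc; split => // i ? ?; exact: h1.
  transitivity (0 : C); first by apply/eqP/contraT => /composite_support H; case: nc; exact: H.
  by apply/esym/eqP/contraT => /composite_support H; case: nc'; exact: H.
rewrite mulrC; congr (_ * _).
  apply: (coef_block bb ib j12) => [i i1|i i1|i i1|i i1|]; rewrite /splice ?i1 ?(negbTE i1) ?eqxx ?(negbTE j12)//.
    by have [//|i2] := eqVneq (blk i) j2; exact: off.
  by rewrite t1; apply: eq_wt => i ->; rewrite (negbTE j12).
apply: (coef_block ba ia j21) => [i i1|i i1|i i1|i i1|]; rewrite /splice ?i1 ?(negbTE i1) ?eqxx ?(negbTE j21)//.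
  by have [//|i2] := eqVneq (blk i) j1; apply/esym; exact: off.
by rewrite t2; apply: eq_wt => i ->; rewrite (negbTE j21).
Qed.

Lemma composite_form j1 j2 a b (Tb : V -> C) f al D : bounded_symbol a -> bounded_symbol b ->
  j1 != j2 -> block_invariant j1 a -> block_invariant j2 b -> berg f -> berg Tb ->
  (forall k, berg k -> ip Tb k = form b f k) -> (\sum_i al i < D)%N ->
  form a Tb (mono al) = \sum_(ga : {ffun 'I_n -> 'I_D})
    coef a (splice j1 (idx ga) al) al * coef b (idx ga) (splice j1 (idx ga) al) *
    ip f (mono (idx ga)).
Proof.
move=> ba bb j12 ia ib bf bT HT alD.
rewrite (form_expansion ba ia bT alD).
transitivity (\sum_(be : {ffun 'I_n -> 'I_D}) \sum_(ga : {ffun 'I_n -> 'I_D})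
    coef a (idx be) al * coef b (idx ga) (idx be) * ip f (mono (idx ga))).
  (* A nonzero first factor bounds the total degree of [be] by [D], which the second expansion
     requires; the other terms are 0 on both sides. *)
  apply: eq_bigr => be _; have [z|nz] := eqVneq (coef a (idx be) al) 0.
    by rewrite z mul0r big1// => ga _; rewrite !mul0r.
  have [_ beD] := form_lt ba ia alD (coef_neq0 nz).
  rewrite HT; last exact: berg_mono.
  by rewrite (form_expansion bb ib bf beD) mulr_sumr; apply: eq_bigr => ga _; rewrite mulrA.
rewrite exchange_big; apply: eq_bigr => ga _; rewrite -mulr_suml.
rewrite (composite_coef j12 ba bb ia ib)// => i; last exact: ltn_ord.
by apply: leq_ltn_trans alD; rewrite (bigD1 i)//= leq_addr.
Qed.

(** The operators enter only through their pairings with the Bergman space, so [a] and [b] may be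
    representatives that differ from the original symbols on a null set. *)
Theorem operators_commute j1 j2 a b (Ta Tb : (V -> C) -> V -> C) :
  bounded_symbol a -> bounded_symbol b -> j1 != j2 ->
  block_invariant j1 a -> block_invariant j2 b ->
  (forall f, berg f -> berg (Ta f) /\ forall k, berg k -> ip (Ta f) k = form a f k) ->
  (forall f, berg f -> berg (Tb f) /\ forall k, berg k -> ip (Tb f) k = form b f k) ->
  forall f, berg f -> forall z, B z -> Ta (Tb f) z = Tb (Ta f) z.
Proof.
move=> ba bb j12 ia ib HTa HTb f bf z zB; have j21 : j2 != j1 by rewrite eq_sym.
have [bTa HTaf] := HTa f bf; have [bTb HTbf] := HTb f bf.
have [bTab HTab] := HTa _ bTb; have [bTba HTba] := HTb _ bTa.
apply/eqP; rewrite -subr_eq0 -[X in _ - X]mul1r; apply/eqP.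
apply: (mono_complete lambda_gtN1 c0 (bergB 1 bTab bTba)) zB => al.
have bm := berg_mono lambda_gtN1 al.
rewrite ipBl; [|exact: berg_L2|apply: L2Z; exact: berg_L2|exact: berg_L2].
rewrite ipZl; [|exact: berg_L2|exact: berg_L2].
rewrite mul1r HTab// HTba//; apply/eqP; rewrite subr_eq0; apply/eqP.
rewrite (composite_form ba bb j12 ia ib bf bTb HTbf (ltnSn _)).
rewrite (composite_form bb ba j21 ib ia bf bTa HTaf (ltnSn _)).
by apply: eq_bigr => ga _; rewrite (composite_coefC al (idx ga) j12 ba bb ia ib).
Qed.

End commutation.

(** * The groups U(k, j, T) *)

Lemma sum_deltaM (R : comNzRingType) (I : finType) (r : R) (i : I) (x : I -> R) :
  \sum_l r *+ (l == i) * x l = r * x i.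
Proof.
rewrite (bigD1 i)//= eqxx mulr1n big1 ?addr0// => l /negbTE ->.
by rewrite mulr0n mul0r.
Qed.

Section block_circle.
Variables (R : realType) (m : nat) (k : 'I_m -> nat).
Local Notation C := R[i].
Local Notation N := (\sum_(i < m) k i)%N.
Local Notation V := ('cV[R[i]]_N).
Local Notation sig1 := (@tagnat.sig1 m k).

(** An entrywise criterion that hides the dependently typed blocks. For [A] block diagonal, each
    diagonal block of [A A^* = 1] is the unitarity of one block. *)
Lemma U_block_circleP j (A : 'M[C]_N) (t : C) :
  (forall s s', \sum_l A s l * conjc (A s' l) = (s == s')%:R) ->
  (forall s s', sig1 s != sig1 s' -> A s s' = 0) -> cabs t = 1 ->
  (forall s s', sig1 s = j -> sig1 s' = j -> A s s' = t *+ (s == s')) ->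
  U_block_circle (erefl N) j A.
Proof.
move=> AA Aoff t1 Aj.
have AE : A = \mxdiag_i submxblock A i i.
  rewrite -[LHS]submxblockK; apply: eq_mxblock => i i'.
  have [<-|ii] := eqVneq i i'; first by rewrite conform_mx_id.
  by apply/matrixP => s s'; rewrite !mxE Aoff// !tagnat.Rank1K.
have AAt : A *m map_mx Num.Def.conjC A^T = 1%:M.
  by apply/matrixP => s s'; rewrite !mxE -AA; apply: eq_bigr => l _; rewrite !mxE.
exists (fun i => submxblock A i i); split; last by rewrite castmx_id.
- move=> i _; apply/unitarymxP.
  have : submxblock (A *m map_mx Num.Def.conjC A^T) i i = submxblock 1%:M i i by rewrite AAt.
  rewrite {1}AE -[map_mx Num.Def.conjC A^T]submxblockK mul_mxdiag_mxblock mxblockK => H.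
  transitivity (submxblock A i i *m submxblock (map_mx Num.Def.conjC A^T) i i).
    by congr (_ *m _); apply/matrixP => s s'; rewrite !mxE.
  by rewrite H; apply/matrixP => s s'; rewrite !mxE !eq_le !tagnat.le_Rank.
- exists t => //; apply/matrixP => s s'.
  by rewrite !mxE Aj ?tagnat.Rank1K// !eq_le !tagnat.le_Rank.
Qed.

Lemma U_block_circle_diag j (t : 'I_N -> C) (t0 : C) : (forall i, cabs (t i) = 1) ->
  cabs t0 = 1 -> (forall i, sig1 i = j -> t i = t0) ->
  exists2 A, U_block_circle (erefl N) j A & forall z : V, A *m z = diagv t z.
Proof.
move=> t1 t01 tj; pose A : 'M[C]_N := \matrix_(s, s') (t s *+ (s' == s)).
have rowA s (x : 'I_N -> C) : \sum_l A s l * x l = t s * x s.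
  by under eq_bigr do rewrite mxE; exact: sum_deltaM.
exists A; last first.
  by move=> z; apply/matrixP => s i; rewrite ord1 !mxE rowA.
apply: (@U_block_circleP j A t0) => //.
- move=> s s'; rewrite rowA mxE; have [<-|ss] := eqVneq s s'.
    by rewrite mulr1n cabs_conj t1 expr1n.
  by rewrite mulr0n conjc0 mulr0.
- move=> s s' ss; rewrite mxE; have [ss'|//] := eqVneq s' s.
  by rewrite ss' eqxx in ss.
- by move=> s s' sj _; rewrite mxE tj// eq_sym.
Qed.

Lemma U_block_circle_rot j p q (c s : R) : p != q -> sig1 p = sig1 q -> sig1 p != j ->
  c ^+ 2 + s ^+ 2 = 1 ->
  exists2 A, U_block_circle (erefl N) j A & forall z : V, A *m z = plane_rot p q c s z.
Proof.
move=> pq spq pj cs; have qp : q != p by rewrite eq_sym.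
pose A : 'M[C]_N := \matrix_(i, l) (if i == p then c%:C *+ (l == p) - s%:C *+ (l == q)
  else if i == q then s%:C *+ (l == p) + c%:C *+ (l == q) else (l == i)%:R).
have rowA i (x : 'I_N -> C) : \sum_l A i l * x l =
    if i == p then c%:C * x p - s%:C * x q else if i == q then s%:C * x p + c%:C * x q else x i.
  under eq_bigr do rewrite mxE.
  have [_|_] := eqVneq i p.
    by under eq_bigr do rewrite mulrBl; rewrite sumrB !sum_deltaM.
  have [_|_] := eqVneq i q.
    by under eq_bigr do rewrite mulrDl; rewrite big_split /= !sum_deltaM.
  by rewrite sum_deltaM mul1r.
exists A; last first.
  by move=> z; apply/matrixP => i l; rewrite ord1 !mxE rowA.
have Ap i : conjc (A i p) = if i == p then c%:C else if i == q then s%:C else 0.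
  rewrite mxE eqxx (negbTE pq) !mulr1n !mulr0n subr0 addr0.
  have [_|ip] := eqVneq i p; first exact: conjc_real.
  by have [_|_] := eqVneq i q; rewrite ?conjc_real// eq_sym (negbTE ip) conjc0.
have Aq i : conjc (A i q) = if i == p then - s%:C else if i == q then c%:C else 0.
  rewrite mxE eqxx (negbTE qp) !mulr1n !mulr0n sub0r add0r.
  have [_|ip] := eqVneq i p; first by rewrite -(rmorphN (real_complex R)) conjc_real.
  by have [_|iq] := eqVneq i q; rewrite ?conjc_real// eq_sym (negbTE iq) conjc0.
have Ao i l : l != p -> l != q -> conjc (A i l) = (i == l)%:R.
  move=> /negbTE lp /negbTE lq; rewrite mxE lp lq !mulr0n subr0 addr0.
  have [->|_] := eqVneq i p; first by rewrite eq_sym lp conjc0.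
  have [->|_] := eqVneq i q; first by rewrite eq_sym lq conjc0.
  by rewrite eq_sym -(rmorph_nat (real_complex R)) conjc_real.
have csC : c%:C * c%:C + s%:C * s%:C = 1 :> C.
  by rewrite -!(rmorphM (real_complex R)) -(rmorphD (real_complex R)) -!expr2 cs rmorph1.
apply: (@U_block_circleP j A 1) => //.
- move=> i i'; rewrite rowA Ap Aq.
  have [ip|ip] := eqVneq i p.
    rewrite ip [p == i']eq_sym; have [_|_] := eqVneq i' p.
      by rewrite mulrN opprK csC.
    by have [_|_] := eqVneq i' q; rewrite ?mulr0 ?subr0// mulrC subrr.
  have [iq|iq] := eqVneq i q; last by rewrite Ao// eq_sym.
  rewrite iq [q == i']eq_sym; have [->|_] := eqVneq i' p.
    by rewrite (negbTE pq) mulrN mulrC subrr.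
  by have [_|_] := eqVneq i' q; rewrite ?mulr0 ?addr0// addrC csC.
- move=> i l il; rewrite mxE.
  have lE (x : 'I_N) : sig1 i = sig1 x -> (l == x) = false.
    by move=> ix; apply/eqP => lx; rewrite lx ix eqxx in il.
  have [ip|_] := eqVneq i p; first by rewrite !lE ?ip// subr0.
  have [iq|_] := eqVneq i q; first by rewrite !lE ?iq// addr0.
  by rewrite lE.
- by rewrite Normc.normc1.
- move=> i l ij lj; rewrite mxE.
  have [ip|_] := eqVneq i p; first by rewrite -ip ij eqxx in pj.
  have [iq|_] := eqVneq i q; first by rewrite spq -iq ij eqxx in pj.
  by rewrite eq_sym.
Qed.

Lemma block_invariant_sig1 j (a : V -> C) :
  invariant_symbol (U_block_circle (erefl N) j) a -> block_invariant sig1 j a.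
Proof.
move=> ai; split.
- move=> p t pj t1; have [i|||A UA AE] := @U_block_circle_diag j (fun i => if i == p then t else 1) 1.
  + by case: ifP => // _; rewrite Normc.normc1.
  + by rewrite Normc.normc1.
  + by move=> i ij; case: eqP => // ip; rewrite -ip ij eqxx in pj.
  + by apply: filterS (ai A UA) => z H zB; rewrite -[RHS]H// AE.
- move=> t t1; have [i|||A UA AE] := @U_block_circle_diag j (fun i => if sig1 i == j then t else 1) t.
  + by case: ifP => // _; rewrite Normc.normc1.
  + by [].
  + by move=> i ->; rewrite eqxx.
  + by apply: filterS (ai A UA) => z H zB; rewrite -[RHS]H// AE.
- move=> p q c s pq spq pj cs _; have [A UA AE] := U_block_circle_rot pq spq pj cs.
  by apply: filterS (ai A UA) => z H zB; rewrite -[RHS]H// AE.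
Qed.

End block_circle.

(** Once [n] is replaced by the sum of the block sizes, the cast is trivial and [tagnat.sig1], which
    gives the block containing an index, serves as [blk]. *)
Lemma U_block_circle_invariant (R : realType) (m n : nat) (k : 'I_m -> nat)
    (kn : (\sum_(i < m) k i)%N = n) : exists blk : 'I_n -> 'I_m,
  forall j (a : 'cV[R[i]]_n -> R[i]), invariant_symbol (U_block_circle kn j) a ->
    block_invariant blk j a.
Proof.
by case: n / kn; exists (@tagnat.sig1 m k) => j a; exact: block_invariant_sig1.
Qed.

Section bounded_representative.
Variables (R : realType) (n : nat) (lambda : R).
Local Notation C := R[i].
Local Notation V := ('cV[R[i]]_n).
Local Notation v := (@lebesgue_Cn R n).
Local Notation B := (unit_ball (R := R) (n := n)).
Local Notation L2 := (square_integrable (R := R) (n := n) lambda).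
Local Notation berg := (bergman_space (R := R) (n := n) lambda).
Local Notation ip := (@inner_product R n lambda).

(** The truncation acts on the values of [a], not on its domain. Composition with [t] keeps every
    almost everywhere invariance, see [block_invariant_comp]. *)
Lemma bounded_representative (a : V -> C) : Linfty_ball a -> exists2 t : C -> C,
  bounded_symbol (fun z => t (a z)) & {ae v, forall z, B z -> a z = t (a z)}.
Proof.
move=> [ma [M aM]]; pose t (x : C) := if cabs x <= M then x else 0.
exists t; last by apply: filterS aM => z H zB; rewrite /t H.
split.
  have mB : measurable B by exact: measurable_unit_ball.
  apply: measurable_fun_if => //.
    by apply: measurable_fun_ler; [exact: measurable_cabs|exact: measurable_cst].
  exact: measurable_funS ma.
exists (Num.max 0 M) => z _; rewrite /t le_max; case: ifP => [->|_]; first by rewrite orbT.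
by rewrite Normc.normc0 lexx.
Qed.

Lemma block_invariant_comp (I : eqType) (blk : 'I_n -> I) j (t : C -> C) (a : V -> C) :
  block_invariant blk j a -> block_invariant blk j (fun z => t (a z)).
Proof.
move=> [h1 h2 h3]; split.
- by move=> p u pj u1; apply: filterS (h1 p u pj u1) => z H zB; rewrite H.
- by move=> u u1; apply: filterS (h2 u u1) => z H zB; rewrite H.
- by move=> p q c s pq bpq pj cs s0; apply: filterS (h3 p q c s pq bpq pj cs s0) => z H zB; rewrite H.
Qed.

(** The symbol [a] itself need not be bounded pointwise: its product with [f] is square-integrable
    because it agrees almost everywhere with that of [a']. *)
Lemma toeplitzP (a a' f : V -> C) : 0 < wconst n lambda -> measurable_fun B a ->
  bounded_symbol a' -> {ae v, forall z, B z -> a z = a' z} -> berg f ->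
  berg (toeplitz lambda a f) /\
  forall k, berg k -> ip (toeplitz lambda a f) k = form lambda a' f k.
Proof.
move=> c0 ma ba' aa bf; have Lf := berg_L2 bf; have La := L2_symbol ba' Lf.
have maf : measurable_fun B (fun z => a z * f z) by apply: cmeasurableM => //; exact: Lf.1.
have aaf : {ae v, forall z, B z -> a z * f z = a' z * f z}.
  by apply: filterS aa => z H zB; rewrite H.
have Laf : L2 (fun z => a z * f z).
  by split => //; rewrite -[X in (X < _)%E]/(nsq lambda _) (nsq_ae lambda maf La.1 aaf); exact: La.2.
have [bP HP] := bergman_projectionP c0 Laf; split => // k bk.
by rewrite HP//; apply: ip_ae => //; [exact: La.1|exact: (berg_L2 bk).1].
Qed.

End bounded_representative.

(* This spares a proof that [Gamma] is positive: for a zero weight all inner products vanish. *)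
Lemma toeplitz_wconst0 (R : realType) (n : nat) (lambda : R) (a b f g : 'cV[R[i]]_n -> R[i]) :
  wconst n lambda = 0 -> toeplitz lambda a f = toeplitz lambda b g.
Proof.
move=> w0.
have ip0 (h k : 'cV[R[i]]_n -> R[i]) : inner_product lambda h k = 0.
  rewrite ipE -[RHS](cint0 (@lebesgue_Cn R n) (measurable_unit_ball (R := R) (n := n))).
  by apply: eq_cint => z _; rewrite /ipf weightE w0 mul0r mulr0.
rewrite /toeplitz /bergman_projection; congr xget; apply/seteqP.
by split => h [bh _]; split => // k _; exact: ip0.
Qed.

Theorem theorem6p6 (R : realType) (m n : nat) (k : 'I_m -> nat)
    (hm : (2 <= m)%N) (hk : forall i, (0 < k i)%N)
    (kn : (\sum_(i < m) k i)%N = n) (j1 j2 : 'I_m) (hj : j1 <> j2)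
    (a b : 'cV[R[i]]_n -> R[i]) (ha : Linfty_ball a) (hb : Linfty_ball b)
    (ainv : invariant_symbol (U_block_circle kn j1) a)
    (binv : invariant_symbol (U_block_circle kn j2) b)
    (lambda : R) (hlambda : -1 < lambda) :
  forall f, bergman_space lambda f -> forall z, unit_ball z ->
    toeplitz lambda a (toeplitz lambda b f) z =
    toeplitz lambda b (toeplitz lambda a f) z.
Proof.
have [w0|w0] := eqVneq (wconst n lambda) 0.
  move=> f _ z _.
  by rewrite (toeplitz_wconst0 a b (toeplitz lambda b f) (toeplitz lambda a f) w0).
have c0 : 0 < wconst n lambda by rewrite lt_def w0 wconst_ge0.
have [blk Hblk] := U_block_circle_invariant R kn.
have [t ba aE] := bounded_representative ha.
have [u bb bE] := bounded_representative hb.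
have ia := block_invariant_comp t (Hblk j1 a ainv).
have ib := block_invariant_comp u (Hblk j2 b binv).
apply: (operators_commute hlambda c0 ba bb _ ia ib) => [|f bf|f bf].
- exact/eqP.
- by apply: toeplitzP => //; case: ha.
- by apply: toeplitzP => //; case: hb.
Qed.
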